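(* Let $n>2$, let $\alpha$ be a Riemannian metric of constant sectional curvature $\mu$ on an $n$-dimensional manifold, and let $\beta$ be a Killing form of $\alpha$ with non-constant length satisfying $$t_{00}+(a^2-\mu b^2)\alpha^2+\mu(b^2\alpha^2-\beta^2)-\frac{\mu}{a^2-\mu b^2}s_0^2=0$$ for some constant $a\neq0$. Let $\bar\alpha=e^{\rho(b^2)}\sqrt{\alpha^2-\kappa(b^2)\beta^2}$, $\bar\beta=\nu(b^2)\beta$, and $\Delta:=1-b^2\kappa$. Then $\bar\alpha$ has constant sectional curvature $\bar\mu$ if and only if $\Delta\equiv1$ and, for some constants $C$ and $D$, $$\rho(b^2)=-\ln(C+Db^2),\quad\bar\mu=4CDa^2\qquad\text{when }\mu=0,$$ $$\rho(b^2)=-\ln\big(C+D\sqrt{a^2-\mu b^2}\big),\quad\bar\mu=(C^2-D^2a^2)\mu\qquad\text{when }\mu\neq0.$$ Moreover, in this case, when $\nu=k(1-b^2\kappa)e^{2\rho}$ with $k$ a non-zero constant, $\bar\beta$ is a Killing form of $\bar\alpha$ satisfying $$\bar t_{00}+(\bar a^2-\bar\mu\bar b^2)\bar\alpha^2+\bar\mu(\bar b^2\bar\alpha^2-\bar\beta^2)-\frac{\bar\mu}{\bar a^2-\bar\mu\bar b^2}\bar s_0^2=0,$$ in which $\bar a=\pm ka$.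
   Context: Setting: $M$ is a smooth connected $n$-manifold, $\alpha=\sqrt{a_{ij}(x)y^iy^j}$ is a Riemannian metric on $M$ (viewed as a function of tangent vectors $y$), $\beta=b_i(x)y^i$ is a 1-form, $b:=\|\beta\|_\alpha$. A bar ''$|$'' denotes covariant derivative with respect to the Levi-Civita connection of $\alpha$; indices are raised and lowered with $a_{ij}$. A 1-form is a Killing form if its dual vector field is Killing, i.e. $b_{i|j}+b_{j|i}=0$. Put $s_{ij}:=\frac12(b_{i|j}-b_{j|i})$, $s_i:=b^ms_{mi}$, $s_0:=s_iy^i$, $t_{ij}:=s_{im}s^m{}_j$, $t_{00}:=t_{ij}y^iy^j$. At points where $a^2-\mu b^2=0$ the term $s_0^2/(a^2-\mu b^2)$ is understood as its limit (similarly for barred quantities). Deformation: $\rho,\kappa,\nu$ are smooth functions of the single variable $b^2$, and $\Delta=1-b^2\kappa$ is assumed positive (so that $\bar\alpha$ is a Riemannian metric). The barred quantities $\bar b=\|\bar\beta\|_{\bar\alpha}$, $\bar t_{00}$, $\bar s_0$ are the same objects formed from the pair $(\bar\alpha,\bar\beta)$ (with $\bar\alpha$'s own Levi-Civita connection and index raising). $C,D$ are such that the arguments of the logarithms are positive. ($\bar a$ is a constant, not to be confused with the metric $\bar\alpha$.) *)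

(* Defs.v *)
From HB Require Import structures.
From mathcomp Require Import all_boot all_order all_algebra.
From mathcomp Require Import all_classical all_reals all_analysis.

Set Implicit Arguments.
Unset Strict Implicit.
Unset Printing Implicit Defensive.

Import Order.TTheory GRing.Theory Num.Theory.
Import numFieldNormedType.Exports.

Local Open Scope classical_set_scope.
Local Open Scope ring_scope.

Section Calculus.
Context {R : realType} {n : nat}.

Definition partial (i : 'I_n) (f : 'rV[R]_n -> R) : 'rV[R]_n -> R :=
  fun z => 'D_(delta_mx 0 i) f z.

(* C^oo on the open set U: every iterated partial derivative is
   (Frechet-)differentiable at every point of U. *)
Definition smooth_on (U : set 'rV[R]_n) (f : 'rV[R]_n -> R) : Prop :=
  forall (s : seq 'I_n) z, U z -> differentiable (foldr partial f s) z.

(* L is the value N z / D z, understood as a limit where D vanishes; such a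
   limit only makes sense at a limit point of [D != 0], hence the properness. *)
Definition quotient_value (N D : 'rV[R]_n -> R) (z : 'rV[R]_n) (L : R) : Prop :=
  if D z != 0 then L = N z / D z
  else let F := within [set w | D w != 0] (nbhs z) in
       ProperFilter F /\ N w / D w @[w --> F] --> L.

End Calculus.

(* C^oo on an open set of the real line. *)
Definition smooth1_on {R : realType} (I : set R) (f : R -> R) : Prop :=
  forall (k : nat) t, I t -> derivable (derive1n k f) t 1.

Record smoothManifold (R : realType) (n : nat) := SmoothManifold {
  carrier :> topologicalType;
  mfd_hausdorff : hausdorff_space carrier;
  mfd_second_countable : @second_countable carrier;
  chart : Type;
  dom : chart -> set carrier;
  coord : chart -> carrier -> 'rV[R]_n;
  param : chart -> 'rV[R]_n -> carrier;
  dom_cover : forall x, exists c, dom c x;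
  dom_open : forall c, open (dom c);
  image_open : forall c, open (coord c @` dom c);
  coordK : forall c x, dom c x -> param c (coord c x) = x;
  coord_continuous : forall c, {within dom c, continuous (coord c)};
  param_continuous : forall c, {within coord c @` dom c, continuous (param c)};
  transition_smooth : forall c d j,
    smooth_on (coord c @` (dom c `&` dom d))
              (fun z => coord d (param c z) 0 j)
}.
Arguments chart {R n} M : rename.
Arguments dom {R n M} c : rename.
Arguments coord {R n M} c x : rename.
Arguments param {R n M} c z : rename.

(* Tensor fields are given, as in classical tensor calculus, by their component
   functions in each chart; a value z \in chart_image c is a point of M read in c. *)
Section Fields.
Context {R : realType} {n : nat} (M : smoothManifold R n).

Definition chart_image (c : chart M) : set 'rV[R]_n := coord c @` dom c.

Definition overlap (c d : chart M) : set 'rV[R]_n :=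
  coord c @` (dom c `&` dom d).

Definition transition (c d : chart M) : 'rV[R]_n -> 'rV[R]_n :=
  fun z => coord d (param c z).

Definition oneForm := chart M -> 'rV[R]_n -> 'rV[R]_n.
Definition metricField := chart M -> 'rV[R]_n -> 'M[R]_n.

(* The library's jacobian acts on row vectors: ('J f z) i j is the i-th partial
   derivative of the j-th component of f. *)
Definition is_oneForm (beta : oneForm) : Prop :=
  (forall c i, smooth_on (chart_image c) (fun z => beta c z 0 i)) /\
  (forall c d z, overlap c d z ->
     beta c z = beta d (transition c d z) *m ('J (transition c d) z)^T).

Definition is_riemannian (alpha : metricField) : Prop :=
  [/\ forall c i j, smooth_on (chart_image c) (fun z => alpha c z i j),
      forall c d z, overlap c d z ->
        alpha c z = 'J (transition c d) z *m alpha d (transition c d z)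
                      *m ('J (transition c d) z)^T,
      forall c z, chart_image c z -> (alpha c z)^T = alpha c z
    & forall c z, chart_image c z -> forall y : 'rV[R]_n, y != 0 ->
        0 < (y *m alpha c z *m y^T) 0 0].

End Fields.

(* Below g and b are the components of a metric and of a 1-form in one chart,
   z is a point of the chart and y a tangent vector at z. *)
Section Local.
Context {R : realType} {n : nat}.
Variables (g : 'rV[R]_n -> 'M[R]_n) (b : 'rV[R]_n -> 'rV[R]_n).
Implicit Types (z y u v : 'rV[R]_n) (i j k l m p : 'I_n).

Definition inner z u v : R := (u *m g z *m v^T) 0 0.

Definition metric_fun z y : R := Num.sqrt (inner z y y).

Definition form_fun z y : R := (b z *m y^T) 0 0.

(* b^2 = a^{ij} b_i b_j *)
Definition sqlen z : R := (b z *m invmx (g z) *m (b z)^T) 0 0.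

Definition christoffel k i j z : R :=
  2^-1 * \sum_l invmx (g z) k l *
    (partial i (fun w => g w j l) z + partial j (fun w => g w i l) z
     - partial l (fun w => g w i j) z).

(* R(d_i, d_j) d_k = sum_l (riemann l k i j) d_l *)
Definition riemann l k i j z : R :=
  partial i (christoffel l j k) z - partial j (christoffel l i k) z
  + \sum_m (christoffel l i m z * christoffel m j k z
            - christoffel l j m z * christoffel m i k z).

(* R(u, v) w *)
Definition curvature z u v (w : 'rV[R]_n) : 'rV[R]_n :=
  \row_l \sum_i \sum_j \sum_k riemann l k i j z * u 0 i * v 0 j * w 0 k.

Definition sectional z u v : R :=
  inner z (curvature z u v v) u /
  (inner z u u * inner z v v - inner z u v ^+ 2).

(* b_{i|j} *)
Definition cov i j z : R :=
  partial j (fun w => b w 0 i) z - \sum_k christoffel k i j z * b z 0 k.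

Definition s_mx z : 'M[R]_n := \matrix_(i, j) (2^-1 * (cov i j z - cov j i z)).

(* s_i = b^m s_{mi} *)
Definition s_row z : 'rV[R]_n := b z *m invmx (g z) *m s_mx z.

Definition s0 z y : R := (s_row z *m y^T) 0 0.

(* t_{ij} = s_{im} a^{mk} s_{kj} *)
Definition t_mx z : 'M[R]_n := s_mx z *m invmx (g z) *m s_mx z.

Definition t00 z y : R := (y *m t_mx z *m y^T) 0 0.

Definition structure_eq (a mu : R) z y : Prop :=
  exists2 L : R,
    quotient_value (fun w => s0 w y ^+ 2)
                   (fun w => a ^+ 2 - mu * sqlen w) z L &
    t00 z y + (a ^+ 2 - mu * sqlen z) * metric_fun z y ^+ 2
      + mu * (sqlen z * metric_fun z y ^+ 2 - form_fun z y ^+ 2)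
      - mu * L = 0.

End Local.

Section Global.
Context {R : realType} {n : nat} {M : smoothManifold R n}.
Implicit Types (alpha : metricField M) (beta : oneForm M).

Definition constant_sectional_curvature alpha (mu : R) : Prop :=
  forall c z, chart_image c z -> forall u v : 'rV[R]_n,
    row_free (col_mx u v) -> sectional (alpha c) z u v = mu.

Definition killing alpha beta : Prop :=
  forall c z, chart_image c z -> forall i j : 'I_n,
    cov (alpha c) (beta c) i j z + cov (alpha c) (beta c) j i z = 0.

Definition satisfies_structure_eq alpha beta (a mu : R) : Prop :=
  forall c z, chart_image c z -> forall y : 'rV[R]_n,
    structure_eq (alpha c) (beta c) a mu z y.

(* The values taken on M by the function b^2. *)
Definition sqlen_values alpha beta : set R :=
  [set t | exists (c : chart M) (z : 'rV[R]_n),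
             chart_image c z /\ t = sqlen (alpha c) (beta c) z].

Definition deform_metric (rho kappa : R -> R) alpha beta : metricField M :=
  fun c z => let t := sqlen (alpha c) (beta c) z in
    expR (rho t) ^+ 2 *: (alpha c z - kappa t *: ((beta c z)^T *m beta c z)).

Definition deform_form (nu : R -> R) alpha beta : oneForm M :=
  fun c z => nu (sqlen (alpha c) (beta c) z) *: beta c z.

Lemma deform_metricE rho kappa alpha beta c z y :
  is_riemannian alpha -> chart_image c z ->
  metric_fun (deform_metric rho kappa alpha beta c) z y =
  expR (rho (sqlen (alpha c) (beta c) z)) *
  Num.sqrt (metric_fun (alpha c) z y ^+ 2
            - kappa (sqlen (alpha c) (beta c) z) * form_fun (beta c) z y ^+ 2).
Proof.
move=> [_ _ _ pos] cz; rewrite /metric_fun sqr_sqrtr; last first.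
  have [->|y0] := eqVneq y 0; first by rewrite /inner trmx0 mulmx0 mxE.
  exact/ltW/pos.
rewrite /inner /deform_metric -scalemxAr -scalemxAl [in LHS]mxE.
rewrite sqrtrM ?sqr_ge0// sqrtr_sqr ger0_norm ?expR_ge0//.
congr (_ * Num.sqrt _).
have E : y *m ((beta c z)^T *m beta c z) *m y^T =
         (beta c z *m y^T)^T *m (beta c z *m y^T).
  by rewrite trmx_mul trmxK !mulmxA.
rewrite mulmxBr mulmxBl -scalemxAr -scalemxAl E [LHS]mxE; congr (_ + _).
rewrite [LHS]mxE [X in - X]mxE; congr (- (_ * _)).
by rewrite [LHS]mxE big_ord1 [X in X * _]mxE /form_fun expr2.
Qed.

Lemma deform_formE nu alpha beta c z y :
  form_fun (deform_form nu alpha beta c) z y =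
  nu (sqlen (alpha c) (beta c) z) * form_fun (beta c) z y.
Proof. by rewrite /form_fun /deform_form -scalemxAl mxE. Qed.

End Global.

(* Main.v *)
Require Import Defs.
From mathcomp Require Import all_boot all_order all_algebra perm.
From mathcomp Require Import all_classical all_reals all_analysis.
From mathcomp Require Import ring lra.

Import Order.TTheory GRing.Theory Num.Theory.
Import numFieldNormedType.Exports.

Local Open Scope classical_set_scope.
Local Open Scope ring_scope.

Set Implicit Arguments.
Unset Strict Implicit.
Unset Printing Implicit Defensive.

(* Let X be the vector dual to beta, J the endomorphism s^i_j and S = - J X, so that the
   gradient of f = b^2 is 2 S. For a Killing form of a metric of constant curvature mu the
   covariant derivative of s is - mu (b /\ g), and the structure equation reads
   J^2 = - a^2 + mu b (x) X + (mu / p) s (x) S with p = a^2 - mu f; hence |S|^2 = f p and the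
   covariant derivative of S in the direction u is p u - (mu / p) s(u) S. All computations
   take place at the points where f and p are nonzero, which are dense; the remaining
   points follow by continuity.

   The connection of the deformed metric differs from that of alpha by an explicit tensor T,
   which gives its curvature. Choose y orthogonal to X and S (n > 2). Writing k = kappa(f),
   r = 2 rho' and E = e^(2 rho), constant curvature mubar imposes, on the components
   (J y, S, X, y), (y, X, X, y) and (y, J y, J y, y),
     k' f + k = 0,
     p (1 + r f)^2 = a^2 (1 - k f) - mubar E f,
     p (1 + r f)^2 = a^2 (4 - 3 (1 - k f)) - mubar E f,
   so k f = 0 and the deformation is conformal. The components (y, S, S, y) and
   (y, J y, J y, y) of a conformal deformation amount to
     2 p (rho'' - rho'^2) = mu rho',   mu - 2 r p - r^2 f p = mubar E,
   the first of which says that e^(- rho) is affine in f if mu = 0 and in sqrt p otherwise.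
   The barred structure equation is a consequence of the same two identities, since
   abar^2 - mubar bbar^2 = c^2 p (1 + r f)^2 where nu = c e^(2 rho). *)

(** * Smooth functions *)

(** The choice of y is what makes the elimination possible: J y is again orthogonal to X and S, and
    J^2 y = - a^2 y, so X, S, y and J y have a closed multiplication table. In the three components
    used, every derivative that would bring in kappa'' or rho'' has coefficient zero, and only an
    algebraic system remains. The obstacle is the set of degenerate points. Since |S|^2 = f p, both
    f and p are nonnegative, so the values 0 and a^2 / mu of b^2 can only be endpoints of the
    interval of values; removing them leaves an interval on which the equations for rho can be
    integrated. Identities that must reach the degenerate points are first cleared of their
    denominators, so that both sides are smooth. In the converse, rho is known only on the values of
    b^2, and its formula can be differentiated only at interior values; those taken at regular
    points are interior because the gradient 2 S is nonzero there. The Killing property of betabar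
    has a geometric reason: with nu = c e^(2 rho) the dual field of betabar for the conformal metric
    is c X, and the flow of X preserves g and f, hence also e^(2 rho) g. *)

Section DerivativeRules.
Context {R : realType} {V : normedModType R}.
Implicit Types (F G : V -> R) (z v : V).

Lemma isd_cst z v (c : R) : is_derive z v (fun=> c) 0.
Proof. exact: is_derive_cst. Qed.

Lemma isdD z v F G dF dG : is_derive z v F dF -> is_derive z v G dG ->
  is_derive z v (fun w => F w + G w) (dF + dG).
Proof. by move=> ? ?; exact: is_deriveD. Qed.

Lemma isdN z v F dF : is_derive z v F dF -> is_derive z v (fun w => - F w) (- dF).
Proof. by move=> ?; exact: is_deriveN. Qed.

Lemma isdM z v F G dF dG : is_derive z v F dF -> is_derive z v G dG ->
  is_derive z v (fun w => F w * G w) (dF * G z + F z * dG).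
Proof.
move=> ? ?; apply: (is_derive_eq (is_deriveM _ _)).
by rewrite /GRing.scale/= addrC mulrC.
Qed.

Lemma isdX2 z v F dF : is_derive z v F dF ->
  is_derive z v (fun w => F w ^+ 2) (2 * F z * dF).
Proof.
move=> dF2; have := isdM dF2 dF2; rewrite (_ : _ + _ = 2 * F z * dF); last by ring.
by rewrite (_ : (fun w => F w * F w) = (fun w => F w ^+ 2)).
Qed.

Lemma isd_sum z v (n : nat) (F : 'I_n -> V -> R) (dF : 'I_n -> R) :
  (forall i, is_derive z v (F i) (dF i)) ->
  is_derive z v (fun w => \sum_i F i w) (\sum_i dF i).
Proof.
move=> dFi; rewrite (_ : (fun w => _) = \sum_i F i); first exact: is_derive_sum.
by apply/funext => w; rewrite fct_sumE.
Qed.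

(** Both difference quotients are the same function of [h]. Directional derivatives thus become
    ordinary ones, to which the one-variable chain rule and the mean value theorem apply. *)
Lemma derive_line z v F :
  'D_1 (fun t : R => F (t *: v + z)) 0 = 'D_v F z.
Proof.
rewrite /derive; set g1 := fun h => h^-1 *: _; set g2 := fun h => h^-1 *: _.
suff -> : g1 = g2 by [].
by rewrite funeqE /g1 /g2 => h /=; rewrite addr0 scale0r add0r [_%:A]mulr1.
Qed.

Lemma isd_line z v F dF : is_derive z v F dF ->
  is_derive (0 : R) 1 (fun t : R => F (t *: v + z)) dF.
Proof.
move=> Fd; apply: DeriveDef.
  by apply: (derivable1P F z v).1; exact: ex_derive.
by rewrite derive_line; exact: derive_val.
Qed.

Lemma isd_of_line z v F dF :
  is_derive (0 : R) 1 (fun t : R => F (t *: v + z)) dF -> is_derive z v F dF.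
Proof.
move=> Fd; apply: DeriveDef.
  by apply: (derivable1P F z v).2; exact: ex_derive.
by rewrite -derive_line; exact: derive_val.
Qed.

Lemma isd_comp z v (h : R -> R) F dh dF :
  is_derive (F z) 1 h dh -> is_derive z v F dF ->
  is_derive z v (fun w => h (F w)) (dh * dF).
Proof.
move=> hd Fd; apply: isd_of_line.
have F0 : (fun t : R => F (t *: v + z)) 0 = F z by rewrite scale0r add0r.
have hd1 : is_derive ((fun t : R => F (t *: v + z)) 0) 1 h dh by rewrite F0.
have := @is_derive1_comp _ h (fun t => F (t *: v + z)) 0 dh dF hd1 (isd_line Fd).
by [].
Qed.

End DerivativeRules.

Lemma isd_line_at {R : realType} {V : normedModType R} (F : V -> R) z v s dF :
  is_derive (s *: v + z) v F dF ->
  is_derive s 1 (fun t : R => F (t *: v + z)) dF.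
Proof.
move=> /isd_line Fd.
have Hs : is_derive s (1 : R) (fun t : R => t - s) 1.
  by apply: (is_derive_eq (isdD (is_derive_id _ _) (isd_cst s 1 (- s)))); rewrite addr0.
have Fd' : is_derive (s - s) 1 (fun t : R => F (t *: v + (s *: v + z))) dF.
  by rewrite subrr.
have := @is_derive1_comp _ (fun t : R => F (t *: v + (s *: v + z))) (fun t => t - s) _ _ _ Fd' Hs.
rewrite mulr1.
rewrite (_ : _ \o _ = (fun t : R => F (t *: v + z))) //.
by apply/funext => t /=; rewrite addrA -scalerDl subrK.
Qed.

Section CoordinateDerivatives.
Context {R : realType} {V : normedModType R} {n : nat}.

Lemma isd_coord (F : V -> 'rV[R]_n) z v dF i :
  is_derive z v F dF -> is_derive z v (fun w => F w 0 i) (dF 0 i).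
Proof.
move=> Fd; have D : derivable F z v by exact: ex_derive.
have Di := (derivable_mxP F z v).1 D 0 i.
have FE : 'D_v F z = dF by exact: derive_val.
by apply: DeriveDef => //; rewrite -FE derive_mx // mxE.
Qed.

Lemma isd_row (F : V -> 'rV[R]_n) z v (dF : 'rV[R]_n) :
  (forall i, is_derive z v (fun w => F w 0 i) (dF 0 i)) -> is_derive z v F dF.
Proof.
move=> Fd; have D : derivable F z v.
  by apply/derivable_mxP => i j; rewrite ord1; exact: ex_derive.
apply: DeriveDef => //; rewrite derive_mx //; apply/rowP => j.
by rewrite mxE derive_val.
Qed.

End CoordinateDerivatives.

(** Differentiability is local: ['d f z] also gives a first-order expansion of [g], and uniqueness
    of the differential identifies it with ['d g z]. *)
Lemma near_eq_differentiable {R : realType} {V W : normedModType R}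
  (f g : V -> W) z :
  (\near z, f z = g z) -> differentiable f z -> differentiable g z.
Proof.
move=> fg /diff_locallyP [dc df].
have fgz : f z = g z by exact: nbhs_singleton fg.
have key : g \o shift z = cst (g z) + 'd f z +o_ 0 id.
  apply/eqaddoP => _/posnumP[e].
  have /eqaddoP/(_ e%:num) H := df.
  have fg0 : \forall y \near (0 : V), f (y + z) = g (y + z).
    by move: fg; rewrite (near_shift 0 z) /= subr0.
  near=> y; have -> : (g \o shift z - (cst (g z) + 'd f z)) y =
                      (f \o shift z - (cst (f z) + 'd f z)) y.
    by rewrite !fctE /= fgz; congr (_ - _); apply/esym; near: y.
  by near: y; exact: H.
have E := diff_unique dc key.
apply/diff_locallyP; split; first by rewrite E.
by rewrite E.
Unshelve. all: by end_near. Qed.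

Section Smooth.
Context {R : realType} {n : nat}.
Local Notation V := 'rV[R]_n.
Implicit Types (U : set V) (f g : V -> R) (z u v : V).

Lemma isd_partial f z i : differentiable f z ->
  is_derive z (delta_mx 0 i) f (partial i f z).
Proof. by move=> /(@diff_derivable _ _ _ f z (delta_mx 0 i))/derivableP. Qed.

Lemma derive_partial f z v : differentiable f z ->
  'D_v f z = \sum_i v 0 i * partial i f z.
Proof.
move=> df; rewrite deriveE // {1}(row_sum_delta v) linear_sum /=.
by apply: eq_bigr => i _; rewrite linearZ /= /partial deriveE.
Qed.

Lemma near_eq_partial f g z i : (\near z, f z = g z) ->
  partial i f z = partial i g z.
Proof. exact: near_eq_derive. Qed.

(** Smoothness of order [k], peeling off the innermost partial derivative. Unlike the lists in
    [smooth_on], it allows induction on [k] in the product, inverse and chain rules. *)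
Fixpoint diff_upto U (k : nat) f : Prop :=
  (forall z, U z -> differentiable f z) /\
  if k is k'.+1 then forall i, diff_upto U k' (partial i f) else True.

Lemma smooth_onP U f : smooth_on U f <-> forall k, diff_upto U k f.
Proof.
split=> [sf k|df s].
  elim: k f sf => [|k IH] f sf /=; split=> //; try by move=> z; exact: (sf [::]).
  by move=> i; apply: IH => s z Uz; have := sf (rcons s i) z Uz; rewrite foldr_rcons.
elim/last_ind: s f df => [|s i IH] f df z Uz; first exact: (df 0%N).1.
by rewrite foldr_rcons; apply: IH => // k; exact: (df k.+1).2.
Qed.

Lemma diff_upto0 U k f : diff_upto U k f -> forall z, U z -> differentiable f z.
Proof. by case: k => [|k] []. Qed.

Lemma diff_uptoW U k f : diff_upto U k.+1 f -> diff_upto U k f.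
Proof.
elim: k f => [|k IH] f [df dpf]; first by split.
by split=> // i; exact: IH.
Qed.

Lemma near_eq_open (W : Type) U (f g : V -> W) z : open U -> (forall z, U z -> f z = g z) -> U z ->
  \near z, f z = g z.
Proof.
by move=> oU fg Uz; near=> w; apply: fg; near: w; exact: open_nbhs_nbhs.
Unshelve. all: by end_near. Qed.

Lemma eq_diff_upto U k f g : open U -> (forall z, U z -> f z = g z) ->
  diff_upto U k f -> diff_upto U k g.
Proof.
move=> oU; elim: k f g => [|k IH] f g fg [df dpf]; split=> //.
- by move=> z Uz; apply: near_eq_differentiable (df z Uz); exact: near_eq_open Uz.
- by move=> z Uz; apply: near_eq_differentiable (df z Uz); exact: near_eq_open Uz.
- move=> i; apply: IH (dpf i) => z Uz.
  by apply: near_eq_partial; exact: near_eq_open Uz.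
Qed.

Lemma diff_upto_cst U k (c : R) : open U -> diff_upto U k (fun=> c).
Proof.
move=> oU; elim: k c => [|k IH] c; split=> //; try by move=> z _; exact: differentiable_cst.
move=> i; apply: (eq_diff_upto (f := fun=> 0)) => // z _.
by rewrite /partial derive_cst.
Qed.

Lemma diff_uptoD U k f g : open U -> diff_upto U k f -> diff_upto U k g ->
  diff_upto U k (fun z => f z + g z).
Proof.
move=> oU; elim: k f g => [|k IH] f g [df dpf] [dg dpg].
  by split=> // z Uz; apply: differentiableD; [exact: df|exact: dg].
split; first by move=> z Uz; apply: differentiableD; [exact: df|exact: dg].
move=> i; apply: (eq_diff_upto _ _ (IH _ _ (dpf i) (dpg i))) => // z Uz.
by apply/esym/(@derive_val _ _ _ _ _ (fun w => f w + g w))/isdD; apply: isd_partial;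
  [exact: df|exact: dg].
Qed.

Lemma diff_uptoM U k f g : open U -> diff_upto U k f -> diff_upto U k g ->
  diff_upto U k (fun z => f z * g z).
Proof.
move=> oU; elim: k f g => [|k IH] f g [df dpf] [dg dpg].
  by split=> // z Uz; apply: differentiableM; [exact: df|exact: dg].
split; first by move=> z Uz; apply: differentiableM; [exact: df|exact: dg].
move=> i; apply: (eq_diff_upto (f := fun z => partial i f z * g z + f z * partial i g z)) => //.
- move=> z Uz; apply/esym/(@derive_val _ _ _ _ _ (fun w => f w * g w)).
  by apply: isdM; apply: isd_partial; [exact: df|exact: dg].
- have kf : diff_upto U k f by apply: diff_uptoW.
  have kg : diff_upto U k g by apply: diff_uptoW.
  by apply: diff_uptoD => //; [exact: (IH _ _ (dpf i) kg)|exact: (IH _ _ kf (dpg i))].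
Qed.

Lemma diff_upto_comp U k (I : set R) (h : R -> R) f : open U ->
  smooth1_on I h -> (forall z, U z -> I (f z)) ->
  diff_upto U k f -> diff_upto U k (fun z => h (f z)).
Proof.
move=> oU; elim: k h => [|k IH] h sh fI df.
  split=> // z Uz; apply: differentiable_comp; first exact: (diff_upto0 df).
  by apply/derivable1_diffP; exact: (sh 0%N _ (fI _ Uz)).
split.
  move=> z Uz; apply: differentiable_comp; first exact: (diff_upto0 df).
  by apply/derivable1_diffP; exact: (sh 0%N _ (fI _ Uz)).
move=> i; apply: (eq_diff_upto (f := fun z => derive1 h (f z) * partial i f z)) => //.
- move=> z Uz; apply/esym/(@derive_val _ _ _ _ _ (fun w => h (f w))).
  apply: isd_comp; last exact/isd_partial/(diff_upto0 df).
  rewrite derive1E; apply: derivableP; exact: (sh 0%N _ (fI _ Uz)).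
- apply: diff_uptoM => //; last exact: df.2.
  apply: IH => //; last exact: diff_uptoW.
  by move=> j t It; rewrite -derive1Sn; exact: sh.
Qed.

Lemma diff_uptoV U k f : open U -> (forall z, U z -> f z != 0) ->
  diff_upto U k f -> diff_upto U k (fun z => (f z)^-1).
Proof.
move=> oU f0; elim: k => [|k IH] df.
  by split=> // z Uz; apply: differentiableV; [exact: (diff_upto0 df)|exact: f0].
split.
  by move=> z Uz; apply: differentiableV; [exact: (diff_upto0 df)|exact: f0].
have IH' := IH (diff_uptoW df).
move=> i; apply: (eq_diff_upto
  (f := fun z => -1 * ((f z)^-1 * (f z)^-1 * partial i f z))) => //.
- move=> z Uz; rewrite {2}/partial.
  rewrite -[X in _ = X]/('D_(delta_mx 0 i) (fun w => (f w)^-1) z) deriveV ?f0//.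
    by rewrite -exprVn expr2 mulN1r scaleNr.
  by apply: diff_derivable; exact: (diff_upto0 df).
- apply: diff_uptoM => //; first exact: diff_upto_cst.
  apply: diff_uptoM => //; last exact: df.2.
  exact: diff_uptoM.
Qed.

Lemma smooth_on_diff U f z : smooth_on U f -> U z -> differentiable f z.
Proof. exact: (fun h => h [::] z). Qed.

Lemma smooth_on_derivable U f z v : smooth_on U f -> U z ->
  is_derive z v f ('D_v f z).
Proof. by move=> sf Uz; apply/derivableP/diff_derivable; exact: smooth_on_diff sf Uz. Qed.

Lemma smooth_on_continuous U f z : smooth_on U f -> U z -> {for z, continuous f}.
Proof. by move=> sf Uz; apply/differentiable_continuous; exact: smooth_on_diff sf Uz. Qed.

Lemma smooth_on_partial U f i : smooth_on U f -> smooth_on U (partial i f).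
Proof. by move=> /smooth_onP sf; apply/smooth_onP => k; exact: (sf k.+1).2. Qed.

Lemma eq_smooth_on U f g : open U -> (forall z, U z -> f z = g z) ->
  smooth_on U f -> smooth_on U g.
Proof.
by move=> oU fg /smooth_onP sf; apply/smooth_onP => k; exact: eq_diff_upto (sf k).
Qed.

Lemma smooth_on_cst U (c : R) : open U -> smooth_on U (fun=> c).
Proof. by move=> oU; apply/smooth_onP => k; exact: diff_upto_cst. Qed.

Lemma smooth_onD U f g : open U -> smooth_on U f -> smooth_on U g ->
  smooth_on U (fun z => f z + g z).
Proof.
move=> oU /smooth_onP sf /smooth_onP sg; apply/smooth_onP => k.
exact: diff_uptoD.
Qed.

Lemma smooth_onM U f g : open U -> smooth_on U f -> smooth_on U g ->
  smooth_on U (fun z => f z * g z).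
Proof.
move=> oU /smooth_onP sf /smooth_onP sg; apply/smooth_onP => k.
exact: diff_uptoM.
Qed.

Lemma smooth_onN U f : open U -> smooth_on U f -> smooth_on U (fun z => - f z).
Proof.
move=> oU sf; apply: (eq_smooth_on (f := fun z => -1 * f z)) => //.
  by move=> z _; rewrite mulN1r.
by apply: smooth_onM => //; exact: smooth_on_cst.
Qed.

Lemma smooth_on_sum U (J : Type) (r : seq J) (F : J -> V -> R) : open U ->
  (forall i, smooth_on U (F i)) -> smooth_on U (fun z => \sum_(i <- r) F i z).
Proof.
move=> oU sF; elim: r => [|i r IH].
  by apply: (eq_smooth_on (f := fun=> 0)); [|move=> z _; rewrite big_nil|exact: smooth_on_cst].
apply: (eq_smooth_on (f := fun z => F i z + \sum_(j <- r) F j z)) => //.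
  by move=> z _; rewrite big_cons.
exact: smooth_onD.
Qed.

Lemma smooth_on_prod U (J : Type) (r : seq J) (F : J -> V -> R) : open U ->
  (forall i, smooth_on U (F i)) -> smooth_on U (fun z => \prod_(i <- r) F i z).
Proof.
move=> oU sF; elim: r => [|i r IH].
  by apply: (eq_smooth_on (f := fun=> 1)); [|move=> z _; rewrite big_nil|exact: smooth_on_cst].
apply: (eq_smooth_on (f := fun z => F i z * \prod_(j <- r) F j z)) => //.
  by move=> z _; rewrite big_cons.
exact: smooth_onM.
Qed.

Lemma smooth_onV U f : open U -> (forall z, U z -> f z != 0) ->
  smooth_on U f -> smooth_on U (fun z => (f z)^-1).
Proof.
by move=> oU f0 /smooth_onP sf; apply/smooth_onP => k; exact: diff_uptoV.
Qed.

Lemma smooth_on_comp U (I : set R) (h : R -> R) f : open U ->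
  smooth1_on I h -> (forall z, U z -> I (f z)) -> smooth_on U f ->
  smooth_on U (fun z => h (f z)).
Proof.
by move=> oU sh fI /smooth_onP sf; apply/smooth_onP => k; exact: diff_upto_comp sh _ _.
Qed.

Lemma smooth_on_derive U f v : open U -> smooth_on U f ->
  smooth_on U (fun z => 'D_v f z).
Proof.
move=> oU sf; apply: (eq_smooth_on (f := fun z => \sum_i v 0 i * partial i f z)) => //.
  by move=> z Uz; rewrite derive_partial //; exact: smooth_on_diff sf Uz.
apply: smooth_on_sum => // i; apply: smooth_onM => //; first exact: smooth_on_cst.
exact: smooth_on_partial.
Qed.

(** The mean value theorem is applied twice: along [u] to the first difference in the direction [v],
    then along [v] to ['D_u f]. *)
Lemma mean_value_mixed U f u v z (h : R) : open U -> smooth_on U f -> 0 < h ->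
  (forall s t, 0 <= s <= h -> 0 <= t <= h -> U (s *: u + (t *: v + z))) ->
  exists s t, [/\ 0 <= s <= h, 0 <= t <= h &
    f (h *: u + (h *: v + z)) - f (h *: u + z) - (f (h *: v + z) - f z)
    = 'D_v (fun w => 'D_u f w) (s *: u + (t *: v + z)) * h * h].
Proof.
move=> oU sf h0 hU.
have hU0 s : 0 <= s <= h -> U (s *: u + z).
  by move=> hs; have := hU s 0 hs; rewrite lexx (ltW h0) scale0r add0r; exact.
have hh : 0 <= h <= h by rewrite lexx ltW.
pose phi s := f (s *: u + (h *: v + z)) - f (s *: u + z).
have dphi s : 0 <= s <= h -> is_derive s 1 phi
    ('D_u f (s *: u + (h *: v + z)) - 'D_u f (s *: u + z)).
  move=> hs; apply: isdD; last apply: isdN; apply: isd_line_at.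
    by apply: (smooth_on_derivable _ sf); exact: hU.
  by apply: (smooth_on_derivable _ sf); exact: hU0.
have [s /[!in_itv]/= /andP[s0 sh] phiE] : exists2 c, c \in `]0, h[ &
    phi h - phi 0 = ('D_u f (c *: u + (h *: v + z)) - 'D_u f (c *: u + z)) * (h - 0).
  apply: (MVT (df := fun c => 'D_u f (c *: u + (h *: v + z)) - 'D_u f (c *: u + z))).
    by []. 
    by move=> c /[!in_itv]/= /andP[c0 ch]; apply: dphi; rewrite !ltW.
  apply: derivable_within_continuous => c /[!in_itv]/= hc.
  by apply: ex_derive; exact: dphi.
have hs : 0 <= s <= h by rewrite !ltW.
pose psi t := 'D_u f (t *: v + (s *: u + z)).
have comm t : t *: v + (s *: u + z) = s *: u + (t *: v + z).
  by rewrite addrCA.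
have dpsi t : 0 <= t <= h -> is_derive t 1 psi
    ('D_v (fun w => 'D_u f w) (s *: u + (t *: v + z))).
  move=> ht; apply: (isd_line_at (F := fun w => 'D_u f w)); rewrite comm.
  by apply: (smooth_on_derivable _ (smooth_on_derive u oU sf)); exact: hU.
have [t /[!in_itv]/= /andP[t0 th] psiE] : exists2 c, c \in `]0, h[ &
    psi h - psi 0 = 'D_v (fun w => 'D_u f w) (s *: u + (c *: v + z)) * (h - 0).
  apply: (MVT (df := fun c => 'D_v (fun w => 'D_u f w) (s *: u + (c *: v + z)))).
    by [].
    by move=> c /[!in_itv]/= /andP[c0 ch]; apply: dpsi; rewrite !ltW.
  apply: derivable_within_continuous => c /[!in_itv]/= hc.
  by apply: ex_derive; exact: dpsi.
exists s, t; split => //; first by rewrite !ltW.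
move: phiE psiE; rewrite /phi /psi !comm !scale0r !add0r !subr0 => -> ->.
by [].
Qed.

(** Schwarz's theorem. The second difference over the parallelogram with sides [h *: u] and [h *: v]
    is symmetric in [u] and [v], so the two mixed derivatives agree at two points near [z]; by
    continuity they cannot differ at [z]. *)
Lemma derive_comm U f u v z : open U -> smooth_on U f -> U z ->
  'D_u (fun w => 'D_v f w) z = 'D_v (fun w => 'D_u f w) z.
Proof.
move=> oU sf Uz.
set A := fun w => 'D_v (fun w => 'D_u f w) w; set B := fun w => 'D_u (fun w => 'D_v f w) w.
rewrite -/(A z) -/(B z); apply/eqP/negPn/negP => neAB.
have cont w1 w2 : {for z, continuous (fun w => 'D_w1 (fun w => 'D_w2 f w) w)}.
  by apply: (smooth_on_continuous _ Uz); do 2! apply: smooth_on_derive => //.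
pose e := `|A z - B z| / 2.
have e0 : 0 < e by rewrite divr_gt0 // normr_gt0 subr_eq0 eq_sym.
have [d /= d0 hd] : exists2 d : R, 0 < d & forall w, ball z d w ->
    [/\ U w, `|A z - A w| < e & `|B z - B w| < e].
  have nU : nbhs z U by exact: open_nbhs_nbhs.
  have /cvgrPdist_lt/(_ e e0) nA := cont v u.
  have /cvgrPdist_lt/(_ e e0) nB := cont u v.
  have [d d0 hd] := (nbhs_ballP _ _).1 (filterI nU (filterI nA nB)).
  exists d; first exact: d0.
  move=> w wd; have [h1 [h2 h3]] := hd w wd.
  by split; [exact: h1|exact: h2|exact: h3].
(* With this side length the whole parallelogram stays within d / 2 of [z]; the summand 1 keeps the
   denominator positive. *)
pose h := d / 2 / (`|u| + `|v| + 1).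
have N0 : 0 < `|u| + `|v| + 1 by rewrite ltr_wpDl // addr_ge0.
have h0 : 0 < h by rewrite !divr_gt0.
have inb s t : 0 <= s <= h -> 0 <= t <= h -> ball z d (s *: u + (t *: v + z)).
  move=> /andP[s0 sh] /andP[t0 th].
  rewrite -ball_normE /ball_ /= addrA opprD addrCA subrr addr0 normrN.
  apply: (le_lt_trans (ler_normD _ _)); rewrite !normrZ !ger0_norm //.
  apply: (@le_lt_trans _ _ (h * (`|u| + `|v| + 1))).
    rewrite !mulrDr mulr1 -[leLHS]addr0 lerD ?(ltW h0)//.
    by apply: lerD; apply: ler_wpM2r.
  by rewrite /h divfK ?gt_eqF// ltr_pdivrMr // ltr_pMr // ltr1n.
have [s [t [hs ht E1]]] := mean_value_mixed oU sf h0 (fun s t hs ht => let: And3 x _ _ := hd _ (inb s t hs ht) in x).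
have inb' s' t' : 0 <= s' <= h -> 0 <= t' <= h -> ball z d (s' *: v + (t' *: u + z)).
  by move=> hs' ht'; rewrite addrCA; exact: inb.
have [s' [t' [hs' ht' E2]]] := mean_value_mixed oU sf h0 (fun s t hs ht => let: And3 x _ _ := hd _ (inb' s t hs ht) in x).
have AB : A (s *: u + (t *: v + z)) = B (s' *: v + (t' *: u + z)).
  apply: (@mulIf _ h); first by rewrite gt_eqF.
  apply: (@mulIf _ h); first by rewrite gt_eqF.
  apply: (etrans (esym E1)).
  apply: (etrans _ E2).
  rewrite [h *: v + (h *: u + z)]addrCA.
  move: (f _) (f _) (f _) (f _) => x1 x2 x3 x4; ring.
have [_ hA _] := hd _ (inb s t hs ht); have [_ _ hB] := hd _ (inb' s' t' hs' ht').
have : `|A z - B z| < e + e.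
  rewrite -(subrKA (A (s *: u + (t *: v + z)))).
  apply: (le_lt_trans (ler_normD _ _)); apply: ltrD; first exact: hA.
  by rewrite AB distrC; exact: hB.
by rewrite /e -splitr ltxx.
Qed.

End Smooth.

Lemma smooth1_on_derive1 {R : realType} (I : set R) (h : R -> R) :
  smooth1_on I h -> smooth1_on I (derive1 h).
Proof. by move=> sh j t It; rewrite -derive1Sn; exact: sh. Qed.

Lemma smooth1_on_isd {R : realType} (I : set R) (h : R -> R) t :
  smooth1_on I h -> I t -> is_derive t 1 h (derive1 h t).
Proof. by move=> sh It; rewrite derive1E; apply: derivableP; exact: (sh 0%N). Qed.

Lemma smooth1_on_expR {R : realType} (I : set R) : smooth1_on I (@expR R).
Proof.
move=> k t _; rewrite (_ : derive1n k expR = expR); first exact: derivable_expR.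
by elim: k => // k IH; rewrite derive1nS IH; apply/funext => r; rewrite derive1E derive_val.
Qed.

(** * Metrics and the Levi-Civita connection *)

Section Bilinear.
Context {R : realType} {n : nat}.
Implicit Types (A : 'M[R]_n) (u v w : 'rV[R]_n) (c : R).

(** Taken for an arbitrary matrix, so that the same rules serve the metric, the form s and the
    covariant derivative of b. *)
Definition bil A u v : R := (u *m A *m v^T) 0 0.

Definition dot u v : R := (u *m v^T) 0 0.

Lemma innerE (g : 'rV[R]_n -> 'M[R]_n) z u v : inner g z u v = bil (g z) u v.
Proof. by []. Qed.

Lemma form_funE (b : 'rV[R]_n -> 'rV[R]_n) z u : form_fun b z u = dot (b z) u.
Proof. by []. Qed.

Lemma bilDl A u v w : bil A (u + v) w = bil A u w + bil A v w.
Proof. by rewrite /bil !mulmxDl mxE. Qed.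
Lemma bilDr A u v w : bil A w (u + v) = bil A w u + bil A w v.
Proof. by rewrite /bil linearD /= mulmxDr mxE. Qed.
Lemma bilNl A u w : bil A (- u) w = - bil A u w.
Proof. by rewrite /bil !mulNmx mxE. Qed.
Lemma bilNr A u w : bil A w (- u) = - bil A w u.
Proof. by rewrite /bil linearN /= mulmxN mxE. Qed.
Lemma bilZl A c u w : bil A (c *: u) w = c * bil A u w.
Proof. by rewrite /bil -!scalemxAl mxE. Qed.
Lemma bilZr A c u w : bil A w (c *: u) = c * bil A w u.
Proof. by rewrite /bil linearZ /= -scalemxAr mxE. Qed.
Lemma bil0l A w : bil A 0 w = 0.
Proof. by rewrite /bil !mul0mx mxE. Qed.
Lemma bil0r A w : bil A w 0 = 0.
Proof. by rewrite /bil linear0 mulmx0 mxE. Qed.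

Lemma dotDr u v w : dot w (u + v) = dot w u + dot w v.
Proof. by rewrite /dot linearD /= mulmxDr mxE. Qed.
Lemma dotNr u w : dot w (- u) = - dot w u.
Proof. by rewrite /dot linearN /= mulmxN mxE. Qed.
Lemma dotZl c u w : dot (c *: u) w = c * dot u w.
Proof. by rewrite /dot -scalemxAl mxE. Qed.
Lemma dotZr c u w : dot w (c *: u) = c * dot w u.
Proof. by rewrite /dot linearZ /= -scalemxAr mxE. Qed.

Lemma dot0r w : dot w 0 = 0.
Proof. by rewrite -[0](scale0r 0) dotZr mul0r. Qed.

Definition bilE := (bilDl, bilDr, bilNl, bilNr, bilZl, bilZr, bil0l, bil0r).
Definition dotE := (dotDr, dotNr, dotZr, dot0r).

Lemma bil_sum A u v : bil A u v = \sum_i \sum_j u 0 i * A i j * v 0 j.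
Proof.
rewrite /bil mxE exchange_big /=; apply: eq_bigr => j _.
by rewrite mxE big_distrl /=; apply: eq_bigr => i _; rewrite mxE.
Qed.

Lemma dot_sum u v : dot u v = \sum_i u 0 i * v 0 i.
Proof. by rewrite /dot mxE; apply: eq_bigr => i _; rewrite mxE. Qed.

Lemma bil_tr A u v : bil A^T u v = bil A v u.
Proof.
rewrite !bil_sum exchange_big; apply: eq_bigr => i _; apply: eq_bigr => j _.
rewrite mxE; ring.
Qed.

Lemma bil_delta A i j : bil A (delta_mx 0 i) (delta_mx 0 j) = A i j.
Proof.
rewrite bil_sum (bigD1 i) //= (bigD1 j) //= !mxE !eqxx !mul1r mulr1.
rewrite big1 ?addr0 => [|k kj]; last by rewrite [delta_mx 0 j 0 k]mxE (negbTE kj) mulr0.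
rewrite big1 ?addr0 // => k ki; apply: big1 => l _.
by rewrite mxE (negbTE ki) !mul0r.
Qed.

Lemma dot_delta u i : dot u (delta_mx 0 i) = u 0 i.
Proof.
rewrite dot_sum (bigD1 i) //= mxE !eqxx mulr1 big1 ?addr0 // => k ki.
by rewrite mxE (negbTE ki) mulr0.
Qed.

Lemma bilP A B : (forall u v, bil A u v = bil B u v) -> A = B.
Proof. by move=> AB; apply/matrixP => i j; rewrite -!bil_delta. Qed.

Lemma dotP u v : (forall w, dot u w = dot v w) -> u = v.
Proof. by move=> uv; apply/rowP => i; rewrite -!dot_delta. Qed.

End Bilinear.

Section BilinearDerivative.
Context {R : realType} {n : nat}.
Local Notation V := 'rV[R]_n.

Lemma isd_bil (A : V -> 'M[R]_n) (B : 'M[R]_n) (F G : V -> V) z u dF dG :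
  (forall i j, is_derive z u (fun w => A w i j) (B i j)) ->
  is_derive z u F dF -> is_derive z u G dG ->
  is_derive z u (fun w => bil (A w) (F w) (G w))
    (bil B (F z) (G z) + bil (A z) dF (G z) + bil (A z) (F z) dG).
Proof.
move=> dA Fd Gd.
rewrite (_ : (fun w => _) = fun w => \sum_i \sum_j F w 0 i * A w i j * G w 0 j); last first.
  by apply/funext => w; rewrite bil_sum.
rewrite !bil_sum -!big_split /=; apply: isd_sum => i.
rewrite -!big_split /=; apply: isd_sum => j.
apply: (is_derive_eq (isdM (isdM (isd_coord i Fd) (dA i j)) (isd_coord j Gd))).
ring.
Qed.

Lemma isd_dot (b : V -> V) (F : V -> V) z u db dF :
  is_derive z u b db -> is_derive z u F dF ->
  is_derive z u (fun w => dot (b w) (F w)) (dot db (F z) + dot (b z) dF).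
Proof.
move=> bd Fd.
rewrite (_ : (fun w => _) = fun w => \sum_i b w 0 i * F w 0 i); last first.
  by apply/funext => w; rewrite dot_sum.
rewrite !dot_sum -!big_split /=; apply: isd_sum => i.
by apply: isdM; exact: isd_coord.
Qed.

Lemma isd_lincomb (c : V -> R) (F G : V -> V) z u dc dF dG :
  is_derive z u c dc -> is_derive z u F dF -> is_derive z u G dG ->
  is_derive z u (fun w => c w *: F w + G w) (dc *: F z + c z *: dF + dG).
Proof.
move=> cd Fd Gd; apply: isd_row => i.
rewrite (_ : (fun w => _) = fun w => c w * F w 0 i + G w 0 i); last first.
  by apply/funext => w; rewrite !mxE.
apply: (is_derive_eq (isdD (isdM cd (isd_coord i Fd)) (isd_coord i Gd))).
by rewrite !mxE.
Qed.

End BilinearDerivative.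

Section SmoothMatrix.
Context {R : realType} {n : nat}.
Local Notation V := 'rV[R]_n.
Implicit Types (U : set V) (z : V).

Definition smooth_mx_on U m p (A : V -> 'M[R]_(m, p)) :=
  forall i j, smooth_on U (fun w => A w i j).

Lemma smooth_mxM U m p q (A : V -> 'M[R]_(m, p)) (B : V -> 'M[R]_(p, q)) :
  open U -> smooth_mx_on U A -> smooth_mx_on U B ->
  smooth_mx_on U (fun w => A w *m B w).
Proof.
move=> oU sA sB i j.
apply: (eq_smooth_on (f := fun w => \sum_k A w i k * B w k j)) => //.
  by move=> w _; rewrite mxE.
by apply: smooth_on_sum => // k; apply: smooth_onM; [|exact: sA|exact: sB].
Qed.

Lemma smooth_mx_tr U m p (A : V -> 'M[R]_(m, p)) : open U ->
  smooth_mx_on U A -> smooth_mx_on U (fun w => (A w)^T).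
Proof.
move=> oU sA i j; apply: (eq_smooth_on (f := fun w => A w j i)) => //.
by move=> w _; rewrite mxE.
Qed.

Lemma smooth_mx_cst U m p (A : 'M[R]_(m, p)) : open U -> smooth_mx_on U (fun=> A).
Proof. by move=> oU i j; exact: smooth_on_cst. Qed.

Lemma smooth_det U m (A : V -> 'M[R]_m) : open U ->
  smooth_mx_on U A -> smooth_on U (fun w => \det (A w)).
Proof.
move=> oU sA; apply: (eq_smooth_on
  (f := fun w => \sum_(s : 'S_m) (-1) ^+ s * \prod_i A w i (s i))) => //.
apply: smooth_on_sum => // s; apply: smooth_onM => //; first exact: smooth_on_cst.
by apply: smooth_on_prod => // i; exact: sA.
Qed.

(** Cramer's formula: the entries are cofactors divided by a nonvanishing determinant. *)
Lemma smooth_invmx U m (A : V -> 'M[R]_m) : open U ->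
  (forall z, U z -> A z \in unitmx) ->
  smooth_mx_on U A -> smooth_mx_on U (fun w => invmx (A w)).
Proof.
move=> oU uA sA i j; apply: (eq_smooth_on
  (f := fun w => (\det (A w))^-1 * ((-1) ^+ (j + i) * \det (row' j (col' i (A w)))))) => //.
  by move=> z Uz; rewrite /invmx uA // !mxE.
apply: smooth_onM => //.
  apply: smooth_onV => //; last exact: smooth_det.
  by move=> z Uz; have := uA z Uz; rewrite unitmxE unitfE.
apply: smooth_onM => //; first exact: smooth_on_cst.
apply: smooth_det => // k l; apply: (eq_smooth_on (f := fun w => A w (lift j k) (lift i l))) => //.
by move=> z _; rewrite !mxE.
Qed.

Lemma smooth_bil U (A : V -> 'M[R]_n) (F G : V -> V) : open U ->
  smooth_mx_on U A -> smooth_mx_on U F -> smooth_mx_on U G ->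
  smooth_on U (fun w => bil (A w) (F w) (G w)).
Proof.
move=> oU sA sF sG; apply: (smooth_mxM _ (A := fun w => F w *m A w)) => //.
  exact: smooth_mxM.
exact: smooth_mx_tr.
Qed.

Lemma smooth_dot U (F G : V -> V) : open U ->
  smooth_mx_on U F -> smooth_mx_on U G -> smooth_on U (fun w => dot (F w) (G w)).
Proof. by move=> oU sF sG; apply: smooth_mxM => //; exact: smooth_mx_tr. Qed.

Lemma smooth_row_isd U (F : V -> V) z u : smooth_mx_on U F -> U z ->
  is_derive z u F ('D_u F z).
Proof.
move=> sF Uz; apply: derivableP; apply/derivable_mxP => i j.
by apply: diff_derivable; exact: smooth_on_diff (sF i j) Uz.
Qed.

End SmoothMatrix.

Definition metric_on {R : realType} {n : nat} (U : set 'rV[R]_n)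
    (g : 'rV[R]_n -> 'M[R]_n) :=
  [/\ open U, smooth_mx_on U g, forall z, U z -> (g z)^T = g z &
      forall z, U z -> forall y : 'rV[R]_n, y != 0 -> 0 < bil (g z) y y].

Section LeviCivita.
Context {R : realType} {n : nat}.
Local Notation V := 'rV[R]_n.
Variables (U : set V) (g : V -> 'M[R]_n).
Hypothesis gU : metric_on U g.
Implicit Types (z u v w x : V).

Lemma metric_on_open : open U. Proof. by case: gU. Qed.
Lemma metric_on_smooth : smooth_mx_on U g. Proof. by case: gU. Qed.
Let oU := metric_on_open.
Let sg := metric_on_smooth.

Lemma metric_on_sym z u v : U z -> bil (g z) u v = bil (g z) v u.
Proof. by case: gU => _ _ gt _ Uz; rewrite -{1}gt // bil_tr. Qed.

Lemma metric_on_pos z y : U z -> y != 0 -> 0 < bil (g z) y y.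
Proof. by case: gU => _ _ _ gp Uz; exact: gp. Qed.

Lemma metric_on_ge0 z y : U z -> 0 <= bil (g z) y y.
Proof.
move=> Uz; have [->|y0] := eqVneq y 0; first by rewrite bil0l.
by rewrite ltW // metric_on_pos.
Qed.

Lemma metric_on_unit z : U z -> g z \in unitmx.
Proof.
move=> Uz; rewrite unitmxE unitfE; apply/det0P => -[v v0 vg].
by have := metric_on_pos Uz v0; rewrite /bil vg mul0mx mxE ltxx.
Qed.

Lemma metric_on_inj z u v : U z -> (forall w, bil (g z) u w = bil (g z) v w) -> u = v.
Proof.
move=> Uz uv; apply: (can_inj (mulmxK (metric_on_unit Uz))).
by apply: dotP => w; exact: uv.
Qed.

Lemma smooth_metric_inv : smooth_mx_on U (fun w => invmx (g w)).
Proof. by apply: smooth_invmx => //; exact: metric_on_unit. Qed.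

Lemma metric_inv_sym z : U z -> (invmx (g z))^T = invmx (g z).
Proof. by case: gU => _ _ gt _ Uz; rewrite trmx_inv gt. Qed.

Lemma smooth_christoffel k i j : smooth_on U (christoffel g k i j).
Proof.
have sp a b c : smooth_on U (partial a (fun w => g w b c)).
  by apply: smooth_on_partial; exact: sg.
apply: smooth_onM => //; first exact: smooth_on_cst.
apply: smooth_on_sum => // l; apply: smooth_onM => //.
  exact: smooth_metric_inv.
by do ![apply: smooth_onD => //|apply: smooth_onN => //].
Qed.

(* The Christoffel symbols as a vector-valued bilinear map. *)
Definition Gam z u v : V := \row_k \sum_i \sum_j christoffel g k i j z * u 0 i * v 0 j.

Lemma GamDl z u v w : Gam z (u + v) w = Gam z u w + Gam z v w.
Proof.
apply/rowP => k; rewrite !mxE -big_split /=; apply: eq_bigr => i _.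
by rewrite -big_split /=; apply: eq_bigr => j _; rewrite mxE mulrDr mulrDl.
Qed.

Lemma GamZl z c u w : Gam z (c *: u) w = c *: Gam z u w.
Proof.
apply/rowP => k; rewrite !mxE big_distrr /=; apply: eq_bigr => i _.
rewrite big_distrr /=; apply: eq_bigr => j _; rewrite mxE; ring.
Qed.

(** The right-hand side of the Koszul formula for constant fields [u] and [v], whose brackets
    vanish, as a covector; it is dual to twice [Gam z u v]. *)
Definition koszul z u v : V := \row_l
  ('D_u (fun w => bil (g w) v (delta_mx 0 l)) z
   + 'D_v (fun w => bil (g w) u (delta_mx 0 l)) z
   - 'D_(delta_mx 0 l) (fun w => bil (g w) u v) z).

Lemma smooth_metric_bil u v : smooth_on U (fun w => bil (g w) u v).
Proof. by apply: smooth_bil => //; exact: smooth_mx_cst. Qed.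

Lemma derive_metric z u v w : U z -> 'D_u (fun x => bil (g x) v w) z =
  \sum_i \sum_j \sum_k partial i (fun x => g x j k) z * u 0 i * v 0 j * w 0 k.
Proof.
move=> Uz; rewrite derive_partial; last exact: smooth_on_diff (smooth_metric_bil v w) Uz.
apply: eq_bigr => i _.
have -> : partial i (fun x => bil (g x) v w) z =
    bil (\matrix_(j, k) partial i (fun x => g x j k) z) v w.
  apply: derive_val; apply: is_derive_eq.
    apply: (isd_bil (F := fun=> v) (G := fun=> w)
      (B := \matrix_(j, k) partial i (fun x => g x j k) z)) => //.
    by move=> j k; rewrite mxE; apply: isd_partial; exact: smooth_on_diff (sg j k) Uz.
  by rewrite bil0l bil0r !addr0.
rewrite bil_sum big_distrr /=; apply: eq_bigr => j _.
rewrite big_distrr /=; apply: eq_bigr => k _; rewrite mxE; ring.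
Qed.

Lemma GamE z u v : U z -> Gam z u v = 2^-1 *: (koszul z u v *m invmx (g z)).
Proof.
move=> Uz; apply/rowP => k; rewrite !mxE.
under eq_bigr => i _.
  under eq_bigr => j _ do rewrite -mulrA -mulrA big_distrl /=.
  over.
under eq_bigr => i _.
  rewrite -big_distrr /= exchange_big /=.
  over.
rewrite -big_distrr /= exchange_big /=; congr (_ * _); apply: eq_bigr => l _.
have -> : koszul z u v 0 l = \sum_i \sum_j
   (partial i (fun w => g w j l) z + partial j (fun w => g w i l) z
     - partial l (fun w => g w i j) z) * (u 0 i * v 0 j).
  rewrite mxE !derive_metric //.
  have dl (F : 'I_n -> R) : \sum_k F k * (delta_mx 0 l : V) 0 k = F l.
    rewrite (bigD1 l) //= mxE !eqxx mulr1 big1 ?addr0 // => m ml.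
    by rewrite mxE (negbTE ml) mulr0.
  have -> : \sum_i \sum_j \sum_k partial i (fun x => g x j k) z *
      (delta_mx 0 l : V) 0 i * u 0 j * v 0 k =
      \sum_i \sum_j partial l (fun x => g x i j) z * (u 0 i * v 0 j).
    rewrite exchange_big /=; apply: eq_bigr => i _.
    rewrite exchange_big /=; apply: eq_bigr => j _.
    under eq_bigr => m _ do rewrite -mulrA mulrAC.
    by rewrite dl.
  under eq_bigr => i _ do under eq_bigr => j _ do rewrite dl.
  under [X in _ + X - _]eq_bigr => i _ do under eq_bigr => j _ do rewrite dl.
  rewrite [X in _ + X - _]exchange_big /= -big_split -sumrB /=.
  apply: eq_bigr => i _; rewrite -big_split -sumrB /=; apply: eq_bigr => j _.
  ring.
rewrite [RHS]big_distrl; apply: eq_bigr => i _ /=.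
rewrite [RHS]big_distrl; apply: eq_bigr => j _ /=.
have -> : invmx (g z) k l = invmx (g z) l k by rewrite -[in LHS]metric_inv_sym // mxE.
ring.
Qed.

Lemma koszul_dot z u v w : U z -> dot (koszul z u v) w =
  'D_u (fun x => bil (g x) v w) z + 'D_v (fun x => bil (g x) u w) z
  - 'D_w (fun x => bil (g x) u v) z.
Proof.
move=> Uz; pose Dg a := \matrix_(i, j) 'D_a (fun x => g x i j) z.
have DgE a b c : 'D_a (fun x => bil (g x) b c) z = bil (Dg a) b c.
  apply: derive_val; apply: is_derive_eq.
    apply: (isd_bil (F := fun=> b) (G := fun=> c) (B := Dg a)) => //.
    by move=> j k; rewrite mxE; exact: smooth_on_derivable (sg j k) Uz.
  by rewrite bil0l bil0r !addr0.
have bilr (A : 'M[R]_n) b c : bil A b c = \sum_l bil A b (delta_mx 0 l) * c 0 l.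
  rewrite {1}(row_sum_delta c) /bil linear_sum /= mulmx_sumr summxE.
  by apply: eq_bigr => l _; rewrite linearZ /= -scalemxAr mxE mulrC.
rewrite [X in _ - X]derive_partial; last exact: smooth_on_diff (smooth_metric_bil u v) Uz.
rewrite dot_sum !DgE !(bilr _ _ w) -big_split -sumrB /=; apply: eq_bigr => l _.
rewrite mxE /partial !DgE.
by move: (bil (Dg u) _ _) (bil (Dg v) _ _) (bil (Dg _) u v) => ? ? ?; ring.
Qed.

Lemma Gam_koszul z u v w : U z -> 2 * bil (g z) (Gam z u v) w =
  'D_u (fun x => bil (g x) v w) z + 'D_v (fun x => bil (g x) u w) z
  - 'D_w (fun x => bil (g x) u v) z.
Proof.
move=> Uz; rewrite -koszul_dot // GamE // bilZl mulrA divff ?mul1r ?pnatr_eq0 //.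
by rewrite /bil mulmxKV // metric_on_unit.
Qed.

Lemma derive_metric_sym z u v w : U z ->
  'D_u (fun x => bil (g x) v w) z = 'D_u (fun x => bil (g x) w v) z.
Proof.
by move=> Uz; apply: near_eq_derive; apply: near_eq_open Uz => // x Ux; rewrite metric_on_sym.
Qed.

Lemma GamC z u v : U z -> Gam z u v = Gam z v u.
Proof.
move=> Uz; apply: (metric_on_inj Uz) => w.
apply: (@mulfI _ 2); first by rewrite pnatr_eq0.
rewrite !Gam_koszul // (derive_metric_sym w v u Uz); ring.
Qed.

Lemma GamDr z u v w : U z -> Gam z w (u + v) = Gam z w u + Gam z w v.
Proof. by move=> Uz; rewrite !(GamC w) // GamDl. Qed.

Lemma GamZr z c u w : U z -> Gam z w (c *: u) = c *: Gam z w u.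
Proof. by move=> Uz; rewrite !(GamC w) // GamZl. Qed.

Lemma Gam_compat z u v w : U z -> 'D_u (fun x => bil (g x) v w) z =
  bil (g z) (Gam z u v) w + bil (g z) v (Gam z u w).
Proof.
move=> Uz; apply: (@mulfI _ 2); first by rewrite pnatr_eq0.
rewrite mulrDr (metric_on_sym v _ Uz) !Gam_koszul //.
rewrite (derive_metric_sym u w v Uz); ring.
Qed.

Lemma Gam_unique (Gam' : V -> V -> V) z : U z ->
  (forall u v, Gam' u v = Gam' v u) ->
  (forall u v w, 'D_u (fun x => bil (g x) v w) z =
     bil (g z) (Gam' u v) w + bil (g z) v (Gam' u w)) ->
  forall u v, Gam z u v = Gam' u v.
Proof.
move=> Uz sym compat u v; apply: (metric_on_inj Uz) => w.
apply: (@mulfI _ 2); first by rewrite pnatr_eq0.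
rewrite Gam_koszul // !compat !(metric_on_sym _ (Gam' _ _) Uz).
rewrite (sym v u) (sym w u) (sym w v); ring.
Qed.

(* DF is the covariant derivative of the vector field F in the direction u at z. *)
Definition is_cov z u (F : V -> V) DF := is_derive z u F (DF - Gam z u (F z)).

Lemma is_cov_eq z u F DF DF' : is_cov z u F DF -> DF = DF' -> is_cov z u F DF'.
Proof. by move=> ? <-. Qed.

Lemma is_cov_cst z u v : is_cov z u (fun=> v) (Gam z u v).
Proof. by rewrite /is_cov subrr; exact: is_derive_cst. Qed.

Lemma is_cov_lincomb z u (c : V -> R) F G dc DF DG : U z ->
  is_derive z u c dc -> is_cov z u F DF -> is_cov z u G DG ->
  is_cov z u (fun w => c w *: F w + G w) (dc *: F z + c z *: DF + DG).
Proof.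
move=> Uz cd Fd Gd; apply: (is_derive_eq (isd_lincomb cd Fd Gd)).
rewrite GamDr // GamZr // scalerBr opprD; apply/rowP => i; rewrite !mxE; ring.
Qed.

Lemma isd_inner z u F G DF DG : U z -> is_cov z u F DF -> is_cov z u G DG ->
  is_derive z u (fun w => bil (g w) (F w) (G w))
    (bil (g z) DF (G z) + bil (g z) (F z) DG).
Proof.
move=> Uz Fd Gd; pose B := \matrix_(i, j) 'D_u (fun x => g x i j) z.
apply: (is_derive_eq (isd_bil (B := B) _ Fd Gd)).
  by move=> i j; rewrite mxE; exact: smooth_on_derivable (sg i j) Uz.
have -> : bil B (F z) (G z) = 'D_u (fun x => bil (g x) (F z) (G z)) z.
  apply/esym; apply: derive_val; apply: is_derive_eq.
    apply: (isd_bil (F := fun=> F z) (G := fun=> G z) (B := B)) => //.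
    by move=> j k; rewrite mxE; exact: smooth_on_derivable (sg j k) Uz.
  by rewrite bil0l bil0r !addr0.
rewrite Gam_compat // !bilE; ring.
Qed.

(** By nondegeneracy it suffices to test against constant fields [w], whose covariant derivative is
    [Gam z u w]. The derivatives of X, J and S are thereby reduced to those of scalar functions. *)
Lemma is_cov_inner z u F DF : U z -> smooth_mx_on U F ->
  (forall w, is_derive z u (fun x => bil (g x) (F x) w)
     (bil (g z) DF w + bil (g z) (F z) (Gam z u w))) ->
  is_cov z u F DF.
Proof.
move=> Uz sF FD; have F0 : is_cov z u F ('D_u F z + Gam z u (F z)).
  by rewrite /is_cov addrK; exact: smooth_row_isd sF Uz.
apply: (is_cov_eq F0); apply: (metric_on_inj Uz) => w.
have D1 := isd_inner Uz F0 (is_cov_cst z u w).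
have D2 := FD w.
have : bil (g z) ('D_u F z + Gam z u (F z)) w + bil (g z) (F z) (Gam z u w) =
       bil (g z) DF w + bil (g z) (F z) (Gam z u w).
  rewrite -(@derive_val _ _ _ _ _ _ _ D1); exact: (@derive_val _ _ _ _ _ _ _ D2).
exact: addIr.
Qed.

(* The second covariant derivative of the constant field w along constant fields u, v. *)
Definition dotcov z u v w : V :=
  'D_u (fun x => Gam x v w) z + Gam z u (Gam z v w).

Lemma smooth_Gam v w : smooth_mx_on U (fun x => Gam x v w).
Proof.
move=> i j; apply: (eq_smooth_on
  (f := fun x => \sum_a \sum_b christoffel g j a b x * (v 0 a * w 0 b))) => //.
  move=> x _; rewrite mxE; apply: eq_bigr => a _; apply: eq_bigr => b _.
  by rewrite mulrA.
apply: smooth_on_sum => // a; apply: smooth_on_sum => // b.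
by apply: smooth_onM => //; [exact: smooth_christoffel|exact: smooth_on_cst].
Qed.

Lemma is_cov_Gam z u v w : U z -> is_cov z u (fun x => Gam x v w) (dotcov z u v w).
Proof. by move=> Uz; rewrite /is_cov addrK; exact: smooth_row_isd (smooth_Gam v w) Uz. Qed.

Lemma derive_Gam z u v w l : U z -> ('D_u (fun x => Gam x v w) z) 0 l =
  \sum_i \sum_j \sum_k partial i (christoffel g l j k) z * u 0 i * v 0 j * w 0 k.
Proof.
move=> Uz; have Gd := smooth_row_isd u (smooth_Gam v w) Uz.
rewrite -(@derive_val _ _ _ _ _ _ _ (isd_coord l Gd)).
rewrite derive_partial; last exact: smooth_on_diff (smooth_Gam v w 0 l) Uz.
apply: eq_bigr => i _.
have -> : partial i (fun x => Gam x v w 0 l) z =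
    \sum_j \sum_k partial i (christoffel g l j k) z * (v 0 j * w 0 k).
  rewrite (_ : (fun x => _) = fun x => \sum_j \sum_k christoffel g l j k x * (v 0 j * w 0 k)).
    apply: derive_val; apply: isd_sum => j; apply: isd_sum => k.
    apply: (is_derive_eq (isdM (isd_partial i _) (isd_cst _ _ _))).
      exact: smooth_on_diff (smooth_christoffel l j k) Uz.
    by rewrite mulr0 addr0.
  apply/funext => x; rewrite mxE; apply: eq_bigr => a _; apply: eq_bigr => b _.
  by rewrite mulrA.
rewrite big_distrr /=; apply: eq_bigr => j _.
rewrite big_distrr /=; apply: eq_bigr => k _; ring.
Qed.

Lemma curvatureE z u v w : U z ->
  curvature g z u v w = dotcov z u v w - dotcov z v u w.
Proof.
move=> Uz; apply/rowP => l; rewrite mxE.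
have GG a b c : Gam z a (Gam z b c) 0 l = \sum_i \sum_j \sum_k
   (\sum_m christoffel g l i m z * christoffel g m j k z) * a 0 i * b 0 j * c 0 k.
  rewrite mxE; apply: eq_bigr => i _.
  under eq_bigr => m _.
    rewrite mxE big_distrr /=.
    under eq_bigr => j _ do rewrite big_distrr /=.
    over.
  rewrite exchange_big /=; apply: eq_bigr => j _.
  rewrite exchange_big /=; apply: eq_bigr => k _.
  rewrite !big_distrl /=; apply: eq_bigr => m _; ring.
rewrite /dotcov [RHS]mxE [X in _ + X]mxE [X in X - _]mxE [X in _ - X]mxE.
rewrite [X in _ - (X + _)]derive_Gam // [X in X + _ - _]derive_Gam // !GG.
rewrite [X in _ - (X + _)]exchange_big [X in _ - (_ + X)]exchange_big /=.
rewrite -!big_split -sumrB /=; apply: eq_bigr => i _.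
rewrite -!big_split -sumrB /=; apply: eq_bigr => j _.
rewrite -!big_split -sumrB /=; apply: eq_bigr => k _.
rewrite /riemann sumrB; move: (partial i _ z) (partial j _ z) (\sum_m _) (\sum_m _).
by move=> ? ? ? ?; ring.
Qed.

End LeviCivita.

(** * Constant curvature *)

(** An algebraic curvature tensor is determined by its sectional values. The symmetries imply
    exchange of pairs; polarizing in the inner and then in the outer arguments makes [B]
    antisymmetric in its second and third arguments, hence totally antisymmetric, and the Bianchi
    identity becomes 3 B = 0. *)
Lemma curvature_like_eq0 {R : realType} {V : lmodType R} (B : V -> V -> V -> V -> R) :
  (forall u u' v w x, B (u + u') v w x = B u v w x + B u' v w x) ->
  (forall u v w x, B u v w x = - B v u w x) ->
  (forall u v w x, B u v w x = - B u v x w) ->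
  (forall u v w x, B u v w x + B v w u x + B w u v x = 0) ->
  (forall u v, B u v v u = 0) ->
  forall u v w x, B u v w x = 0.
Proof.
move=> add anti12 anti34 bianchi sect.
have pair u v w x : B u v w x = B w x u v.
  have := bianchi u v w x; have := bianchi v w x u.
  have := bianchi w x u v; have := bianchi x u v w.
  have := anti34 v w x u; have := anti34 w x v u; have := anti34 x u w v.
  have := anti34 u v x w; have := anti12 u w x v; have := anti34 w u x v.
  have := anti12 v x u w; have := anti34 x v u w; lra.
have add2 u v v' w x : B u (v + v') w x = B u v w x + B u v' w x.
  by rewrite anti12 add !(anti12 _ u) opprD !opprK.
have add3 u v w w' x : B u v (w + w') x = B u v w x + B u v w' x.
  by rewrite pair add !(pair _ x u v).
have add4 u v w x x' : B u v w (x + x') = B u v w x + B u v w x'.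
  by rewrite pair add2 !(pair w _ u v).
have sect2 u v w : B u v w u = 0.
  have := sect u (v + w); rewrite !(add2, add3) !sect (pair u w v u).
  rewrite (anti12 v u) (anti34 u v u w); lra.
have anti23 u v w x : B u v w x = - B u w v x.
  have := sect2 (u + x) v w; rewrite !(add, add4) !sect2 (pair x v w u).
  rewrite (anti12 w u) (anti34 u w x v); lra.
move=> u v w x; have := bianchi u v w x.
rewrite (anti12 w u v x) (anti23 u w v x) (anti23 v w u x) (anti12 v u w x); lra.
Qed.

Section CurvatureForm.
Context {R : realType} {n : nat}.
Local Notation V := 'rV[R]_n.
Variables (U : set V) (g : V -> 'M[R]_n).
Hypothesis gU : metric_on U g.
Implicit Types (z u v w x : V).
Let oU : open U := metric_on_open gU.

Definition cform z u v w x : R := bil (g z) (curvature g z u v w) x.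

(** The Gram determinant, which is the denominator of [sectional]; multiplying by it makes a
    curvature condition polynomial. *)
Definition gram z u v : R := bil (g z) u u * bil (g z) v v - bil (g z) u v ^+ 2.

Lemma curvatureDl z u u' v w :
  curvature g z (u + u') v w = curvature g z u v w + curvature g z u' v w.
Proof.
apply/rowP => l; rewrite !mxE -big_split /=; apply: eq_bigr => i _.
rewrite -big_split /=; apply: eq_bigr => j _; rewrite -big_split /=; apply: eq_bigr => k _.
by rewrite mxE mulrDr !mulrDl.
Qed.

Lemma curvatureZl z c u v w : curvature g z (c *: u) v w = c *: curvature g z u v w.
Proof.
apply/rowP => l; rewrite !mxE big_distrr /=; apply: eq_bigr => i _.
rewrite big_distrr /=; apply: eq_bigr => j _; rewrite big_distrr /=; apply: eq_bigr => k _.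
by rewrite mxE mulrCA !mulrA.
Qed.

Lemma cform_anti12 z u v w x : U z -> cform z u v w x = - cform z v u w x.
Proof. by move=> Uz; rewrite /cform !(curvatureE gU) // -bilNl opprB. Qed.

Lemma dotcovC z u v w : U z -> dotcov g z u v w = dotcov g z u w v.
Proof.
move=> Uz; rewrite /dotcov (GamC gU v w Uz); apply: (congr1 (fun t => t + _)).
by apply: near_eq_derive; apply: (near_eq_open oU) Uz => y Uy; rewrite (GamC gU v w Uy).
Qed.

Lemma cform_bianchi z u v w x : U z ->
  cform z u v w x + cform z v w u x + cform z w u v x = 0.
Proof.
move=> Uz; rewrite /cform !(curvatureE gU) //.
rewrite (dotcovC u v w Uz) (dotcovC v w u Uz) (dotcovC w u v Uz).
move: (dotcov g z u w v) (dotcov g z v u w) (dotcov g z w v u) => a b c.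
rewrite !bilE; ring.
Qed.

Lemma isd_Gam_form z u v w x : U z ->
  is_derive z u (fun y => bil (g y) (Gam g y v w) x)
   (bil (g z) (dotcov g z u v w) x + bil (g z) (Gam g z v w) (Gam g z u x)).
Proof. by move=> Uz; exact: (isd_inner gU Uz (is_cov_Gam gU u v w Uz) (is_cov_cst g z u x)). Qed.

(** Metric compatibility writes the second derivative of g(w, x) along [a] and [b] through [dotcov],
    up to terms symmetric in [a] and [b]. Second derivatives commute, so the remaining curvature
    terms cancel. *)
Lemma cform_anti34 z u v w x : U z -> cform z u v w x = - cform z u v x w.
Proof.
move=> Uz; rewrite /cform !(curvatureE gU) //.
have key a b : 'D_a (fun y => 'D_b (fun t => bil (g t) w x) y) z =
    bil (g z) (dotcov g z a b w) x + bil (g z) (Gam g z b w) (Gam g z a x) +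
    (bil (g z) (dotcov g z a b x) w + bil (g z) (Gam g z b x) (Gam g z a w)).
  rewrite -(@derive_val _ _ _ _ _ _ _ (isdD (isd_Gam_form a b w x Uz) (isd_Gam_form a b x w Uz))).
  apply: near_eq_derive; apply: (near_eq_open oU) Uz => y Uy.
  by rewrite (Gam_compat gU) // (metric_on_sym gU w).
have := derive_comm u v oU (smooth_metric_bil gU w x) Uz.
rewrite !key (metric_on_sym gU (Gam g z v w)) // (metric_on_sym gU (Gam g z v x)) //.
move: (dotcov g z u v w) (dotcov g z u v x) (dotcov g z v u w) (dotcov g z v u x).
move: (Gam g z u w) (Gam g z u x) (Gam g z v w) (Gam g z v x) => a b c d a' b' c' d'.
rewrite !bilE; lra.
Qed.

Lemma gram_ge0 z u v : U z -> 0 <= gram z u v.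
Proof.
move=> Uz; have [->|v0] := eqVneq v 0; first by rewrite /gram !bilE; lra.
have vp := metric_on_pos gU Uz v0.
have := metric_on_ge0 gU (bil (g z) v v *: u - bil (g z) u v *: v) Uz.
rewrite !bilE (metric_on_sym gU v u Uz) => h.
rewrite -(pmulr_rge0 _ vp); rewrite /gram; move: h; congr (0 <= _); ring.
Qed.

Lemma gram_eq0 z u v : U z -> gram z u v = 0 -> v != 0 ->
  u = (bil (g z) u v / bil (g z) v v) *: v.
Proof.
move=> Uz g0 v0; have vp := metric_on_pos gU Uz v0.
apply/eqP; rewrite -subr_eq0; apply/negPn/negP => w0.
have := metric_on_pos gU Uz w0; rewrite !bilE (metric_on_sym gU v u Uz) => h.
have : 0 < bil (g z) v v * (bil (g z) u u - bil (g z) u v / bil (g z) v v * bil (g z) u v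
  + - (bil (g z) u v / bil (g z) v v * (bil (g z) u v - bil (g z) u v / bil (g z) v v * bil (g z) v v))).
  by rewrite pmulr_rgt0 //; move: h; congr (0 < _); ring.
rewrite divfK ?gt_eqF// subrr mulr0 oppr0 addr0 mulrBr.
rewrite [X in _ - X](_ : _ = bil (g z) u v ^+ 2); last by rewrite mulrA mulrCA divff ?gt_eqF// mulr1 expr2.
by rewrite mulrC -/(gram z u v) g0 ltxx.
Qed.

Lemma row_free_gram z u v : U z -> row_free (col_mx u v) = (gram z u v != 0).
Proof.
move=> Uz; apply/idP/idP => [fr|gn0].
  apply/eqP => g0.
  have fr0 a b : a *: u + b *: v = 0 -> a = 0 /\ b = 0.
    move=> ab; have : row_mx a%:M b%:M *m col_mx u v = 0 *m col_mx u v.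
      by rewrite mul0mx mul_row_col !mul_scalar_mx.
    move/(row_free_inj fr); rewrite -[0](@row_mx0 _ 1 1 1) => /eq_row_mx [].
    by move=> /matrixP/(_ 0 0) + /matrixP/(_ 0 0); rewrite !mxE eqxx.
  have [v0|v0] := eqVneq v 0.
    have [|_ /eqP] := fr0 0 1; first by rewrite v0 scaler0 addr0 scale0r.
    by rewrite oner_eq0.
  have uv := gram_eq0 Uz g0 v0.
  have [|/eqP] := fr0 1 (- (bil (g z) u v / bil (g z) v v)).
    by rewrite scale1r scaleNr -uv subrr.
  by rewrite oner_eq0.
rewrite -kermx_eq0; apply/negPn/negP => /rowV0Pn [k /sub_kermxP kA k0].
move: kA; rewrite -(hsubmxK (k : 'rV_(1 + 1))) mul_row_col.
rewrite (mx11_scalar (lsubmx _)) (mx11_scalar (rsubmx _)) !mul_scalar_mx.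
set a := lsubmx _ 0 0; set b := rsubmx _ 0 0 => ab.
have ab0 : (a != 0) || (b != 0).
  apply: contraNT k0; rewrite negb_or !negbK => /andP[/eqP a0 /eqP b0].
  rewrite -(hsubmxK (k : 'rV_(1 + 1))) (mx11_scalar (lsubmx _)) (mx11_scalar (rsubmx _)).
  by rewrite -/a -/b a0 b0 !raddf0 row_mx0.
have eu : bil (g z) (a *: u + b *: v) u = 0 by rewrite ab bil0l.
have ev : bil (g z) (a *: u + b *: v) v = 0 by rewrite ab bil0l.
move: eu ev; rewrite !bilE (metric_on_sym gU v u Uz) => eu ev.
have ga : a * gram z u v = 0.
  rewrite /gram (_ : _ * _ = (a * bil (g z) u u + b * bil (g z) u v) * bil (g z) v v
    - (a * bil (g z) u v + b * bil (g z) v v) * bil (g z) u v); last by ring.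
  by rewrite eu ev !mul0r subrr.
have gb : b * gram z u v = 0.
  rewrite /gram (_ : _ * _ = (a * bil (g z) u v + b * bil (g z) v v) * bil (g z) u u
    - (a * bil (g z) u u + b * bil (g z) u v) * bil (g z) u v); last by ring.
  by rewrite eu ev !mul0r subrr.
case/orP: ab0 => /mulfI inj; move: gn0.
  by rewrite (inj _ _ (etrans ga (esym (mulr0 a)))) eqxx.
by rewrite (inj _ _ (etrans gb (esym (mulr0 b)))) eqxx.
Qed.

Lemma sectional_cform z mu u v : U z -> row_free (col_mx u v) ->
  (sectional g z u v = mu <-> cform z u v v u = mu * gram z u v).
Proof.
move=> Uz; rewrite (row_free_gram _ _ Uz) => gn0.
rewrite /sectional !innerE -/(gram z u v) -/(cform z u v v u); split=> [<-|->].
  by rewrite divfK.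
by rewrite mulfK.
Qed.

Lemma const_sectional z mu : U z ->
  (forall u v, row_free (col_mx u v) -> sectional g z u v = mu) ->
  forall u v w x, cform z u v w x =
    mu * (bil (g z) v w * bil (g z) u x - bil (g z) u w * bil (g z) v x).
Proof.
move=> Uz cc u v w x; apply/eqP; rewrite -subr_eq0; apply/eqP.
have S a b := metric_on_sym gU a b Uz.
pose B u v w x := cform z u v w x -
  mu * (bil (g z) v w * bil (g z) u x - bil (g z) u w * bil (g z) v x).
rewrite -/(B u v w x); move: u v w x; apply: curvature_like_eq0.
- by move=> u u' v w x; rewrite /B /cform curvatureDl !bilE; ring.
- by move=> u v w x; rewrite /B (cform_anti12 u v) //; ring.
- by move=> u v w x; rewrite /B (cform_anti34 u v w x) //; ring.
- move=> u v w x; have := cform_bianchi u v w x Uz; rewrite /B.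
  rewrite (S w u) (S v u) (S w v); lra.
move=> u v; rewrite /B (S v u).
have [fr|] := boolP (row_free (col_mx u v)).
  by rewrite ((sectional_cform mu Uz fr).1 (cc _ _ fr)) /gram; ring.
(* Sectional curvature says nothing about dependent pairs; there [v] is zero or [u] is a multiple of
   [v], and both terms of [B] vanish separately. *)
rewrite (row_free_gram _ _ Uz) negbK => /eqP g0.
have -> : cform z u v v u = 0.
  have c0 a b c : cform z a a b c = 0.
    by have := cform_anti12 a a b c Uz; lra.
  have [->|v0] := eqVneq v 0.
    rewrite cform_anti12 // -[X in cform z X](scale0r 0) /cform curvatureZl scale0r.
    by rewrite bil0l oppr0.
  rewrite [X in cform z X v v u](gram_eq0 Uz g0 v0) /cform curvatureZl bilZl.
  by have := c0 v v u; rewrite /cform => ->; rewrite mulr0.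
have := g0; rewrite /gram => g0'.
rewrite (_ : _ - _ = - mu * (bil (g z) u u * bil (g z) v v - bil (g z) u v ^+ 2)); last by ring.
by rewrite g0' mulr0.
Qed.

Lemma smooth_curvature u v w : smooth_mx_on U (fun z => curvature g z u v w).
Proof.
have sc k i j : smooth_on U (christoffel g k i j) by exact: (smooth_christoffel gU).
move=> i0 l; apply: (eq_smooth_on (f := fun z => \sum_i \sum_j \sum_k
    (riemann g l k i j z * (u 0 i * v 0 j * w 0 k)))) => //.
  move=> z _; rewrite mxE; apply: eq_bigr => i _; apply: eq_bigr => j _.
  by apply: eq_bigr => k _; rewrite !mulrA.
do 3! (apply: smooth_on_sum => // ?); apply: smooth_onM => //; last exact: smooth_on_cst.
apply: smooth_onD => //.
  apply: smooth_onD => //; first by apply: smooth_on_partial; exact: sc.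
  by apply: smooth_onN => //; apply: smooth_on_partial; exact: sc.
apply: smooth_on_sum => // m; apply: smooth_onD => //.
  by apply: smooth_onM => //; exact: sc.
by apply: smooth_onN => //; apply: smooth_onM => //; exact: sc.
Qed.

Lemma smooth_gram u v : smooth_on U (fun z => gram z u v).
Proof.
have sb a b : smooth_on U (fun z => bil (g z) a b) by exact: (smooth_metric_bil gU).
apply: smooth_onD => //; first exact: smooth_onM.
apply: smooth_onN => //.
by apply: (eq_smooth_on (f := fun z => bil (g z) u v * bil (g z) u v)) => //; exact: smooth_onM.
Qed.

End CurvatureForm.

(** * Killing forms *)

Section OneForm.
Context {R : realType} {n : nat}.
Local Notation V := 'rV[R]_n.
Variables (U : set V) (g : V -> 'M[R]_n) (b : V -> V).
Hypothesis gU : metric_on U g.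
Hypothesis sb : smooth_mx_on U b.
Implicit Types (z u v w x : V).
Let oU : open U := metric_on_open gU.

(* In the paper's notation Xf has components b^i, Jf u has components s^i_j u^j
   and Sf has components s^i; thus b^2 = g(X, X), S = - J X and t_ij is the form
   g(J (J _), _). *)
Definition sform z : 'M[R]_n := s_mx g b z.
Definition Xf z : V := b z *m invmx (g z).
Definition Jf z u : V := u *m (sform z)^T *m invmx (g z).
Definition Sf z : V := s_row g b z *m invmx (g z).

Lemma sform_tr z : (sform z)^T = - sform z.
Proof. by apply/matrixP => i j; rewrite !mxE; ring. Qed.

Lemma sformC z u v : bil (sform z) v u = - bil (sform z) u v.
Proof. by rewrite -bil_tr sform_tr /bil mulmxN mulNmx mxE. Qed.

Lemma sform_diag z u : bil (sform z) u u = 0.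
Proof. by have := sformC z u u; lra. Qed.

Lemma bil_X z w : U z -> bil (g z) (Xf z) w = dot (b z) w.
Proof. by move=> Uz; rewrite /bil /Xf mulmxKV // (metric_on_unit gU). Qed.

Lemma bil_J z u w : U z -> bil (g z) (Jf z u) w = bil (sform z) w u.
Proof. by move=> Uz; rewrite -[RHS]bil_tr /bil /Jf mulmxKV // (metric_on_unit gU). Qed.

Lemma bil_S z w : U z -> bil (g z) (Sf z) w = bil (sform z) (Xf z) w.
Proof. by move=> Uz; rewrite /bil /Sf mulmxKV // (metric_on_unit gU). Qed.

Lemma s0E z w : s0 g b z w = bil (sform z) (Xf z) w.
Proof. by []. Qed.

Lemma Sf_J z : U z -> Sf z = - Jf z (Xf z).
Proof.
move=> Uz; apply: (metric_on_inj gU Uz) => w.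
by rewrite bil_S // bilNl bil_J // -sformC.
Qed.

Lemma JfD z u v : Jf z (u + v) = Jf z u + Jf z v.
Proof. by rewrite /Jf !mulmxDl. Qed.
Lemma JfZ z c u : Jf z (c *: u) = c *: Jf z u.
Proof. by rewrite /Jf -!scalemxAl. Qed.
Lemma JfN z u : Jf z (- u) = - Jf z u.
Proof. by rewrite /Jf !mulNmx. Qed.

Lemma t_mxE z u v : U z -> bil (t_mx g b z) u v = bil (g z) (Jf z (Jf z u)) v.
Proof.
move=> Uz; rewrite bil_J // sformC /bil /t_mx /Jf -/(sform z).
by rewrite sform_tr mulmxN !mulNmx [in RHS]mxE opprK !mulmxA.
Qed.

(** The index of differentiation comes second, so the direction of differentiation is the right
    argument of the bilinear form. *)
Definition cov_mx z : 'M[R]_n := \matrix_(i, j) cov g b i j z.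

Lemma cov_mxE z u v : U z ->
  bil (cov_mx z) v u = 'D_u (fun x => dot (b x) v) z - dot (b z) (Gam g z u v).
Proof.
move=> Uz.
have -> : 'D_u (fun x => dot (b x) v) z =
    \sum_i \sum_j v 0 i * partial j (fun w => b w 0 i) z * u 0 j.
  have -> : (fun x => dot (b x) v) = fun x => \sum_i b x 0 i * v 0 i.
    by apply/funext => x; rewrite dot_sum.
  apply: derive_val; apply: isd_sum => i.
  have bd : differentiable (fun x => b x 0 i) z by exact: smooth_on_diff (sb 0 i) Uz.
  apply: (is_derive_eq (isdM (derivableP (diff_derivable (v := u) bd)) (isd_cst _ _ _))).
  rewrite mulr0 addr0 derive_partial // big_distrl /=.
  by apply: eq_bigr => j _; move: (partial j _ z) => p; ring.
rewrite (GamC gU) // bil_sum dot_sum.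
have -> : \sum_i b z 0 i * Gam g z v u 0 i =
    \sum_i \sum_j v 0 i * (\sum_k christoffel g k i j z * b z 0 k) * u 0 j.
  under eq_bigr => k _.
    rewrite mxE big_distrr /=; under eq_bigr => i _ do rewrite big_distrr /=.
    over.
  rewrite exchange_big /=; apply: eq_bigr => i _.
  rewrite exchange_big /=; apply: eq_bigr => j _.
  rewrite big_distrr big_distrl /=; apply: eq_bigr => k _; ring.
rewrite -sumrB; apply: eq_bigr => i _; rewrite -sumrB; apply: eq_bigr => j _.
by rewrite mxE /cov mulrBr mulrBl.
Qed.

Lemma smooth_cov_mx : smooth_mx_on U cov_mx.
Proof.
move=> i j; apply: (eq_smooth_on (f := fun z => cov g b i j z)) => //.
  by move=> z _; rewrite mxE.
apply: smooth_onD => //; first by apply: smooth_on_partial; exact: sb.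
apply: smooth_onN => //; apply: smooth_on_sum => // k.
by apply: smooth_onM => //; exact: (smooth_christoffel gU).
Qed.

Lemma smooth_sform : smooth_mx_on U sform.
Proof.
move=> i j; apply: (eq_smooth_on
  (f := fun z => 2^-1 * (cov_mx z i j + -1 * cov_mx z j i))) => //.
  by move=> z _; rewrite !mxE mulN1r.
apply: smooth_onM => //; first exact: smooth_on_cst.
apply: smooth_onD => //; first exact: smooth_cov_mx.
by apply: smooth_onM => //; [exact: smooth_on_cst|exact: smooth_cov_mx].
Qed.

Lemma smooth_Xf : smooth_mx_on U Xf.
Proof. by apply: smooth_mxM => //; exact: (smooth_metric_inv gU). Qed.

Lemma smooth_Jf F : smooth_mx_on U F -> smooth_mx_on U (fun z => Jf z (F z)).
Proof.
move=> sF; apply: smooth_mxM => //; last exact: (smooth_metric_inv gU).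
by apply: smooth_mxM => //; apply: smooth_mx_tr => //; exact: smooth_sform.
Qed.

Lemma smooth_Sf : smooth_mx_on U Sf.
Proof.
apply: smooth_mxM => //; last exact: (smooth_metric_inv gU).
by apply: smooth_mxM => //; [exact: smooth_Xf|exact: smooth_sform].
Qed.

Lemma smooth_s0 y : smooth_on U (fun z => s0 g b z y).
Proof.
by apply: smooth_bil => //; [exact: smooth_sform|exact: smooth_Xf|exact: smooth_mx_cst].
Qed.

Lemma smooth_t00 y : smooth_on U (fun z => t00 g b z y).
Proof.
apply: smooth_bil => //; try exact: smooth_mx_cst.
apply: smooth_mxM => //; last exact: smooth_sform.
by apply: smooth_mxM => //; [exact: smooth_sform|exact: (smooth_metric_inv gU)].
Qed.

Lemma smooth_form y : smooth_on U (fun z => dot (b z) y).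
Proof. by apply: smooth_dot => //; exact: smooth_mx_cst. Qed.

Lemma sqlenX z : U z -> sqlen g b z = dot (b z) (Xf z).
Proof.
by move=> Uz; rewrite -bil_X // /bil /Xf mulmxKV ?(metric_on_unit gU) // trmx_mul
  (metric_inv_sym gU) // mulmxA.
Qed.

Lemma smooth_sqlen : smooth_on U (sqlen g b).
Proof.
apply: (eq_smooth_on (f := fun z => dot (b z) (Xf z))) => //.
  by move=> z Uz; rewrite sqlenX.
by apply: smooth_dot => //; exact: smooth_Xf.
Qed.

Lemma sqlen_bil z : U z -> sqlen g b z = bil (g z) (Xf z) (Xf z).
Proof. by move=> Uz; rewrite bil_X // sqlenX. Qed.

Lemma sqlen_ge0 z : U z -> 0 <= sqlen g b z.
Proof. by move=> Uz; rewrite sqlen_bil //; exact: (metric_on_ge0 gU). Qed.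

Lemma sqlen_eq0 z : U z -> sqlen g b z = 0 -> Xf z = 0.
Proof.
move=> Uz f0; apply/eqP/negPn/negP => X0.
by have := metric_on_pos gU Uz X0; rewrite -sqlen_bil // f0 ltxx.
Qed.

Lemma form_sqr_le z y : U z -> dot (b z) y ^+ 2 <= sqlen g b z * bil (g z) y y.
Proof.
move=> Uz; have := gram_ge0 gU (Xf z) y Uz.
by rewrite /gram -sqlen_bil // bil_X // subr_ge0.
Qed.

Hypothesis kb : forall z, U z -> forall i j, cov g b i j z + cov g b j i z = 0.

Lemma killing_cov_mx z : U z -> cov_mx z = sform z.
Proof.
by move=> Uz; apply/matrixP => i j; rewrite !mxE; have := kb Uz i j; lra.
Qed.

Lemma isd_form z u F DF : U z -> is_cov g z u F DF ->
  is_derive z u (fun x => dot (b x) (F x)) (bil (sform z) (F z) u + dot (b z) DF).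
Proof.
move=> Uz Fd.
have bd := smooth_row_isd u sb Uz.
apply: (is_derive_eq (isd_dot bd Fd)).
have -> : dot ('D_u b z) (F z) = 'D_u (fun x => dot (b x) (F z)) z.
  apply/esym/derive_val; apply: (is_derive_eq (isd_dot bd (is_derive_cst _ _ _))).
  by rewrite dot0r addr0.
by rewrite -killing_cov_mx // cov_mxE // !dotE; ring.
Qed.

Lemma is_cov_X z u : U z -> is_cov g z u Xf (Jf z u).
Proof.
move=> Uz; apply: (is_cov_inner gU Uz smooth_Xf) => w.
rewrite bil_J // bil_X //.
apply: (near_eq_is_derive _ (isd_form Uz (is_cov_cst g z u w))).
by apply: (near_eq_open oU) Uz => y Uy; rewrite bil_X.
Qed.

Lemma form_J z u : U z -> dot (b z) (Jf z u) = bil (sform z) (Xf z) u.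
Proof. by move=> Uz; rewrite -bil_X // (metric_on_sym gU) // bil_J. Qed.

Lemma isd_sqlen z u : U z -> is_derive z u (sqlen g b) (2 * s0 g b z u).
Proof.
move=> Uz; apply: (@near_eq_is_derive _ _ _ (fun x => dot (b x) (Xf x))).
  by apply: (near_eq_open oU) Uz => y Uy; rewrite sqlenX.
apply: (is_derive_eq (isd_form Uz (is_cov_X u Uz))).
by rewrite form_J // s0E; ring.
Qed.

Variable mu : R.
Hypothesis cc : forall z, U z -> forall u v, row_free (col_mx u v) -> sectional g z u v = mu.

(* The difference of both sides is antisymmetric in (v, w) and, by the Ricci identity and
   constant curvature, symmetric in (u, w), hence zero. *)
Lemma killing_integrability z u v w : U z ->
  'D_u (fun x => bil (sform x) v w) z =
  - mu * (dot (b z) v * bil (g z) w u - dot (b z) w * bil (g z) v u)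
  + bil (sform z) (Gam g z u v) w + bil (sform z) v (Gam g z u w).
Proof.
move=> Uz.
have Ds a c d : 'D_a (fun x => bil (sform x) c d) z =
    'D_a (fun y => 'D_d (fun x => dot (b x) c) y) z -
    (bil (sform z) (Gam g z d c) a + dot (b z) (dotcov g z a d c)).
  have D1 := smooth_on_derivable a (smooth_on_derive d oU (smooth_form c)) Uz.
  have D2 := isd_form Uz (is_cov_Gam gU a d c Uz).
  rewrite -(@derive_val _ _ _ _ _ _ _ (isdD D1 (isdN D2))).
  apply: near_eq_derive; apply: (near_eq_open oU) Uz => y Uy.
  by rewrite -killing_cov_mx // cov_mxE.
pose M a c d := 'D_a (fun x => bil (sform x) c d) z
  - bil (sform z) (Gam g z a c) d - bil (sform z) c (Gam g z a d)
  + mu * (dot (b z) c * bil (g z) d a - dot (b z) d * bil (g z) c a).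
suff M0 : M u v w = 0 by move: M0; rewrite /M; lra.
have anti a c d : M a c d = - M a d c.
  rewrite /M.
  have -> : 'D_a (fun x => bil (sform x) c d) z = - 'D_a (fun x => bil (sform x) d c) z.
    have D1 : is_derive z a (fun x => bil (sform x) d c) ('D_a (fun x => bil (sform x) d c) z).
      apply: smooth_on_derivable Uz.
      by apply: smooth_bil => //; [exact: smooth_sform|exact: smooth_mx_cst|exact: smooth_mx_cst].
    rewrite -(@derive_val _ _ _ _ _ _ _ (isdN D1)); apply: near_eq_derive.
    by near=> y; rewrite sformC.
  by rewrite (sformC z (Gam g z a c) d) (sformC z c (Gam g z a d)); ring.
have sym a c d : M a c d = M d c a.
  have := const_sectional gU Uz (cc Uz) a d c (Xf z).
  rewrite /cform (curvatureE gU) //.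
  rewrite /M !Ds (derive_comm a d oU (smooth_form c) Uz).
  rewrite bilDl bilNl !(metric_on_sym gU _ (Xf z)) // !bil_X //.
  rewrite (metric_on_sym gU d c Uz) (metric_on_sym gU a c Uz) (metric_on_sym gU d a Uz).
  rewrite (GamC gU d a Uz).
  move: ('D_d _ z) (dot (b z) (dotcov g z a d c)) (dot (b z) (dotcov g z d a c)).
  by move=> D d1 d2; lra.
have := sym u v w; have := anti w v u; have := sym w u v; have := anti v u w.
have := sym v w u; have := anti u w v; lra.
Unshelve. all: by end_near. Qed.

Lemma isd_sform z u F G DF DG : U z -> is_cov g z u F DF -> is_cov g z u G DG ->
  is_derive z u (fun x => bil (sform x) (F x) (G x))
  (- mu * (dot (b z) (F z) * bil (g z) (G z) u - dot (b z) (G z) * bil (g z) (F z) u)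
   + bil (sform z) DF (G z) + bil (sform z) (F z) DG).
Proof.
move=> Uz Fd Gd; pose B := \matrix_(i, j) 'D_u (fun x => sform x i j) z.
have Bd i j : is_derive z u (fun x => sform x i j) (B i j).
  by rewrite mxE; exact: smooth_on_derivable (smooth_sform i j) Uz.
apply: (is_derive_eq (isd_bil Bd Fd Gd)).
have -> : bil B (F z) (G z) = 'D_u (fun x => bil (sform x) (F z) (G z)) z.
  apply/esym; apply: derive_val; apply: is_derive_eq.
    by apply: (isd_bil (F := fun=> F z) (G := fun=> G z) Bd).
  by rewrite bil0l bil0r !addr0.
rewrite killing_integrability // !bilE; ring.
Qed.

Lemma is_cov_J z u F DF : U z -> smooth_mx_on U F -> is_cov g z u F DF ->
  is_cov g z u (fun x => Jf x (F x))
   (- mu *: (bil (g z) u (F z) *: Xf z - dot (b z) (F z) *: u) + Jf z DF).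
Proof.
move=> Uz sF Fd; apply: (is_cov_inner gU Uz (smooth_Jf sF)) => w.
apply: (@near_eq_is_derive _ _ _ (fun x => bil (sform x) w (F x))).
  by apply: (near_eq_open oU) Uz => y Uy; rewrite bil_J.
apply: (is_derive_eq (isd_sform Uz (is_cov_cst g z u w) Fd)).
rewrite !bilE !bil_J // bil_X // (metric_on_sym gU w) // (metric_on_sym gU (F z)) //; ring.
Qed.

Lemma is_cov_S z u : U z ->
  is_cov g z u Sf (mu *: (dot (b z) u *: Xf z - sqlen g b z *: u) - Jf z (Jf z u)).
Proof.
move=> Uz.
apply: (is_cov_inner gU Uz smooth_Sf) => w.
apply: (@near_eq_is_derive _ _ _ (fun x => bil (sform x) (Xf x) w)).
  by apply: (near_eq_open oU) Uz => y Uy; rewrite bil_S.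
apply: (is_derive_eq (isd_sform Uz (is_cov_X u Uz) (is_cov_cst g z u w))).
rewrite !bilE !bil_J // !bil_X // bil_S // -sqlenX //.
rewrite (metric_on_sym gU w u Uz) (sformC z (Jf z u) w); ring.
Qed.
End OneForm.

(** * The structure equation as an identity for J^2 *)

Section StructureEquation.
Context {R : realType} {n : nat}.
Local Notation V := 'rV[R]_n.
Variables (U : set V) (g : V -> 'M[R]_n) (b : V -> V) (mu a : R).
Hypothesis gU : metric_on U g.
Hypothesis sb : smooth_mx_on U b.
Hypothesis kb : forall z, U z -> forall i j, cov g b i j z + cov g b j i z = 0.
Hypothesis str : forall z, U z -> forall y, structure_eq g b a mu z y.
Hypothesis a0 : a != 0.
Implicit Types (z u v w x : V).
Let oU : open U := metric_on_open gU.

Local Notation f := (sqlen g b).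
Definition pfun z : R := a ^+ 2 - mu * f z.
Local Notation p := pfun.
Local Notation s := (s0 g b).
Local Notation X := (Xf g b).
Local Notation S := (Sf g b).
Local Notation J := (Jf g b).

Let XE := @bil_X R n U g b gU.
Let SE := @bil_S R n U g b gU.
Let JE := @bil_J R n U g b gU.
Let S_J := @Sf_J R n U g b gU.
Let fX := @sqlenX R n U g b gU.
Let fXX := @sqlen_bil R n U g b gU.

(** The points where the quotient by p is an honest one and where X and S are both nonzero, as |X|^2
    = f and |S|^2 = f p. *)
Definition regular z := [/\ U z, f z != 0 & p z != 0].

Lemma metric_fun_sqr z y : U z -> metric_fun g z y ^+ 2 = bil (g z) y y.
Proof. by move=> Uz; rewrite /metric_fun sqr_sqrtr // innerE (metric_on_ge0 gU). Qed.

Lemma structure_regular z y : U z -> p z != 0 ->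
  t00 g b z y + a ^+ 2 * bil (g z) y y - mu * dot (b z) y ^+ 2
  - mu / p z * s z y ^+ 2 = 0.
Proof.
move=> Uz p0; have [L] := str Uz y; rewrite /quotient_value -/(p z) p0 => ->.
rewrite metric_fun_sqr // form_funE => <-.
move: p0; rewrite /pfun; set q := f z => p0; field.
exact: p0.
Qed.

Lemma t00E z y : U z -> t00 g b z y = bil (g z) (J z (J z y)) y.
Proof. by move=> Uz; rewrite -(t_mxE b gU). Qed.

(** The structure equation prescribes only the quadratic form of J^2. As J is skew, J^2 is
    self-adjoint, and polarization recovers the operator. *)
Lemma JJ z u : U z -> p z != 0 ->
  J z (J z u) = - a ^+ 2 *: u + (mu * dot (b z) u) *: X z + (mu / p z * s z u) *: S z.
Proof.
move=> Uz p0; apply: (metric_on_inj gU Uz) => w.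
rewrite !bilE XE // SE // -s0E.
have E y : bil (g z) (J z (J z y)) y = - a ^+ 2 * bil (g z) y y
    + mu * dot (b z) y ^+ 2 + mu / p z * s z y ^+ 2.
  have := structure_regular y Uz p0; rewrite t00E //; move: (mu / p z) => c; lra.
have sym x y : bil (g z) (J z (J z x)) y = bil (g z) (J z (J z y)) x.
  by rewrite !JE // [LHS]sformC [RHS]sformC -!JE // (metric_on_sym gU).
have sD x y : s z (x + y) = s z x + s z y by rewrite !s0E bilE.
have := E (u + w); rewrite !JfD !(bilDl, bilDr) !E (sym w u) !dotE sD.
rewrite (metric_on_sym gU w u Uz).
move: (mu / p z) (bil _ (J _ _) _) => c d; lra.
Qed.

Lemma s0_X z : s z (X z) = 0.
Proof. by rewrite s0E sform_diag. Qed.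

Lemma form_S z : U z -> dot (b z) (S z) = 0.
Proof. by move=> Uz; rewrite -XE // (metric_on_sym gU) // SE // sform_diag. Qed.

Lemma J_X z : U z -> J z (X z) = - S z.
Proof. by move=> Uz; rewrite S_J // opprK. Qed.

Lemma J_S z : U z -> p z != 0 -> J z (S z) = p z *: X z.
Proof.
move=> Uz p0; rewrite S_J // JfN JJ // s0_X mulr0 scale0r addr0 -fX //.
rewrite -scalerDl -scaleNr; congr (_ *: _); rewrite /pfun; ring.
Qed.

Lemma s0_S z : U z -> p z != 0 -> s z (S z) = f z * p z.
Proof.
move=> Uz p0; rewrite s0E -JE // J_S // bilZl -fXX //.
by rewrite mulrC.
Qed.

Lemma normS z : U z -> p z != 0 -> bil (g z) (S z) (S z) = f z * p z.
Proof. by move=> Uz p0; rewrite SE // -s0E s0_S. Qed.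

Lemma s0_J z u : U z -> p z != 0 -> s z (J z u) = - p z * dot (b z) u.
Proof.
move=> Uz p0; rewrite s0E -SE // (metric_on_sym gU) // JE // sformC.
by rewrite -JE // J_S // bilZl XE // mulNr.
Qed.

(** The sign of p comes from 0 <= |S|^2 = f p. This is what later confines the zero of p to an
    endpoint of the interval of values of b^2. *)
Lemma regular_gt0 z : regular z -> 0 < f z /\ 0 < p z.
Proof.
move=> [Uz f0 p0]; have fp : 0 < f z by rewrite lt_neqAle eq_sym f0 (sqlen_ge0 b gU).
split=> //; rewrite lt_neqAle eq_sym p0 /=.
by rewrite -(pmulr_rge0 _ fp) -normS // (metric_on_ge0 gU).
Qed.

Lemma smooth_pfun : smooth_on U p.
Proof.
apply: smooth_onD => //; first exact: smooth_on_cst.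
apply: smooth_onN => //; apply: smooth_onM => //; first exact: smooth_on_cst.
exact: smooth_sqlen.
Qed.

Lemma pfun_ge0 z : U z -> 0 <= p z.
Proof.
move=> Uz; have [->|p0] := eqVneq (p z) 0; first by [].
have [f0|f0] := eqVneq (f z) 0; first by rewrite /pfun f0 mulr0 subr0 sqr_ge0.
by have [] := regular_gt0 (And3 Uz f0 p0) => _ /ltW.
Qed.

Hypothesis n0 : (0 < n)%N.

(* If [X] vanished near z so would [J], against [J^2 = -a^2]. *)
Lemma regular_dense z (W : set V) : U z -> nbhs z W -> exists w, W w /\ regular w.
Proof.
move=> Uz Wz.
have [w [Uw Ww pw]] : exists w, [/\ U w, nbhs w W & p w != 0].
  have [p0|p0] := eqVneq (p z) 0; last by exists z.
  (* Where p vanishes, the structure equation is a statement about a limit, and its properness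
     clause provides nearby points with p nonzero. The tangent vector is immaterial, hence 0. *)
  have [L] := str Uz 0; rewrite /quotient_value -/(p z) p0 eqxx /= => -[FP _] _.
  have WU : nbhs z (W° `&` U).
    by apply: filterI; [exact: nbhs_interior|exact: open_nbhs_nbhs].
  have /= H : within [set w | a ^+ 2 - mu * f w != 0] (nbhs z) (W° `&` U `&` [set w | p w != 0]).
    by rewrite /within /=; near=> w => pw; split => //; near: w.
  have [w [[Ww Uw] pw]] := @filter_ex _ _ FP _ H.
  by exists w; split.
have nW : nbhs w (W `&` (U `&` [set y | p y != 0])).
  apply: filterI => //; apply: filterI; first exact: open_nbhs_nbhs.
  have pc : p y @[y --> w] --> p w by exact: (smooth_on_continuous smooth_pfun Uw).
  exact: (cvgr_neq0 _ pc pw).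
have [[y [[Wy [Uy py]] fy]]|nex] := pselect (exists y, (W `&` (U `&` [set y | p y != 0])) y /\ f y != 0).
  by exists y.
exfalso.
have f0 y : (W `&` (U `&` [set y | p y != 0])) y -> f y = 0.
  by move=> Wy; apply/eqP/negPn/negP => fy; apply: nex; exists y.
have Xw : \forall y \near w, (fun=> 0) y = X y.
  by near=> y; apply/esym/(sqlen_eq0 gU); [|apply: f0]; near: y => //; exact: open_nbhs_nbhs.
have X0 : X w = 0 by rewrite -(nbhs_singleton Xw).
have J0 u : J w u = 0.
  have D1 := is_cov_X gU sb kb u Uw.
  have D2 := near_eq_is_derive Xw (is_derive_cst (0 : V) w u).
  have : 'D_u X w = J w u - Gam g w u (X w) by exact: derive_val.
  rewrite (@derive_val _ _ _ _ _ _ _ D2) X0 -[X in Gam _ _ _ X](scale0r (0 : V)).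
  by rewrite (GamZr gU) // scale0r subr0.
pose u : V := delta_mx 0 (Ordinal n0).
have := JJ u Uw pw; rewrite !J0 S_J // X0 J0 oppr0 !scaler0 !addr0.
move/rowP/(_ (Ordinal n0)); rewrite !mxE !eqxx mulr1 => /esym/eqP.
by rewrite oppr_eq0 sqrf_eq0 (negbTE a0).
Unshelve. all: by end_near. Qed.

End StructureEquation.

(** * Deformed metrics *)

Section ConnectionDifference.
Context {R : realType} {n : nat}.
Local Notation V := 'rV[R]_n.
Variables (U : set V) (g gb : V -> 'M[R]_n) (T : V -> V -> V -> V).
Hypothesis gU : metric_on U g.
Hypothesis gbU : metric_on U gb.
Hypothesis TE : forall z u v, U z -> Gam gb z u v = Gam g z u v + T z u v.
Let oU : open U := metric_on_open gU.

(* N is the covariant derivative of T with respect to g. *)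
Lemma curvature_diff z (N : V -> V -> V -> V) : U z ->
  (forall u v w, is_cov g z u (fun y => T y v w)
     (N u v w + T z (Gam g z u v) w + T z v (Gam g z u w))) ->
  forall u v w, curvature gb z u v w = curvature g z u v w + N u v w - N v u w
    + T z u (T z v w) - T z v (T z u w).
Proof.
move=> Uz TN u v w; rewrite (curvatureE gbU) // (curvatureE gU) //.
have TC c d : T z c d = T z d c.
  have := TE c d Uz; rewrite (GamC gbU) // TE // (GamC gU) //.
  by move/(@addrI _ _ _ _) => ->.
have D c d e : dotcov gb z c d e = dotcov g z c d e +
    (N c d e + T z (Gam g z c d) e + T z d (Gam g z c e))
    + T z c (Gam g z d e) + T z c (T z d e).
  rewrite /dotcov.
  have D1 := smooth_row_isd c (smooth_Gam gU d e) Uz.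
  have D2 := TN c d e.
  have -> : 'D_c (fun x => Gam gb x d e) z =
      'D_c (fun x => Gam g x d e) z +
      (N c d e + T z (Gam g z c d) e + T z d (Gam g z c e) - Gam g z c (T z d e)).
    have DD := is_deriveD D1 D2; rewrite -(@derive_val _ _ _ _ _ _ _ DD).
    by apply: near_eq_derive; apply: (near_eq_open oU) Uz => y Uy; rewrite TE.
  rewrite (TE d e Uz) (GamDr gbU) // !(TE c) //.
  move: ('D_c _ z) (Gam g z c (T z d e)) => x y.
  apply/rowP => i; rewrite !mxE; ring.
rewrite !D (GamC gU v u Uz) (TC _ (Gam g z v w)) (TC _ (Gam g z u w)).
move: (dotcov _ _ _ _ _) (dotcov _ _ _ _ _) => x y.
apply/rowP => i; rewrite !mxE; ring.
Qed.

End ConnectionDifference.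

Section DifferenceTensor.
Context {R : realType} {n : nat}.
Local Notation V := 'rV[R]_n.
Variables (U : set V) (g : V -> 'M[R]_n) (b : V -> V) (mu : R).
Hypothesis gU : metric_on U g.
Hypothesis sb : smooth_mx_on U b.
Hypothesis kb : forall z, U z -> forall i j, cov g b i j z + cov g b j i z = 0.
Hypothesis cc : forall z, U z -> forall u v, row_free (col_mx u v) -> sectional g z u v = mu.
Variables (cA cB ck cr : V -> R).
Hypotheses (sA : smooth_on U cA) (sB : smooth_on U cB).
Hypotheses (sk : smooth_on U ck) (sr : smooth_on U cr).
Implicit Types (z u v w x : V).
Let oU : open U := metric_on_open gU.

Local Notation f := (sqlen g b).
Local Notation s := (s0 g b).
Local Notation X := (Xf g b).
Local Notation S := (Sf g b).
Local Notation J := (Jf g b).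
Local Notation ip z := (bil (g z)).
Local Notation bf z := (dot (b z)).
Local Notation sf z := (bil (sform g b z)).

(* With A = (kappa' + kappa^2) / (1 - kappa b^2), B = kappa' + 2 rho' kappa, k = kappa
   and r = 2 rho', this is the difference of the Levi-Civita connections of the deformed
   metric e^(2 rho) (g - kappa b b) and of g. *)
Definition Tdef z v w : V :=
  (- (cA z * (s z v * bf z w + s z w * bf z v))) *: X z +
  ((cB z * (bf z v * bf z w) - cr z * ip z v w) *: S z +
   ((- (ck z * bf z w)) *: J z v + ((- (ck z * bf z v)) *: J z w +
     ((cr z * s z v) *: w + (cr z * s z w) *: v)))).

(* The covariant derivatives in the direction u of S, J and Tdef, where J and Tdef are
   differentiated as tensors. *)
Definition covS z u : V := mu *: (bf z u *: X z - f z *: u) - J z (J z u).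

Definition covJ z u v : V := - mu *: (ip z u v *: X z - bf z v *: u).

Definition covT z u v w : V :=
  let h v := ip z (covS z u) v in
  (- ('D_u cA z * (s z v * bf z w + s z w * bf z v)
      + cA z * (h v * bf z w + s z v * sf z w u + h w * bf z v + s z w * sf z v u))) *: X z
  + (- (cA z * (s z v * bf z w + s z w * bf z v))) *: J z u
  + (('D_u cB z * (bf z v * bf z w) + cB z * (sf z v u * bf z w + bf z v * sf z w u)
      - 'D_u cr z * ip z v w) *: S z
     + (cB z * (bf z v * bf z w) - cr z * ip z v w) *: covS z u)
  + ((- ('D_u ck z * bf z w + ck z * sf z w u)) *: J z v + (- (ck z * bf z w)) *: covJ z u v)
  + ((- ('D_u ck z * bf z v + ck z * sf z v u)) *: J z w + (- (ck z * bf z v)) *: covJ z u w)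
  + (('D_u cr z * s z v + cr z * h v) *: w + ('D_u cr z * s z w + cr z * h w) *: v).

Lemma is_cov_scale z u (c : V -> R) F dc DF : U z ->
  is_derive z u c dc -> is_cov g z u F DF ->
  is_cov g z u (fun w => c w *: F w) (dc *: F z + c z *: DF).
Proof.
move=> Uz cd Fd.
have H0 : is_cov g z u (fun=> 0) 0.
  by apply: (is_cov_eq (is_cov_cst g z u 0));
    rewrite -[X in Gam _ _ _ X](scale0r (0 : V)) (GamZr gU) // scale0r.
have := is_cov_lincomb gU Uz cd Fd H0; rewrite addr0 /is_cov addr0.
by congr is_derive; apply/funext => w; rewrite addr0.
Qed.

(** The Leibniz rule for T(v, w): [covT] differentiates the tensor, and the two other terms come
    from the constant fields, whose covariant derivatives are [Gam g z u v] and [Gam g z u w]. *)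
Lemma is_cov_Tdef z u v w : U z -> is_cov g z u (fun y => Tdef y v w)
  (covT z u v w + Tdef z (Gam g z u v) w + Tdef z v (Gam g z u w)).
Proof.
move=> Uz.
have dA := smooth_on_derivable u sA Uz.
have dB := smooth_on_derivable u sB Uz.
have dk := smooth_on_derivable u sk Uz.
have dr := smooth_on_derivable u sr Uz.
have db c : is_derive z u (fun y => bf y c) (sf z c u + bf z (Gam g z u c)).
  exact: (isd_form gU sb kb Uz (is_cov_cst g z u c)).
have ds c : is_derive z u (fun y => s y c) (ip z (covS z u) c + s z (Gam g z u c)).
  apply: (@near_eq_is_derive _ _ _ (fun y => ip y (S y) c)).
    by apply: (near_eq_open oU) Uz => y Uy; rewrite (bil_S b gU).
  apply: (is_derive_eq (isd_inner gU Uz (is_cov_S gU sb kb cc u Uz) (is_cov_cst g z u c))).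
  by rewrite (bil_S b gU).
have dip c d : is_derive z u (fun y => ip y c d) (ip z (Gam g z u c) d + ip z c (Gam g z u d)).
  exact: (isd_inner gU Uz (is_cov_cst g z u c) (is_cov_cst g z u d)).
have DX := is_cov_X gU sb kb u Uz.
have DS : is_cov g z u S (covS z u) by exact: (is_cov_S gU sb kb cc u Uz).
have DJ c : is_cov g z u (fun y => J y c) (covJ z u c + J z (Gam g z u c)).
  apply: (is_cov_J gU sb kb cc Uz _ (is_cov_cst g z u c)).
  by apply: smooth_mx_cst.
have Dc := is_cov_cst g z u.
apply: is_cov_eq.
  apply: (is_cov_lincomb gU Uz (isdN (isdM dA (isdD (isdM (ds v) (db w)) (isdM (ds w) (db v))))) DX).
  apply: (is_cov_lincomb gU Uz (isdD (isdM dB (isdM (db v) (db w))) (isdN (isdM dr (dip v w)))) DS).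
  apply: (is_cov_lincomb gU Uz (isdN (isdM dk (db w))) (DJ v)).
  apply: (is_cov_lincomb gU Uz (isdN (isdM dk (db v))) (DJ w)).
  apply: (is_cov_lincomb gU Uz (isdM dr (ds v)) (Dc w)).
  exact: (is_cov_scale Uz (isdM dr (ds w)) (Dc v)).
rewrite /covT /Tdef.
move: ('D_u cA z) ('D_u cB z) ('D_u ck z) ('D_u cr z) (cA z) (cB z) (ck z) (cr z)
  => xA xB xk xr yA yB yk yr.
move: (covS z u) (covJ z u v) (covJ z u w) => hS hv hw.
move: (Gam g z u v) (Gam g z u w) => Gv Gw.
move: (J z u) (J z v) (J z w) (J z Gv) (J z Gw) (X z) (S z) => Ju Jv Jw JGv JGw X' S'.
apply/rowP => i; rewrite !mxE; ring.
Qed.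

Lemma TdefC z v w : U z -> Tdef z v w = Tdef z w v.
Proof.
move=> Uz; rewrite /Tdef (metric_on_sym gU w v Uz).
move: (J z v) (J z w) (X z) (S z) => Jv Jw X' S'.
apply/rowP => i; rewrite !mxE; ring.
Qed.

End DifferenceTensor.

(** * Connection and curvature of the deformed metric *)

Section Deformation.
Context {R : realType} {n : nat}.
Local Notation V := 'rV[R]_n.

Record killing_data (U : set V) (g : V -> 'M[R]_n) (b : V -> V) (mu a : R) : Prop := {
  kd_metric : metric_on U g;
  kd_smooth : smooth_mx_on U b;
  kd_killing : forall z, U z -> forall i j, cov g b i j z + cov g b j i z = 0;
  kd_curvature : forall z, U z -> forall u v, row_free (col_mx u v) -> sectional g z u v = mu;
  kd_structure : forall z, U z -> forall y, structure_eq g b a mu z y;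
  kd_a : a != 0;
  kd_n : (2 < n)%N }.

Variables (U : set V) (g : V -> 'M[R]_n) (b : V -> V) (mu a : R).
Hypothesis KD : killing_data U g b mu a.
Variables (gb : V -> 'M[R]_n) (I : set R) (rho kappa : R -> R).
Local Notation f := (sqlen g b).
Hypothesis fI : forall z, U z -> I (f z).
Hypotheses (srho : smooth1_on I rho) (skappa : smooth1_on I kappa).
Hypothesis Dpos : forall z, U z -> 0 < 1 - f z * kappa (f z).
Hypothesis gbE : forall z, U z ->
  gb z = expR (rho (f z)) ^+ 2 *: (g z - kappa (f z) *: ((b z)^T *m b z)).
Implicit Types (z u v w x y : V).

Let gU := kd_metric KD.
Let sb := kd_smooth KD.
Let kb := kd_killing KD.
Let cc := kd_curvature KD.
Let str := kd_structure KD.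
Let a0 := kd_a KD.
Let oU : open U := metric_on_open gU.
Let XE := @bil_X R n U g b gU.
Let SE := @bil_S R n U g b gU.
Let JE := @bil_J R n U g b gU.

Local Notation s := (s0 g b).
Local Notation X := (Xf g b).
Local Notation S := (Sf g b).
Local Notation J := (Jf g b).
Local Notation ip z := (bil (g z)).
Local Notation bf z := (dot (b z)).
Local Notation sf z := (bil (sform g b z)).
Local Notation p := (pfun g b mu a).
Local Notation regular := (regular U g b mu a).

Definition efac z : R := expR (rho (f z)) ^+ 2.
Definition dk z : R := kappa (f z).
Definition dk1 z : R := derive1 kappa (f z).
Definition dr z : R := 2 * derive1 rho (f z).
Definition dA z : R := (dk1 z + dk z ^+ 2) / (1 - f z * dk z).
Definition dB z : R := dk1 z + dr z * dk z.

Let sf_ : smooth_on U f := smooth_sqlen gU sb.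

Lemma efac_gt0 z : 0 < efac z.
Proof. by rewrite exprn_gt0 // expR_gt0. Qed.

Lemma smooth_dk : smooth_on U dk.
Proof. exact: (smooth_on_comp oU skappa fI sf_). Qed.
Lemma smooth_dk1 : smooth_on U dk1.
Proof. exact: (smooth_on_comp oU (smooth1_on_derive1 skappa) fI sf_). Qed.
Lemma smooth_dr : smooth_on U dr.
Proof.
apply: smooth_onM => //; first exact: smooth_on_cst.
exact: (smooth_on_comp oU (smooth1_on_derive1 srho) fI sf_).
Qed.
Lemma smooth_dA : smooth_on U dA.
Proof.
apply: smooth_onM => //.
  apply: smooth_onD => //; first exact: smooth_dk1.
  by apply: smooth_onM => //; exact: smooth_dk.
apply: smooth_onV => //; first by move=> z Uz; rewrite gt_eqF // Dpos.
apply: smooth_onD => //; first exact: smooth_on_cst.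
by apply: smooth_onN => //; apply: smooth_onM => //; exact: smooth_dk.
Qed.
Lemma smooth_dB : smooth_on U dB.
Proof.
apply: smooth_onD => //; first exact: smooth_dk1.
by apply: smooth_onM => //; [exact: smooth_dr|exact: smooth_dk].
Qed.
Lemma smooth_efac : smooth_on U efac.
Proof.
have se : smooth_on U (fun z => expR (rho (f z))).
  apply: (@smooth_on_comp _ _ U setT expR (fun z => rho (f z)) oU (@smooth1_on_expR _ _)) => //.
  exact: (smooth_on_comp oU srho fI sf_).
exact: smooth_onM.
Qed.

Lemma isd_comp_sqlen (h : R -> R) z u : smooth1_on I h -> U z ->
  is_derive z u (fun y => h (f y)) (derive1 h (f z) * (2 * s z u)).
Proof.
move=> sh Uz; apply: isd_comp; first exact: smooth1_on_isd sh (fI Uz).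
exact: (isd_sqlen gU sb kb u Uz).
Qed.

Lemma isd_efac z u : U z -> is_derive z u efac (efac z * (dr z * (2 * s z u))).
Proof.
move=> Uz.
have H := isdX2 (isd_comp (is_derive_expR (rho (f z))) (isd_comp_sqlen u srho Uz)).
by apply: (is_derive_eq H); rewrite /efac /dr; ring.
Qed.

Lemma derive_dk z u : U z -> 'D_u dk z = dk1 z * (2 * s z u).
Proof. by move=> Uz; apply: derive_val; exact: isd_comp_sqlen. Qed.

Lemma derive_dr z u : U z -> 'D_u dr z = 2 * derive1 (derive1 rho) (f z) * (2 * s z u).
Proof.
move=> Uz; apply: derive_val.
have H := isdM (isd_cst z u 2) (isd_comp_sqlen u (smooth1_on_derive1 srho) Uz).
by apply: (is_derive_eq H); rewrite mul0r add0r mulrA.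
Qed.

Lemma bil_gb z u v : U z ->
  bil (gb z) u v = efac z * (ip z u v - dk z * (bf z u * bf z v)).
Proof.
move=> Uz; rewrite gbE // {1}/bil -scalemxAr -scalemxAl mxE; congr (_ * _).
rewrite mulmxBr mulmxBl -scalemxAr -scalemxAl mxE; congr (_ + _).
rewrite mxE [X in - X]mxE; congr (- (_ * _)).
have -> : u *m ((b z)^T *m b z) *m v^T = (b z *m u^T)^T *m (b z *m v^T).
  by rewrite trmx_mul trmxK !mulmxA.
by rewrite [LHS]mxE big_ord1 [X in X * _]mxE.
Qed.

(** Positivity is clear for kappa <= 0; for kappa > 0 the Cauchy-Schwarz bound b(y)^2 <= f g(y, y)
    reduces it to kappa f < 1. *)
Lemma metric_on_gb : metric_on U gb.
Proof.
split=> //.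
- move=> i j; apply: (eq_smooth_on (f := fun z => efac z * (g z i j + -1 * (dk z * (b z 0 i * b z 0 j))))) => //.
    move=> z Uz; rewrite -[RHS]bil_delta bil_gb // bil_delta !dot_delta; ring.
  apply: smooth_onM => //; first exact: smooth_efac.
  apply: smooth_onD => //; first by case: gU.
  apply: smooth_onM => //; first exact: smooth_on_cst.
  apply: smooth_onM => //; first exact: smooth_dk.
  by apply: smooth_onM => //; exact: sb.
- move=> z Uz; apply: bilP => u v.
  by rewrite bil_tr !bil_gb // (metric_on_sym gU v u Uz) [bf z v * _]mulrC.
move=> z Uz y y0; rewrite bil_gb // pmulr_rgt0 ?efac_gt0 //.
have yp := metric_on_pos gU Uz y0.
have := form_sqr_le b gU y Uz; rewrite -expr2 => cs.
have [k0|k0] := lerP (dk z) 0.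
  by rewrite ltr_wpDr // oppr_ge0 mulr_le0_ge0 // sqr_ge0.
rewrite subr_gt0; apply: (@le_lt_trans _ _ (dk z * (f z * ip z y y))).
  by rewrite ler_pM2l.
rewrite mulrA -[ltRHS]mul1r ltr_pM2r //.
by have := Dpos Uz; rewrite subr_gt0 mulrC.
Qed.

Local Notation T := (Tdef g b dA dB dk dr).

(** The tensor T is verified, not derived: [Gam g + T] is symmetric and compatible with [gb], which
    characterizes the Levi-Civita connection. *)
Lemma Gam_gb z u v : U z -> Gam gb z u v = Gam g z u v + T z u v.
Proof.
move=> Uz; move: u v; apply: (Gam_unique metric_on_gb Uz) => [u v|u v w].
  by rewrite (GamC gU u v Uz) (TdefC b gU _ _ _ _ u v Uz).
have db c : is_derive z u (fun y => bf y c) (sf z c u + bf z (Gam g z u c)).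
  exact: (isd_form gU sb kb Uz (is_cov_cst g z u c)).
have dip : is_derive z u (fun y => ip y v w) (ip z (Gam g z u v) w + ip z v (Gam g z u w)).
  exact: (isd_inner gU Uz (is_cov_cst g z u v) (is_cov_cst g z u w)).
have dkd : is_derive z u dk (dk1 z * (2 * s z u)) by exact: isd_comp_sqlen.
have D := isdM (isd_efac u Uz) (isdD dip (isdN (isdM dkd (isdM (db v) (db w))))).
have -> : 'D_u (fun x => bil (gb x) v w) z =
  'D_u (fun x => efac x * (ip x v w + - (dk x * (bf x v * bf x w)))) z.
  by apply: near_eq_derive; apply: (near_eq_open oU) Uz => y Uy; rewrite bil_gb.
rewrite (@derive_val _ _ _ _ _ _ _ D) !bil_gb // /Tdef.
rewrite !dotE !(form_S b gU) // -!(sqlenX b gU) // !(form_J b gU) // -!s0E.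
rewrite !(metric_on_sym gU v) // !bilE !XE // !SE // !JE // -!s0E.
rewrite (metric_on_sym gU u w Uz) (metric_on_sym gU u v Uz).
rewrite (metric_on_sym gU w v Uz).
rewrite (sformC g b z u v) (sformC g b z v w) (sformC g b z u w).
(* Since gb(X, w) = e (1 - f k) b(w), the X-coefficient of T contains the inverse of 1 - f k.
   Eliminating kappa' in favour of A leaves a polynomial identity. *)
have dAE : dk1 z = dA z * (1 - f z * dk z) - dk z ^+ 2.
  by rewrite /dA divfK ?addrK // gt_eqF // Dpos.
rewrite /dB dAE.
move: (efac z) (dA z) (dk z) (dr z) => e A k r.
move: (bil _ (Gam _ _ _ _) _) (bil _ (Gam _ _ _ _) _).
move: (bf z (Gam _ _ _ _)) (bf z (Gam _ _ _ _)) => c1 c2 c3 c4.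
ring.
Qed.

Local Notation N := (covT g b mu dA dB dk dr).

Lemma curvature_gb z u v w x : U z -> ip z (curvature gb z u v w) x =
  mu * (ip z v w * ip z u x - ip z u w * ip z v x) + ip z (N z u v w) x
  - ip z (N z v u w) x + ip z (T z u (T z v w)) x - ip z (T z v (T z u w)) x.
Proof.
move=> Uz; have TN u' v' w' := is_cov_Tdef gU sb kb cc smooth_dA smooth_dB smooth_dk smooth_dr u' v' w' Uz.
rewrite (curvature_diff gU metric_on_gb Gam_gb Uz TN) !(bilDl, bilNl).
by have := const_sectional gU Uz (cc Uz) u v w x; rewrite /cform => ->.
Qed.

Lemma covS_regular z u : U z -> p z != 0 ->
  covS g b mu z u = p z *: u + (- (mu / p z) * s z u) *: S z.
Proof.
move=> Uz p0; rewrite /covS (JJ gU str u Uz p0) /pfun; apply/rowP => i; rewrite !mxE.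
move: (mu / _) (X z 0 i) (S z 0 i) => c x' y'; ring.
Qed.

Lemma TdefZr z c u v : U z -> T z u (c *: v) = c *: T z u v.
Proof.
move=> Uz; rewrite /Tdef !s0E !bilE !dotE !JfZ.
move: (J z u) (J z v) (X z) (S z) => Ju Jv X' S'.
move: (dA z) (dB z) (dk z) (dr z) => A B k r.
apply/rowP => i; rewrite !mxE; ring.
Qed.

Lemma covTE z u v w x : U z -> ip z (N z u v w) x =
  - ('D_u dA z * (s z v * bf z w + s z w * bf z v)
      + dA z * (ip z (covS g b mu z u) v * bf z w + s z v * sf z w u
                + ip z (covS g b mu z u) w * bf z v + s z w * sf z v u)) * bf z x
  - dA z * (s z v * bf z w + s z w * bf z v) * sf z x u
  + ('D_u dB z * (bf z v * bf z w) + dB z * (sf z v u * bf z w + bf z v * sf z w u)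
      - 'D_u dr z * ip z v w) * s z x
  + (dB z * (bf z v * bf z w) - dr z * ip z v w) * ip z (covS g b mu z u) x
  - (dk1 z * (2 * s z u) * bf z w + dk z * sf z w u) * sf z x v
  - dk z * bf z w * (- mu * (ip z u v * bf z x - bf z v * ip z u x))
  - (dk1 z * (2 * s z u) * bf z v + dk z * sf z v u) * sf z x w
  - dk z * bf z v * (- mu * (ip z u w * bf z x - bf z w * ip z u x))
  + ('D_u dr z * s z v + dr z * ip z (covS g b mu z u) v) * ip z w x
  + ('D_u dr z * s z w + dr z * ip z (covS g b mu z u) w) * ip z v x.
Proof.
move=> Uz; rewrite /covT /covJ derive_dk //.
move: (covS g b mu z u) => h; rewrite !bilE !XE // !SE // !JE // -!s0E; ring.
Qed.

(** * Curvature components along a vector orthogonal to X and S *)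

Section Transversal.
Variables (z y : V) (reg : regular z).
Hypotheses (by0 : bf z y = 0) (sy0 : s z y = 0) (y0 : y != 0).

Let Uz : U z. Proof. by case: reg. Qed.
Let p0 : p z != 0. Proof. by case: reg. Qed.
Let f0 : f z != 0. Proof. by case: reg. Qed.
Let ipC u v := metric_on_sym gU u v Uz.

Let fXX : bf z (X z) = f z. Proof. by rewrite -(sqlenX b gU). Qed.
Let sX : s z (X z) = 0. Proof. exact: s0_X. Qed.
Let bS : bf z (S z) = 0. Proof. exact: (form_S b gU). Qed.
Let sS : s z (S z) = f z * p z. Proof. exact: (s0_S gU str). Qed.
Let JX : J z (X z) = - S z. Proof. exact: (J_X b gU). Qed.
Let JS : J z (S z) = p z *: X z. Proof. exact: (J_S gU str). Qed.
Let bJy : bf z (J z y) = 0. Proof. by rewrite (form_J b gU). Qed.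
Let sJy : s z (J z y) = 0. Proof. by rewrite (s0_J gU str) // by0 mulr0. Qed.
Let JJy : J z (J z y) = - a ^+ 2 *: y.
Proof. by rewrite (JJ gU str) // by0 sy0 !mulr0 !scale0r !addr0. Qed.
Let Xip u : ip z (X z) u = bf z u. Proof. exact: XE. Qed.
Let Sip u : ip z (S z) u = s z u. Proof. exact: SE. Qed.
Let ipX u : ip z u (X z) = bf z u. Proof. by rewrite ipC. Qed.
Let ipS u : ip z u (S z) = s z u. Proof. by rewrite ipC. Qed.
Let yJy : ip z y (J z y) = 0. Proof. by rewrite ipC JE // sform_diag. Qed.
Let Jyy : ip z (J z y) y = 0. Proof. by rewrite ipC. Qed.
Let sfyJy : sf z y (J z y) = - a ^+ 2 * ip z y y.
Proof. by rewrite -JE // JJy bilZl. Qed.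
Let sfJyy : sf z (J z y) y = a ^+ 2 * ip z y y.
Proof. by rewrite sformC sfyJy; ring. Qed.
Let JyJy : ip z (J z y) (J z y) = a ^+ 2 * ip z y y.
Proof. by rewrite JE. Qed.
Let sfX u : sf z (X z) u = s z u. Proof. by []. Qed.
Let sf_X u : sf z u (X z) = - s z u. Proof. by rewrite sformC. Qed.
Let sf_S u : sf z u (S z) = p z * bf z u.
Proof. by rewrite -JE // JS bilZl Xip. Qed.
Let sfS u : sf z (S z) u = - p z * bf z u.
Proof. by rewrite sformC sf_S mulNr. Qed.
Let hS u v : ip z (covS g b mu z u) v = p z * ip z u v - (mu / p z) * s z u * s z v.
Proof. by rewrite covS_regular // !bilE Sip; ring. Qed.
Let N2 : ip z y y != 0. Proof. by rewrite gt_eqF // (metric_on_pos gU). Qed.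

(** The multiplication table of X, S, y and J y under b, s, J and g, used as a rewriting system that
    reduces each component to the scalars f, p, g(y, y), a and the coefficients of T. *)
Let facts := (fXX, sX, bS, sS, JX, JS, by0, sy0, bJy, sJy, JJy, Xip, Sip, ipX, ipS, yJy,
  Jyy, JyJy).
Let sfacts := (sfX, sf_X, sfS, sf_S, sfyJy, sfJyy, sform_diag g b z).
Let zeros := (mulr0, mul0r, addr0, add0r, subr0, sub0r, oppr0, scale0r, scaler0).

Let T_XX : T z (X z) (X z) = (f z * (dB z * f z + 2 * dk z - dr z)) *: S z.
Proof.
rewrite /Tdef !facts !zeros; apply/rowP => i; rewrite !mxE.
move: (X z 0 i) (S z 0 i) => x' s'; ring.
Qed.
Let T_yS : T z y (S z) = (dr z * (f z * p z)) *: y.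
Proof. by rewrite /Tdef !facts !zeros. Qed.
Let T_Sy : T z (S z) y = (dr z * (f z * p z)) *: y.
Proof. by rewrite (TdefC b gU). Qed.
Let T_yX : T z y (X z) = (- (dk z * f z)) *: J z y.
Proof. by rewrite /Tdef !facts !zeros. Qed.
Let T_XJy : T z (X z) (J z y) = (dk z * f z * a ^+ 2) *: y.
Proof.
rewrite /Tdef !facts !zeros; apply/rowP => i; rewrite !mxE; ring.
Qed.
Let T_JyX : T z (J z y) (X z) = (dk z * f z * a ^+ 2) *: y.
Proof. by rewrite (TdefC b gU). Qed.
Let T_JyJy : T z (J z y) (J z y) = (- (dr z * (a ^+ 2 * ip z y y))) *: S z.
Proof. by rewrite /Tdef !facts !zeros. Qed.
Let T_yJy : T z y (J z y) = 0.
Proof. by rewrite /Tdef !facts !zeros. Qed.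
Let T_SX : T z (S z) (X z) =
  (f z * p z * (- dA z * f z - dk z + dr z)) *: X z.
Proof.
rewrite /Tdef !facts !zeros; apply/rowP => i; rewrite !mxE.
move: (X z 0 i) (S z 0 i) => x' s'; ring.
Qed.

Let T_0 u : T z u 0 = 0.
Proof. by rewrite -[in LHS](scale0r (0 : V)) (TdefZr _ _ _ Uz) scale0r. Qed.

Variable mub : R.
Hypothesis ccb : forall u v, row_free (col_mx u v) -> sectional gb z u v = mub.

(** As b(y) = 0, pairing with y through [gb] is e times pairing through [g]. The factor e cancels,
    so the components ending in y can be computed with [g]. *)
Let cb u v w : ip z (curvature gb z u v w) y =
  mub * (bil (gb z) v w * ip z u y - bil (gb z) u w * ip z v y).
Proof.
have := const_sectional metric_on_gb Uz ccb u v w y.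
rewrite /cform !bil_gb // by0 !mulr0 !subr0 => H.
apply: (mulfI (lt0r_neq0 (efac_gt0 z))); rewrite H -!bil_gb //; ring.
Qed.

(* The (y, J y, J y, y) component of the curvature of gb. *)
Lemma transversal_curvature : mu + 3 * dk z * a ^+ 2 - 2 * dr z * p z
  - dr z ^+ 2 * (f z * p z) = mub * efac z.
Proof.
have := cb y (J z y) (J z y).
rewrite (curvature_gb _ _ _ _ Uz) T_yJy T_JyJy !(TdefZr _ _ _ Uz) T_yS.
rewrite !(covTE _ _ _ _ Uz) !(bil_gb _ _ Uz) !hS T_0 bil0l !bilZl.
rewrite !facts !sfacts ?facts.
(* The derivatives of A, B and r can be arbitrary scalars, since their coefficients vanish in this
   component; rho'' and kappa'' therefore do not enter. *)
move: ('D_y dA z : R) ('D_y dB z : R) ('D_y dr z : R) => DA DB DR.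
move: ('D_(J z y) dA z : R) ('D_(J z y) dB z : R) ('D_(J z y) dr z : R) => DA' DB' DR'.
move: (mu / p z) => c.
move: (dA z) (dB z) (dk1 z) (dk z) (dr z) (efac z) => cA cB k1 k r e.
move: (f z) f0 (p z) p0 (ip z y y) N2 => F F0 P P0 N N0.
have aN : a ^+ 2 * N * N != 0 by rewrite !mulf_neq0 // expf_neq0.
move/eqP; rewrite -subr_eq0 => /eqP H.
apply: (mulfI aN); apply/eqP; rewrite -subr_eq0; apply/eqP; rewrite -[RHS]H; ring.
Qed.

(* The (J y, S, X, y) component, which vanishes for constant curvature. *)
Lemma transversal_mixed : dk1 z * f z + dk z = 0.
Proof.
have := cb (J z y) (S z) (X z).
rewrite (curvature_gb _ _ _ _ Uz) T_SX T_JyX !(TdefZr _ _ _ Uz) T_JyX T_Sy.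
rewrite !bilZl !(covTE _ _ _ _ Uz) !(bil_gb _ _ Uz) !hS.
rewrite !facts !sfacts ?facts.
have dAE : dA z * (1 - f z * dk z) = dk1 z + dk z ^+ 2.
  by rewrite /dA divfK // gt_eqF // Dpos.
move: ('D_(S z) dA z : R) ('D_(S z) dB z : R) ('D_(S z) dr z : R) => DA DB DR.
move: ('D_(J z y) dA z : R) ('D_(J z y) dB z : R) ('D_(J z y) dr z : R) => DA' DB' DR'.
move: dAE.
move: (mu / p z) => c.
move: (dA z) (dB z) (dk1 z) (dk z) (dr z) (efac z) => cA cB k1 k r e.
move: (f z) f0 (p z) p0 (ip z y y) N2 => F F0 P P0 N N0.
have aN : a ^+ 2 * N * (F * P) != 0 by rewrite !mulf_neq0 // expf_neq0.
move=> dAE; have {dAE} -> : k1 = cA * (1 - F * k) - k ^+ 2 by rewrite dAE addrK.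
move/eqP; rewrite -subr_eq0 => /eqP H.
apply: (mulfI aN); rewrite mulr0 -[RHS]oppr0 -H; ring.
Qed.

(* The (y, X, X, y) component. *)
Lemma transversal_axial : mu + dB z * f z * p z - 2 * dk z * mu * f z
  - 2 * dr z * p z + dr z * f z * p z * (dB z * f z + 2 * dk z - dr z)
  + dk z ^+ 2 * f z * a ^+ 2 = mub * efac z * (1 - f z * dk z).
Proof.
have := cb y (X z) (X z).
rewrite (curvature_gb _ _ _ _ Uz) T_XX T_yX !(TdefZr _ _ _ Uz) T_yS T_XJy.
rewrite !(covTE _ _ _ _ Uz) !(bil_gb _ _ Uz) !hS !bilZl.
rewrite !facts !sfacts ?facts.
move: ('D_y dA z : R) ('D_y dB z : R) ('D_y dr z : R) => DA DB DR.
move: ('D_(X z) dA z : R) ('D_(X z) dB z : R) ('D_(X z) dr z : R) => DA' DB' DR'.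
move: (mu / p z) => c.
move: (dA z) (dB z) (dk1 z) (dk z) (dr z) (efac z) => cA cB k1 k r e.
move: (f z) f0 (p z) p0 (ip z y y) N2 => F F0 P P0 N N0.
have FN : F * N != 0 by rewrite mulf_neq0.
move/eqP; rewrite -subr_eq0 => /eqP H.
apply: (mulfI FN); apply/eqP; rewrite -subr_eq0; apply/eqP; rewrite -[RHS]H; ring.
Qed.

Lemma transversal_kappa : dk z = 0.
Proof.
have dBE : dB z = dk1 z + dr z * dk z by [].
have pE : p z = a ^+ 2 - mu * f z by [].
have D0 : 1 - f z * dk z != 0 by rewrite gt_eqF // Dpos.
have := transversal_curvature; have := transversal_axial; have := transversal_mixed.
move: dBE pE D0 f0 a0.
move: (dA z) (dB z) (dk1 z) (dk z) (dr z) (efac z) => cA cB k1 k r e.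
move: (f z) (p z) => F P -> -> D0 F0 A0 mixed axial curv.
(* Multiplying [axial] by F completes a square in r, and [mixed] removes kappa'; the result is
   divisible by 1 - F k, which is nonzero. Multiplying [curv] by F completes the same square, and
   the difference of the two is 4 a^2 F k = 0. *)
have E1 : (1 - F * k) * (a ^+ 2 * (1 - F * k)
    - (a ^+ 2 - mu * F) * (1 + r * F) ^+ 2 - mub * e * F) = 0.
  have := congr1 (fun t => F * t) axial.
  have := congr1 (fun t => t * (F * (a ^+ 2 - mu * F) * (1 + r * F))) mixed.
  move=> /=; lra.
move/eqP: E1; rewrite mulf_eq0 (negbTE D0) /= => /eqP E1.
have E2 : 4 * a ^+ 2 * F * k = 0.
  by have := congr1 (fun t => F * t) curv; move: E1 => /=; lra.
have nz : 4 * a ^+ 2 * F != 0 by rewrite !mulf_neq0 ?pnatr_eq0 // expf_neq0.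
by apply: (mulfI nz); rewrite mulr0.
Qed.

End Transversal.
End Deformation.

(** The vector is found in the kernel of an n by 2 matrix, nonzero because the rank is at most 2. *)
Lemma exists_orthogonal {R : realType} {n : nat} (c d : 'rV[R]_n) : (2 < n)%N ->
  exists y, [/\ y != 0, dot c y = 0 & dot d y = 0].
Proof.
move=> n2; pose A := row_mx c^T d^T.
have kA : kermx A != 0.
  rewrite -mxrank_eq0 mxrank_ker subn_eq0 -ltnNge.
  by apply: leq_ltn_trans n2; exact: rank_leq_col.
have /rowV0Pn [y /sub_kermxP yA y0] := kA.
exists y; split=> //; move: yA; rewrite mul_mx_row -[0]row_mx0 => /eq_row_mx [yc yd].
  by rewrite /dot -[c]trmxK -trmx_mul yc trmx0 mxE.
by rewrite /dot -[d]trmxK -trmx_mul yd trmx0 mxE.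
Qed.

(** * Conformal factors *)

Section Density.
Context {R : realType} {n : nat}.
Local Notation V := 'rV[R]_n.
Variables (U : set V) (g : V -> 'M[R]_n) (b : V -> V) (mu a : R).
Hypothesis KD : killing_data U g b mu a.

Lemma regular_eq0 (F : V -> R) : smooth_on U F ->
  (forall z, regular U g b mu a z -> F z = 0) -> forall z, U z -> F z = 0.
Proof.
move=> sF F0 z Uz; apply/eqP/negPn/negP => Fz.
have Fc : F y @[y --> z] --> F z by exact: (smooth_on_continuous sF Uz).
have nF : nbhs z [set y | F y != 0] by exact: (cvgr_neq0 _ Fc Fz).
have [w [Fw rw]] := regular_dense (kd_metric KD) (kd_smooth KD) (kd_killing KD)
  (kd_structure KD) (kd_a KD) (ltn_trans (isT : (0 < 2)%N) (kd_n KD)) Uz nF.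
by move: Fw; rewrite /= F0 ?eqxx.
Qed.

End Density.

Section Conformal.
Context {R : realType} {n : nat}.
Local Notation V := 'rV[R]_n.
Variables (U : set V) (g : V -> 'M[R]_n) (b : V -> V) (mu a : R).
Hypothesis KD : killing_data U g b mu a.
Variables (gb : V -> 'M[R]_n) (I : set R) (rho : R -> R).
Local Notation f := (sqlen g b).
Hypothesis fI : forall z, U z -> I (f z).
Hypothesis srho : smooth1_on I rho.
Hypothesis gbE : forall z, U z -> gb z = efac g b rho z *: g z.
Implicit Types (z u v w x y : V).

Let gU := kd_metric KD.
Let str := kd_structure KD.
Let oU : open U := metric_on_open gU.
Let zero1 : R -> R := fun=> 0.

Local Notation s := (s0 g b).
Local Notation S := (Sf g b).
Local Notation J := (Jf g b).
Local Notation ip z := (bil (g z)).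
Local Notation p := (pfun g b mu a).
Local Notation regular := (regular U g b mu a).
Local Notation e := (efac g b rho).
Local Notation r := (dr g b rho).
Local Notation T := (Tdef g b (fun=> 0) (fun=> 0) (fun=> 0) r).

Let szero : smooth1_on I zero1.
Proof.
move=> k t _; rewrite (_ : derive1n k zero1 = zero1) ?/zero1; first exact: derivable_cst.
by elim: k => // k IH; rewrite derive1nS IH; apply/funext => x; rewrite derive1_cst.
Qed.

Let Dpos0 z : U z -> 0 < 1 - f z * zero1 (f z).
Proof. by rewrite /zero1 mulr0 subr0 ltr01. Qed.

Let gbE0 z : U z -> gb z = expR (rho (f z)) ^+ 2 *: (g z - zero1 (f z) *: ((b z)^T *m b z)).
Proof. by move=> Uz; rewrite gbE // scale0r subr0. Qed.

Let dk10 : dk1 g b zero1 = fun=> 0.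
Proof. by apply/funext => z; rewrite /dk1 derive1_cst. Qed.
Let dA0 : dA g b zero1 = fun=> 0.
Proof. by apply/funext => z; rewrite /dA dk10 /dk /zero1 expr0n /= addr0 mul0r. Qed.
Let dB0 : dB g b rho zero1 = fun=> 0.
Proof. by apply/funext => z; rewrite /dB dk10 /dk /zero1 mulr0 addr0. Qed.

Lemma metric_on_conformal : metric_on U gb.
Proof. exact: (metric_on_gb KD fI srho szero Dpos0 gbE0). Qed.

Lemma bil_conformal z u v : U z -> bil (gb z) u v = e z * ip z u v.
Proof. by move=> Uz; rewrite gbE // /bil -scalemxAr -scalemxAl mxE. Qed.

Lemma Gam_conformal z u v : U z -> Gam gb z u v =
  Gam g z u v + (r z * (s z u) *: v + r z * s z v *: u - r z * ip z u v *: S z).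
Proof.
move=> Uz; rewrite (Gam_gb KD fI srho szero Dpos0 gbE0) // dA0 dB0 /Tdef.
congr (_ + _); rewrite /dk /zero1 !mul0r oppr0 !scale0r !add0r scaleNr.
by rewrite addrC.
Qed.

(** This is [curvature_gb] for kappa = 0. The last factor equals |s(u) v - s(v) u|^2, so planes on
    which s vanishes see only the first coefficient, and rho'' occurs only in the second. *)
Lemma curvature_conformal z u v : regular z ->
  ip z (curvature gb z u v v) u =
  (mu - 2 * r z * p z - r z ^+ 2 * (f z * p z)) * gram g z u v
  - (4 * derive1 (derive1 rho) (f z) - r z ^+ 2 - r z * mu / p z)
    * (s z u ^+ 2 * ip z v v + s z v ^+ 2 * ip z u u - 2 * s z u * s z v * ip z u v).
Proof.
move=> [Uz f0 p0].
have dr_ c := derive_dr KD fI srho c Uz.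
have hS c d : ip z (covS g b mu z c) d = p z * ip z c d - (mu / p z) * s z c * s z d.
  by rewrite (covS_regular KD) // !bilE (bil_S b gU) // -s0E; move: (mu / p z) => k; ring.
have sS : s z (S z) = f z * p z by exact: (s0_S gU str).
have SE c : ip z (S z) c = s z c by rewrite (bil_S b gU).
have SEr c : ip z c (S z) = s z c by rewrite (metric_on_sym gU).
have TE c d : T z c d = (- (r z * ip z c d)) *: S z + (r z * s z c *: d + r z * s z d *: c).
  by rewrite /Tdef !mul0r oppr0 !scale0r !add0r.
rewrite (curvature_gb KD fI srho szero Dpos0 gbE0 _ _ _ _ Uz).
rewrite !(covTE KD rho fI szero _ _ _ _ Uz) dA0 dB0 /dk /zero1 dk10.
rewrite !hS !TE !s0E !bilE -!s0E !SE !SEr !sS !dr_ !(metric_on_sym gU v u Uz) /gram.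
have D0 c : 'D_c (fun=> 0 : R) z = 0 by exact: derive_cst.
rewrite !D0.
rewrite -[r z * mu / p z]mulrA; move: (mu / p z) => c.
move: (derive1 (derive1 rho) (f z) : R) => r2; rewrite (sformC g b z u v) !sform_diag.
ring.
Qed.

(* The exponent rho of a conformal factor e^(2 rho(b^2)) yielding constant
   curvature mub satisfies these two equations at t = b^2. *)
Definition conformal_ode (mub t : R) :=
  mu - 4 * derive1 rho t * (a ^+ 2 - mu * t)
     - 4 * derive1 rho t ^+ 2 * (t * (a ^+ 2 - mu * t)) = mub * expR (rho t) ^+ 2 /\
  2 * (a ^+ 2 - mu * t) * (derive1 (derive1 rho) t - derive1 rho t ^+ 2)
    = mu * derive1 rho t.

Lemma conformal_ode_sectional z mub : regular z ->
  (forall u v, row_free (col_mx u v) -> sectional gb z u v = mub) ->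
  conformal_ode mub (f z).
Proof.
move=> reg ccb; have [Uz f0 p0] := reg.
have K u v : (mu - 2 * r z * p z - r z ^+ 2 * (f z * p z) - mub * e z) * gram g z u v =
  (4 * derive1 (derive1 rho) (f z) - r z ^+ 2 - r z * mu / p z)
    * (s z u ^+ 2 * ip z v v + s z v ^+ 2 * ip z u u - 2 * s z u * s z v * ip z u v).
  have := const_sectional metric_on_conformal Uz ccb u v v u.
  rewrite /cform !bil_conformal // curvature_conformal // (metric_on_sym gU v u Uz).
  have e0 : e z != 0 by rewrite gt_eqF // efac_gt0.
  move=> H; have := mulfI e0; move=> inj.
  have {}H : (mu - 2 * r z * p z - r z ^+ 2 * (f z * p z)) * gram g z u v -
   (4 * derive1 (derive1 rho) (f z) - r z ^+ 2 - r z * mu / p z) *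
   (s z u ^+ 2 * ip z v v + s z v ^+ 2 * ip z u u - 2 * s z u * s z v * ip z u v)
    = mub * e z * gram g z u v.
    by apply: inj; rewrite H /gram; ring.
  by rewrite mulrBl -H; ring.
have [y [y0 by0 Sy0]] := exists_orthogonal (b z) (s_row g b z) (kd_n KD).
have sy0 : s z y = 0 by [].
have N0 : ip z y y != 0 by rewrite gt_eqF // (metric_on_pos gU).
have SS : ip z (S z) (S z) = f z * p z by exact: (normS gU str).
have sS : s z (S z) = f z * p z by exact: (s0_S gU str).
have ySz : ip z y (S z) = 0 by rewrite (metric_on_sym gU) // (bil_S b gU).
have JyJy : ip z (J z y) (J z y) = a ^+ 2 * ip z y y.
  rewrite (bil_J b gU) // sformC -(bil_J b gU) // (JJ gU str) // by0 sy0.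
  by rewrite !mulr0 !scale0r !addr0 bilZl; ring.
have yJy : ip z y (J z y) = 0 by rewrite (metric_on_sym gU) // (bil_J b gU) // sform_diag.
have sJy : s z (J z y) = 0 by rewrite (s0_J gU str) // by0 mulr0.
have E1 : mu - 2 * r z * p z - r z ^+ 2 * (f z * p z) - mub * e z = 0.
  have := K y (J z y); rewrite /gram sy0 sJy yJy JyJy.
  rewrite !(mulr0, mul0r, expr0n, addr0, subr0) /= => /eqP.
  have nz : ip z y y * (a ^+ 2 * ip z y y) != 0.
    exact: (mulf_neq0 N0 (mulf_neq0 (expf_neq0 2 (kd_a KD)) N0)).
  by rewrite mulf_eq0 (negbTE nz) orbF => /eqP.
have E2 : 4 * derive1 (derive1 rho) (f z) - r z ^+ 2 - r z * mu / p z = 0.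
  have := K y (S z); rewrite E1 mul0r sy0 ySz sS.
  rewrite !(mulr0, mul0r, expr0n, add0r, addr0, subr0) /= => /esym/eqP.
  have nz : (f z * p z) ^+ 2 * ip z y y != 0.
    exact: (mulf_neq0 (expf_neq0 2 (mulf_neq0 f0 p0)) N0).
  by rewrite mulf_eq0 (negbTE nz) orbF => /eqP.
split; first by move: E1; rewrite /dr /efac /pfun; lra.
move: E2; rewrite -/(p z) /dr => /(congr1 (fun t => t * p z)); rewrite mul0r mulrBl divfK //.
by move: (p z) => P; lra.
Qed.

Lemma sectional_conformal_ode z mub : regular z -> conformal_ode mub (f z) ->
  forall u v, bil (gb z) (curvature gb z u v v) u = mub * gram gb z u v.
Proof.
move=> reg [E1 E2] u v; have [Uz f0 p0] := reg.
rewrite /gram !bil_conformal // curvature_conformal //.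
have -> : mu - 2 * r z * p z - r z ^+ 2 * (f z * p z) = mub * e z.
  by rewrite /efac -E1 /dr /pfun; ring.
have -> : 4 * derive1 (derive1 rho) (f z) - r z ^+ 2 - r z * mu / p z = 0.
  apply: (mulIf p0); rewrite mul0r mulrBl divfK // /dr.
  by move: E2; rewrite -/(p z); move: (p z) => P; lra.
rewrite /gram; ring.
Qed.

(** Multiplied by the Gram determinant, the claim is the vanishing of a smooth function, for which
    the dense set of regular points suffices. *)
Lemma conformal_sectional mub : (forall z, regular z -> conformal_ode mub (f z)) ->
  forall z, U z -> forall u v, row_free (col_mx u v) -> sectional gb z u v = mub.
Proof.
move=> ode z Uz u v fr; apply/(sectional_cform metric_on_conformal mub Uz fr).
apply/eqP; rewrite -subr_eq0; apply/eqP.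
pose F x := cform gb x u v v u - mub * gram gb x u v.
rewrite -/(F z); apply: (regular_eq0 KD _ _ Uz).
  apply: smooth_onD => //.
    apply: smooth_bil => //; first exact: (metric_on_smooth metric_on_conformal).
      exact: (smooth_curvature metric_on_conformal).
    exact: smooth_mx_cst.
  apply: smooth_onN => //; apply: smooth_onM => //; first exact: smooth_on_cst.
  exact: (smooth_gram metric_on_conformal).
by move=> x reg; rewrite /F /cform (sectional_conformal_ode reg (ode _ reg)) subrr.
Qed.

End Conformal.

(** * The deformed Killing form and its structure equation *)

Section DeformedKilling.
Context {R : realType} {n : nat}.
Local Notation V := 'rV[R]_n.
Variables (U : set V) (g : V -> 'M[R]_n) (b : V -> V) (mu a : R).
Hypothesis KD : killing_data U g b mu a.
Variables (gb : V -> 'M[R]_n) (bb : V -> V) (I : set R) (rho : R -> R) (k : R).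
Local Notation f := (sqlen g b).
Hypothesis fI : forall z, U z -> I (f z).
Hypothesis srho : smooth1_on I rho.
Hypothesis gbE : forall z, U z -> gb z = efac g b rho z *: g z.
Hypothesis bbE : forall z, U z -> bb z = (k * efac g b rho z) *: b z.
Implicit Types (z u v w x y : V).

Let gU := kd_metric KD.
Let sb := kd_smooth KD.
Let kb := kd_killing KD.
Let str := kd_structure KD.
Let oU : open U := metric_on_open gU.
Let gbU := metric_on_conformal KD fI srho gbE.

Local Notation s := (s0 g b).
Local Notation X := (Xf g b).
Local Notation S := (Sf g b).
Local Notation J := (Jf g b).
Local Notation ip z := (bil (g z)).
Local Notation bf z := (dot (b z)).
Local Notation sf z := (bil (sform g b z)).
Local Notation p := (pfun g b mu a).
Local Notation regular := (regular U g b mu a).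
Local Notation e := (efac g b rho).
Local Notation r := (dr g b rho).

Lemma smooth_bb : smooth_mx_on U bb.
Proof.
move=> i j; apply: (eq_smooth_on (f := fun z => (k * e z) * b z i j)) => //.
  by move=> z Uz; rewrite bbE // mxE.
have sk : smooth_on U (fun z => k * e z).
  by apply: smooth_onM => //; [exact: smooth_on_cst|exact: (smooth_efac KD fI srho)].
exact: (smooth_onM oU sk (sb i j)).
Qed.

(** The derivative of e contributes 2 r s(u) b(v) and the change of connection - r (s(u) b(v) + s(v)
    b(u)), its S-term being killed by b(S) = 0. The sum is antisymmetric precisely for the factor k
    e^(2 rho). *)
Lemma cov_mx_bb z u v : U z -> bil (cov_mx gb bb z) v u =
  k * e z * (sf z v u + r z * (s z u * bf z v - s z v * bf z u)).
Proof.
move=> Uz; rewrite (cov_mxE gbU smooth_bb) //.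
have D := isdM (isdM (isd_cst z u k) (isd_efac KD fI srho u Uz))
  (isd_form gU sb kb Uz (is_cov_cst g z u v)).
have -> : 'D_u (fun x => dot (bb x) v) z = 'D_u (fun x => k * e x * bf x v) z.
  by apply: near_eq_derive; apply: (near_eq_open oU) Uz => y Uy; rewrite bbE // dotZl.
rewrite (@derive_val _ _ _ _ _ _ _ D) bbE // dotZl (Gam_conformal KD fI srho gbE) //.
rewrite !dotE (form_S b gU) //; ring.
Qed.

Lemma killing_bb z : U z -> forall i j, cov gb bb i j z + cov gb bb j i z = 0.
Proof.
move=> Uz i j; have E c d : cov gb bb c d z = bil (cov_mx gb bb z) (delta_mx 0 c) (delta_mx 0 d).
  by rewrite bil_delta mxE.
by rewrite !E !cov_mx_bb // (sformC g b z (delta_mx 0 i)); ring.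
Qed.

Lemma sform_bb z u v : U z -> bil (sform gb bb z) v u =
  k * e z * (sf z v u + r z * (s z u * bf z v - s z v * bf z u)).
Proof. by move=> Uz; rewrite -(killing_cov_mx killing_bb) // cov_mx_bb. Qed.

Lemma Xf_bb z : U z -> Xf gb bb z = k *: X z.
Proof.
move=> Uz; apply: (metric_on_inj gbU Uz) => w.
rewrite (bil_X bb gbU) // bbE // dotZl (bil_conformal gbE) // bilZl (bil_X b gU) //; ring.
Qed.

Lemma sqlen_bb z : U z -> sqlen gb bb z = k ^+ 2 * e z * f z.
Proof.
move=> Uz; rewrite (sqlenX bb gbU) // Xf_bb // bbE // dotZl dotZr -(sqlenX b gU) //; ring.
Qed.

Lemma s0_bb z w : U z -> s0 gb bb z w = k ^+ 2 * e z * (1 + r z * f z) * s z w.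
Proof.
move=> Uz; rewrite s0E sform_bb // Xf_bb // !s0E !bilE dotZr sform_diag -(sqlenX b gU) //.
by rewrite -!s0E; ring.
Qed.

Lemma Jf_bb z u : U z -> Jf gb bb z u =
  k *: (J z u + r z *: (s z u *: X z - bf z u *: S z)).
Proof.
move=> Uz; apply: (metric_on_inj gbU Uz) => w.
rewrite (bil_J bb gbU) // sform_bb // (bil_conformal gbE) // !bilE.
by rewrite (bil_J b gU) // (bil_X b gU) // (bil_S b gU) // -s0E; ring.
Qed.

Lemma t00_bb z y : U z -> p z != 0 -> t00 gb bb z y = - (k ^+ 2 * e z) *
  (a ^+ 2 * ip z y y - mu * bf z y ^+ 2 - mu / p z * s z y ^+ 2
   + r z ^+ 2 * f z * s z y ^+ 2 + r z ^+ 2 * (f z * p z) * bf z y ^+ 2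
   + 2 * r z * s z y ^+ 2 + 2 * r z * p z * bf z y ^+ 2).
Proof.
move=> Uz p0; rewrite (t00E bb gbU) // (bil_J bb gbU) // sformC -(bil_J bb gbU) //.
rewrite Jf_bb // (bil_conformal gbE) //.
have JJy : ip z (J z y) (J z y) =
    a ^+ 2 * ip z y y - mu * bf z y ^+ 2 - mu / p z * s z y ^+ 2.
  rewrite (bil_J b gU) // sformC -(bil_J b gU) // (JJ gU str) // !bilE.
  by rewrite (bil_X b gU) // (bil_S b gU) // -s0E; move: (mu / p z) => c; ring.
have JX : ip z (J z y) (X z) = s z y by rewrite (bil_J b gU).
have JS : ip z (J z y) (S z) = - p z * bf z y.
  by rewrite (metric_on_sym gU) // (bil_S b gU) // -s0E (s0_J gU str).
have XX : ip z (X z) (X z) = f z by rewrite -(sqlen_bil b gU).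
have SS : ip z (S z) (S z) = f z * p z by exact: (normS gU str).
have XS : ip z (X z) (S z) = 0 by rewrite (bil_X b gU) // (form_S b gU).
have C u v := metric_on_sym gU u v Uz.
rewrite !bilE JJy (C (X z) (J z y)) (C (S z) (J z y)) (C (S z) (X z)) JX JS XX SS XS.
by move: (mu / p z) => c; ring.
Qed.

Variables (mub ab : R).
Hypothesis ode : forall z, regular z -> conformal_ode mu a rho mub (f z).
Hypotheses (k0 : k != 0) (abE : ab ^+ 2 = (k * a) ^+ 2).
Local Notation pb := (pfun gb bb mub ab).

(** The barred structure equation without its quotient term, after the two terms mubar bbar^2
    alphabar^2 have cancelled. *)
Definition barred_sum z y : R := t00 gb bb z y + ab ^+ 2 * bil (gb z) y y
  - mub * dot (bb z) y ^+ 2.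

Lemma pb_regular z : regular z -> pb z = k ^+ 2 * p z * (1 + r z * f z) ^+ 2.
Proof.
move=> reg; have [Uz f0 p0] := reg; have [E1 _] := ode reg.
rewrite /pfun sqlen_bb // abE /dr.
have := congr1 (fun t => k ^+ 2 * f z * t) E1; rewrite /efac /=; lra.
Qed.

(** The equation cleared of its denominator is an identity between smooth functions; it is checked
    at the regular points of the original pair and extended by density, also to zeros of [pb]. *)
Lemma barred_structure z y : U z -> pb z * barred_sum z y = mub * s0 gb bb z y ^+ 2.
Proof.
move=> Uz; apply/eqP; rewrite -subr_eq0; apply/eqP.
pose F x := pb x * barred_sum x y - mub * s0 gb bb x y ^+ 2.
rewrite -/(F z); apply: (regular_eq0 KD _ _ Uz).
  apply: smooth_onD => //.
    apply: smooth_onM => //; first exact: (smooth_pfun _ _ gbU smooth_bb).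
    apply: smooth_onD => //.
      apply: smooth_onD => //; first exact: (smooth_t00 gbU smooth_bb).
      apply: smooth_onM => //; first exact: smooth_on_cst.
      exact: (smooth_metric_bil gbU).
    apply: smooth_onN => //; apply: smooth_onM => //; first exact: smooth_on_cst.
    by apply: smooth_onM => //; exact: (smooth_form gbU smooth_bb).
  apply: smooth_onN => //; apply: smooth_onM => //; first exact: smooth_on_cst.
  by apply: smooth_onM => //; exact: (smooth_s0 gbU smooth_bb).
move=> x reg; have [Ux f0 p0] := reg; have [E1 _] := ode reg.
rewrite /F pb_regular // s0_bb // /barred_sum t00_bb // abE (bil_conformal gbE) //.
rewrite bbE // dotZl.
have E : mub * e x = mu - 2 * r x * p x - r x ^+ 2 * (f x * p x).
  by move: E1; rewrite /dr /efac /pfun; lra.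
have cp : (mu / p x) * p x = mu by rewrite divfK.
move: E cp; move: (mu / p x) (e x) => c e'; move=> E cp.
(* The terms in g(y, y) cancel. The brackets of b(y)^2 and s(y)^2 both vanish by the first conformal
   equation, the second once c p is replaced by mu. *)
have -> : k ^+ 2 * p x * (1 + r x * f x) ^+ 2 *
  (- (k ^+ 2 * e') * (a ^+ 2 * ip x y y - mu * bf x y ^+ 2 - c * s x y ^+ 2
    + r x ^+ 2 * f x * s x y ^+ 2 + r x ^+ 2 * (f x * p x) * bf x y ^+ 2
    + 2 * r x * s x y ^+ 2 + 2 * r x * p x * bf x y ^+ 2)
    + (k * a) ^+ 2 * (e' * ip x y y) - mub * (k * e' * bf x y) ^+ 2)
  - mub * (k ^+ 2 * e' * (1 + r x * f x) * s x y) ^+ 2 =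
  k ^+ 4 * e' * (1 + r x * f x) ^+ 2 * (
    p x * bf x y ^+ 2 * (mu - 2 * r x * p x - r x ^+ 2 * (f x * p x) - mub * e')
    + s x y ^+ 2 * (c * p x - 2 * r x * p x - r x ^+ 2 * (f x * p x) - mub * e')).
  ring.
by rewrite cp E subrr !mulr0 addr0 mulr0.
Qed.

(* On an open set where [pb] vanishes, [1 + 2 rho' t = 0], which contradicts the
   second equation of the system. *)
Lemma pb_neq0_dense z : U z -> closure [set w | pb w != 0] z.
Proof.
move=> Uz B /nbhs_interior Bz.
have [w [Bw reg]] := regular_dense gU sb kb str (kd_a KD)
  (ltn_trans (isT : (0 < 2)%N) (kd_n KD)) Uz Bz.
have [Uw f0 p0] := reg.
have [[y [By py]]|nex] := pselect (exists y, B y /\ pb y != 0); first by exists y.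
exfalso.
have sp := smooth_pfun mu a gU sb; have sfl := smooth_sqlen gU sb.
have nW : \forall y \near w, [/\ B y, regular y & pb y = 0].
  have pc : p y @[y --> w] --> p w by exact: (smooth_on_continuous sp Uw).
  have fc : f y @[y --> w] --> f w by exact: (smooth_on_continuous sfl Uw).
  have np := cvgr_neq0 _ pc p0; have nf := cvgr_neq0 _ fc f0.
  near=> y; have By : B y by near: y.
  have Uy : U y by near: y; exact: open_nbhs_nbhs.
  have fy : f y != 0 by near: y; exact: nf.
  have py : p y != 0 by near: y; exact: np.
  split=> //.
  by apply/eqP/negPn/negP => pby; apply: nex; exists y.
have q0 : \forall y \near w, (fun y => 1 + r y * f y) y = (fun=> 0) y.
  near=> y; have [_ regy pby] : [/\ B y, regular y & pb y = 0] by near: y.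
  have [Uy fy py] := regy; move: pby; rewrite pb_regular // => /eqP.
  rewrite mulf_eq0 (negbTE (mulf_neq0 (expf_neq0 2 k0) py)) /= sqrf_eq0.
  by move/eqP.
have qw : 1 + r w * f w = 0 by exact: (nbhs_singleton q0).
(* The relation 1 + r f = 0 is differentiated along S, in which direction b^2 has the nonzero
   derivative 2 f p. *)
have D := isdD (isd_cst w (S w) 1) (isdM
  (smooth_on_derivable (S w) (smooth_dr KD fI srho) Uw) (isd_sqlen gU sb kb (S w) Uw)).
have := near_eq_derive (S w) q0.
rewrite (@derive_val _ _ _ _ _ _ _ D) derive_cst (derive_dr KD fI srho) //.
rewrite (s0_S gU str) // add0r => E.
have fp0 : f w * p w != 0 by rewrite mulf_neq0.
have [_ E2] := ode reg.
move: E E2 qw f0 fp0; rewrite /dr -/(p w).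
have : p w = a ^+ 2 - mu * f w by [].
move: (p w) (f w) (derive1 (derive1 rho) _) (derive1 rho _) => P F r2 r1.
move=> PE E E2 q F0 FP0.
have {}E : r2 * F + r1 = 0.
  have nz : 4 * (F * P) != 0 by rewrite mulf_neq0 // pnatr_eq0.
  by apply: (mulfI nz); rewrite mulr0 -[RHS]E; ring.
(* At t = b^2 the relations give rho' = - 1 / (2 t) and rho'' = 1 / (2 t^2); the second conformal
   equation then reads p = - mu t, and p + mu t = a^2. *)
have : a ^+ 2 = 0.
  have H1 := congr1 (fun t => t * F ^+ 2) E2.
  have H2 := congr1 (fun t => t * (2 * P * F)) E.
  have H3 := congr1 (fun t => t * P) q.
  have H4 := congr1 (fun t => t * (P * r1 * F)) q.
  have H5 := congr1 (fun t => t * (mu * F)) q.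
  by move: H1 H2 H3 H4 H5 PE => /=; lra.
by move/eqP; rewrite sqrf_eq0 (negbTE (kd_a KD)).
Unshelve. all: by end_near. Qed.

Lemma structure_eq_bb z y : U z -> structure_eq gb bb ab mub z y.
Proof.
move=> Uz.
have total L : t00 gb bb z y + (ab ^+ 2 - mub * sqlen gb bb z) * metric_fun gb z y ^+ 2
      + mub * (sqlen gb bb z * metric_fun gb z y ^+ 2 - form_fun bb z y ^+ 2)
      - mub * L = barred_sum z y - mub * L.
  by rewrite (metric_fun_sqr gbU) // form_funE /barred_sum; ring.
have [pb0|pb0] := eqVneq (pb z) 0; last first.
  exists (s0 gb bb z y ^+ 2 / pb z); first by rewrite /quotient_value -/(pb z) pb0.
  rewrite total; apply: (mulfI pb0).
  rewrite mulr0 mulrBr barred_structure //; move: (_ ^+ 2) => Q.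
  by rewrite mulrCA [pb z * _]mulrC divfK // subrr.
(* For mubar = 0 the denominator is the constant abar^2 = (k a)^2, which does not vanish. *)
have mub0 : mub != 0.
  apply: contraTneq isT => m0; move: pb0; rewrite /pfun m0 mul0r subr0 abE => /eqP.
  by rewrite sqrf_eq0 mulf_eq0 (negbTE k0) (negbTE (kd_a KD)).
(* Off the zeros of [pb], the quotient equals this continuous function by [barred_structure], so its
   value at [z] is the limit. *)
exists (mub^-1 * barred_sum z y); last by rewrite total mulVKf // subrr.
rewrite /quotient_value -/(pb z) pb0 eqxx /=; split.
  exact: (@within_nbhs_proper _ _ _ (pb_neq0_dense Uz)).
have sB : smooth_on U (fun w => mub^-1 * barred_sum w y).
  apply: smooth_onM => //; first exact: smooth_on_cst.
  apply: smooth_onD => //.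
    apply: smooth_onD => //; first exact: (smooth_t00 gbU smooth_bb).
    apply: smooth_onM => //; first exact: smooth_on_cst.
    exact: (smooth_metric_bil gbU).
  apply: smooth_onN => //; apply: smooth_onM => //; first exact: smooth_on_cst.
  by apply: smooth_onM => //; exact: (smooth_form gbU smooth_bb).
have cB : mub^-1 * barred_sum w y @[w --> z] --> mub^-1 * barred_sum z y.
  exact: (smooth_on_continuous sB Uz).
apply/cvgrPdist_lt => eps eps0; rewrite near_withinE; near=> w => pw.
have Uw : U w by near: w; exact: open_nbhs_nbhs.
have -> : s0 gb bb w y ^+ 2 / (ab ^+ 2 - mub * sqlen gb bb w) = mub^-1 * barred_sum w y.
  rewrite -/(pb w); apply: (mulIf pw); rewrite divfK // -mulrA [barred_sum w y * _]mulrC.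
  by rewrite barred_structure // mulKf.
by near: w; move/cvgrPdist_lt : cB; apply.
Unshelve. all: by end_near. Qed.
End DeformedKilling.

(** * Integration of the equations for rho *)

Section ConformalFactor.
Context {R : realType}.
Implicit Types (J : set R) (t : R).

Lemma const_of_derive0 J (h : R -> R) : is_interval J ->
  (forall t, J t -> is_derive t 1 h 0) -> forall s t, J s -> J t -> h s = h t.
Proof.
move=> iJ dh s t; wlog st : s t / s <= t.
  by move=> H Js Jt; have [/H|/ltW /H] := lerP s t; [exact|move=> ->].
move=> Js Jt.
have inJ c : c \in `[s, t] -> J c by rewrite in_itv /= => /(iJ s t Js Jt c).
have [| |c _] := @MVT_segment _ h (fun=> 0) s t st.
- by move=> c cst; apply/dh/inJ; exact: subset_itv_oo_cc.
- apply: derivable_within_continuous => c cst.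
  by have Dc := dh c (inJ c cst); exact: ex_derive.
by rewrite mul0r => /eqP; rewrite subr_eq0 => /eqP.
Qed.

(** If u' / psi' is a constant D, then u - D psi is a constant C. It is used for u = e^(- rho), with
    psi the identity or sqrt p. *)
Lemma affine_of_derive J (u u1 psi psi1 : R -> R) : is_interval J -> J !=set0 ->
  (forall t, J t -> is_derive t 1 u (u1 t)) ->
  (forall t, J t -> is_derive t 1 psi (psi1 t)) ->
  (forall t, J t -> psi1 t != 0) ->
  (forall t, J t -> is_derive t 1 (fun s => u1 s / psi1 s) 0) ->
  exists C D, forall t, J t -> u t = C + D * psi t /\ u1 t = D * psi1 t.
Proof.
move=> iJ [t0 Jt0] du dpsi psi0 dq; pose D := u1 t0 / psi1 t0.
have qD t : J t -> u1 t = D * psi1 t.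
  by move=> Jt; rewrite /D (const_of_derive0 iJ dq Jt0 Jt) divfK // psi0.
have dC t : J t -> is_derive t 1 (fun s => u s - D * psi s) 0.
  move=> Jt.
  apply: (is_derive_eq (isdD (du t Jt) (isdN (isdM (isd_cst t 1 D) (dpsi t Jt))))).
  by rewrite mul0r add0r qD // subrr.
exists (u t0 - D * psi t0), D => t Jt; split; last exact: qD.
by rewrite (const_of_derive0 iJ dC Jt0 Jt) subrK.
Qed.

Section Equation.
Variables (mu a mub : R) (I W : set R) (rho : R -> R).
Hypothesis a0 : a != 0.
Hypotheses (srho : smooth1_on I rho) (WI : W `<=` I) (iW : is_interval W).
Hypothesis W0 : forall t, W t -> 0 <= t /\ 0 <= a ^+ 2 - mu * t.
Hypothesis W2 : exists t1 t2, [/\ W t1, W t2 & t1 != t2].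

Let phi t := Num.sqrt (a ^+ 2 - mu * t).
Let J := [set t | [/\ W t, t != 0 & a ^+ 2 - mu * t != 0]].

(** A nonnegative affine function with distinct values at the ends of a segment is positive inside.
    For t and, when mu is nonzero, for a^2 - mu t, this shows that [J] removes at most endpoints
    from [W]. *)
Lemma open_segment t t' x : W t -> W t' -> t != t' -> 0 < x < 1 ->
  J (t + x * (t' - t)).
Proof.
move=> Wt Wt' tt' /andP[x0 x1].
have [t0 pt0] := W0 Wt; have [t'0 pt'0] := W0 Wt'.
have Wx : W (t + x * (t' - t)).
  have [tt|tt] := lerP t t'.
    apply: (iW Wt Wt'); apply/andP; split; first by rewrite lerDl mulr_ge0 ?subr_ge0// ltW.
    by rewrite -lerBrDl ler_piMl ?subr_ge0 // ltW.
  apply: (iW Wt' Wt); apply/andP; split; last by rewrite gerDl mulr_ge0_le0 ?subr_le0// ltW.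
  by rewrite -lerBlDl ler_niMl ?subr_le0 ?ltW.
have lin c d : 0 <= c -> 0 <= d -> c != d -> c + x * (d - c) != 0.
  move=> c0 d0 cd; rewrite gt_eqF //.
  have -> : c + x * (d - c) = (1 - x) * c + x * d by ring.
  move: c0; rewrite le_eqVlt => /predU1P[c0|c0]; last first.
    by apply: ltr_wpDr; rewrite ?mulr_ge0 ?mulr_gt0 ?subr_gt0 // ltW.
  rewrite -c0 mulr0 add0r mulr_gt0 // lt_neqAle d0 andbT.
  by rewrite c0.
split=> //; first exact: lin.
have [mu0|mu0] := eqVneq mu 0; first by rewrite mu0 mul0r subr0 expf_neq0.
rewrite (_ : _ - _ = (a ^+ 2 - mu * t) + x * ((a ^+ 2 - mu * t') - (a ^+ 2 - mu * t))); last by ring.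
apply: lin => //; apply: contra tt'; rewrite (inj_eq (addrI _)) eqr_opp.
by rewrite (inj_eq (mulfI mu0)).
Qed.

Lemma J_nonempty : J !=set0.
Proof.
have [t1 [t2 [W1 W2' t12]]] := W2; exists (t1 + 2^-1 * (t2 - t1)).
by apply: open_segment => //; rewrite invr_gt0 ltr0n invf_lt1 ?ltr1n ?ltr0n.
Qed.

Lemma J_interval : is_interval J.
Proof.
move=> s t Js Jt x /andP[sx xt].
have [->|sx'] := eqVneq x s; first exact: Js.
have [->|xt'] := eqVneq x t; first exact: Jt.
have {sx sx'} sx : s < x by rewrite lt_neqAle eq_sym sx'.
have {xt xt'} xt : x < t by rewrite lt_neqAle xt'.
have st : 0 < t - s by rewrite subr_gt0 (lt_trans sx).
have -> : x = s + ((x - s) / (t - s)) * (t - s) by rewrite divfK ?gt_eqF// addrC subrK.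
have [Ws _ _] := Js; have [Wt _ _] := Jt.
apply: open_segment => //; first by rewrite -subr_eq0 -oppr_eq0 opprB gt_eqF.
apply/andP; split; first by rewrite divr_gt0 // subr_gt0.
by rewrite ltr_pdivrMr // mul1r ltrD2r.
Qed.

Lemma J_dense (h : R -> R) : (forall t, W t -> {for t, continuous h}) ->
  (forall t, J t -> h t = 0) -> forall t, W t -> h t = 0.
Proof.
move=> hc h0 t Wt; apply/eqP/negPn/negP => ht.
have [t' Wt' tt'] : exists2 t', W t' & t != t'.
  have [t1 [t2 [W1 W2' t12]]] := W2.
  by have [E|] := eqVneq t t1; [exists t2; rewrite ?E|exists t1].
have cl : t + x * (t' - t) @[x --> (0 : R)] --> t + 0 * (t' - t).
  by apply: cvgD; [exact: cvg_cst|apply: cvgM; [exact: cvg_id|exact: cvg_cst]].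
rewrite mul0r addr0 in cl.
have hcl : h (t + x * (t' - t)) @[x --> (0 : R)] --> h t.
  exact: (cvg_comp _ _ cl (hc t Wt)).
have [d /= d0 hd] := (nbhs_ballP _ _).1 (cvgr_neq0 _ hcl ht).
(* The first bound keeps the point where h is nonzero, the second keeps it strictly inside the
   segment, hence in [J]. *)
pose x := Num.min (d / 2) 2^-1.
have x0 : 0 < x by rewrite lt_min divr_gt0 //= invr_gt0 ltr0n.
have xd : x < d by rewrite gt_min ltr_pdivrMr // ltr_pMr // ltr1n.
have x1 : x < 1 by rewrite gt_min [X in _ || X]invf_lt1 ?ltr1n ?ltr0n // orbT.
have := hd x; rewrite -ball_normE /ball_ /= sub0r normrN gtr0_norm // => /(_ xd).
by rewrite h0 ?eqxx //; apply: open_segment; rewrite ?x0.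
Qed.

Definition explicit_factor (C D : R) :=
  (mu = 0 -> (forall t, W t -> 0 < C + D * t /\ rho t = - ln (C + D * t)) /\
     mub = 4 * C * D * a ^+ 2) /\
  (mu != 0 -> (forall t, W t -> 0 < C + D * phi t /\ rho t = - ln (C + D * phi t)) /\
     mub = (C ^+ 2 - D ^+ 2 * a ^+ 2) * mu).

(** This substitution linearizes the second equation: as u'' = (rho'^2 - rho'') u, it becomes 2 p
    u'' = mu u'. Hence u' is constant if mu = 0 and otherwise a multiple of p^(-1/2), that is of
    phi'. *)
Let u t := expR (- rho t).
Let u1 t := - derive1 rho t * u t.

Let isd_u t : I t -> is_derive t 1 u (u1 t).
Proof.
move=> It; apply: (is_derive_eq (isd_comp (is_derive_expR _) (isdN (smooth1_on_isd srho It)))).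
by rewrite /u1 /u mulrC.
Qed.

Let isd_u1 t : I t ->
  is_derive t 1 u1 ((derive1 rho t ^+ 2 - derive1 (derive1 rho) t) * u t).
Proof.
move=> It; apply: (is_derive_eq (isdM (isdN (smooth1_on_isd (smooth1_on_derive1 srho) It)) (isd_u It))).
by rewrite /u1; ring.
Qed.

Lemma isd_phi t : 0 < a ^+ 2 - mu * t -> is_derive t 1 phi (- mu * (2 * phi t)^-1).
Proof.
move=> pt.
have H : is_derive t 1 (fun s : R => a ^+ 2 - mu * s) (- mu).
  have Hm := isdM (isd_cst t 1 mu) (is_derive_id t 1).
  apply: (is_derive_eq (isdD (isd_cst t 1 (a ^+ 2)) (isdN Hm))).
  by rewrite mul0r !add0r mulr1.
have := @isd_comp _ _ t 1 Num.sqrt _ _ _ (is_derive1_sqrt pt) H.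
by rewrite mulrC.
Qed.

Let J_gt0 t : J t -> 0 < a ^+ 2 - mu * t.
Proof. by move=> [Wt _ pt]; rewrite lt_neqAle eq_sym pt; have [] := W0 Wt. Qed.

(** The formula passes from [J] to the endpoints by continuity, and the argument of the logarithm is
    positive because it equals an exponential. *)
Let extend (psi : R -> R) C D : (forall t, {for t, continuous psi}) ->
  (forall t, J t -> u t = C + D * psi t) ->
  forall t, W t -> 0 < C + D * psi t /\ rho t = - ln (C + D * psi t).
Proof.
move=> cpsi uE t Wt.
have ut : u t = C + D * psi t.
  apply/eqP; rewrite -subr_eq0; apply/eqP.
  apply: (J_dense (h := fun t => u t - (C + D * psi t))) Wt => [s Ws|s Js]; last first.
    by rewrite uE // subrr.
  apply: cvgB.
    apply: differentiable_continuous; apply/derivable1_diffP.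
    by have Du := isd_u (WI Ws); exact: ex_derive.
  by apply: cvgD; [exact: cvg_cst|apply: cvgM; [exact: cvg_cst|exact: cpsi]].
by rewrite -ut /u expR_gt0 expRK opprK.
Qed.

Lemma phi_continuous t : {for t, continuous phi}.
Proof.
apply: (@continuous_comp _ _ _ (fun s => a ^+ 2 - mu * s) Num.sqrt); last exact: sqrt_continuous.
by apply: cvgB; [exact: cvg_cst|apply: cvgM; [exact: cvg_cst|exact: cvg_id]].
Qed.

Let expE t : expR (rho t) ^+ 2 * u t ^+ 2 = 1.
Proof. by rewrite /u expRN -exprMn divff ?expr1n // gt_eqF // expR_gt0. Qed.

Lemma explicit_of_ode : (forall t, J t -> conformal_ode mu a rho mub t) ->
  exists C D, explicit_factor C D.
Proof.
move=> ode; have iJ := J_interval; have [t0 Jt0] := J_nonempty.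
have JI t : J t -> I t by move=> [Wt _ _]; exact: WI.
have u0 t : u t != 0 by rewrite gt_eqF // expR_gt0.
(* The first conformal equation times u^2, with e^(2 rho) u^2 = 1. Since mubar is constant, its
   value is read off at the single point [t0]. *)
have mubE t : J t -> mub = mu * u t ^+ 2 + 4 * u1 t * u t * (a ^+ 2 - mu * t)
    - 4 * u1 t ^+ 2 * (t * (a ^+ 2 - mu * t)).
  move=> Jt; have [E1 _] := ode t Jt.
  have := congr1 (fun c => c * u t ^+ 2) E1; rewrite /= -[RHS]mulrA expE mulr1 => <-.
  by rewrite /u1; ring.
have [mu0|mu0] := eqVneq mu 0.
  have dq t : J t -> is_derive t 1 (fun s => u1 s / 1) 0.
    move=> Jt; apply: (is_derive_eq (isdM (isd_u1 (JI t Jt)) (isd_cst t 1 1^-1))).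
    have [_] := ode t Jt; rewrite mu0 !mul0r subr0 mulr0 addr0 => /eqP.
    rewrite mulf_eq0 mulf_eq0 pnatr_eq0 /= sqrf_eq0 (negbTE a0) /= subr_eq0 => /eqP ->.
    by rewrite subrr !mul0r.
  have [C [D CD]] := affine_of_derive iJ (ex_intro _ t0 Jt0) (fun t Jt => isd_u (JI t Jt))
    (fun t _ => is_derive_id t 1) (fun _ _ => oner_neq0 R) dq.
  exists C, D; split=> [_|]; last by rewrite mu0 eqxx.
  split; first by apply: (extend (psi := id)) => [t|t /CD[]]; first exact: cvg_id.
  rewrite (mubE t0 Jt0) mu0; have [-> ->] := CD t0 Jt0; ring.
have phi0 t : J t -> phi t != 0 by move=> /J_gt0 pt; rewrite gt_eqF // sqrtr_gt0.
have phiE t : J t -> phi t ^+ 2 = a ^+ 2 - mu * t.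
  by move=> /J_gt0 pt; rewrite sqr_sqrtr // ltW.
have psi0 t : J t -> - mu * (2 * phi t)^-1 != 0.
  by move=> Jt; rewrite mulf_neq0 ?oppr_eq0 // invr_eq0 mulf_neq0 ?pnatr_eq0 // phi0.
have dq t : J t -> is_derive t 1 (fun s => u1 s / (- mu * (2 * phi s)^-1)) 0.
  move=> Jt.
  (* Division by phi' becomes multiplication by a multiple of phi. With the convention that 0 is its
     own inverse, this holds for all s, also where phi vanishes. *)
  rewrite (_ : (fun s => _) = fun s => u1 s * ((- mu)^-1 * 2 * phi s)); last first.
    by apply/funext => s; rewrite invfM invrK !mulrA.
  apply: (is_derive_eq (isdM (isd_u1 (JI t Jt))
    (isdM (isd_cst t 1 ((- mu)^-1 * 2)) (isd_phi (J_gt0 Jt))))).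
  have [_ E2] := ode t Jt; rewrite mul0r add0r /u1.
  have -> : (derive1 rho t ^+ 2 - derive1 (derive1 rho) t) =
      - (mu * derive1 rho t) / (2 * phi t ^+ 2).
    have nz : 2 * phi t ^+ 2 != 0 by rewrite mulf_neq0 ?pnatr_eq0 // expf_neq0 // phi0.
    by apply: (mulIf nz); rewrite divfK // -E2 phiE //; ring.
  by have := phi0 t Jt; move: (phi t) (u t) (derive1 rho t) => F c r F0; field; rewrite F0 mu0.
have [C [D CD]] := affine_of_derive iJ (ex_intro _ t0 Jt0) (fun t Jt => isd_u (JI t Jt))
  (fun t Jt => isd_phi (J_gt0 Jt)) psi0 dq.
exists C, D; split=> [/eqP|_]; first by rewrite (negbTE mu0).
split; first by apply: (extend (psi := phi)) => [t|t /CD[]]; first exact: phi_continuous.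
rewrite (mubE t0 Jt0); have [-> ->] := CD t0 Jt0.
have := phi0 t0 Jt0; have := phiE t0 Jt0; move: (phi t0) => F FE F0.
rewrite -FE; have -> : t0 = (a ^+ 2 - F ^+ 2) / mu by rewrite FE; field.
by field; rewrite F0 mu0.
Qed.

Lemma derive_neg_ln (O : set R) (w w1 : R -> R) w2 t : open O -> O t ->
  (forall s, O s -> [/\ rho s = - ln (w s), 0 < w s & is_derive s 1 w (w1 s)]) ->
  is_derive t 1 w1 w2 ->
  derive1 rho t = - w1 t / w t /\
  derive1 (derive1 rho) t = - w2 / w t + (w1 t / w t) ^+ 2.
Proof.
move=> oO Ot Ow dw1.
have d1 s : O s -> derive1 rho s = - ((w s)^-1 * w1 s).
  move=> Os; have [_ ws dw] := Ow s Os; rewrite derive1E; apply: derive_val.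
  apply: (near_eq_is_derive _ (isdN (isd_comp (is_derive1_ln ws) dw))).
  by near=> y; have [-> _ _] : [/\ rho y = - ln (w y), 0 < w y & is_derive y 1 w (w1 y)]
    by apply: Ow; near: y; exact: open_nbhs_nbhs.
have [_ wt dw] := Ow t Ot; have w0 : w t != 0 by rewrite gt_eqF.
split; first by rewrite d1 // mulrC mulNr.
have dV : is_derive t 1 (fun s => (w s)^-1) (- (w t) ^- 2 * w1 t) by exact: is_deriveV.
rewrite derive1E.
have -> : 'D_1 (derive1 rho) t = 'D_1 (fun s => - ((w s)^-1 * w1 s)) t.
  by apply: near_eq_derive; near=> s; apply: d1; near: s; exact: open_nbhs_nbhs.
rewrite (@derive_val _ _ _ _ _ _ _ (isdN (isdM dV dw1))).
by field.
Unshelve. all: by end_near. Qed.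

(** The formula for rho is available on [W] only, so it determines rho' and rho'' at [t] only when
    [W] is a neighbourhood of [t]. *)
Lemma ode_of_explicit C D : explicit_factor C D ->
  forall t, J t -> nbhs t W -> conformal_ode mu a rho mub t.
Proof.
move=> [E0 E1] t Jt nW; have [Wt t0 pt0] := Jt; have pt := J_gt0 Jt.
have Wi : W° t by exact: nbhs_singleton (nbhs_interior nW).
have expln x : 0 < x -> expR (- ln x) ^+ 2 = x ^- 2.
  by move=> x0; rewrite expRN lnK // exprVn.
rewrite /conformal_ode; have [mu0|mu0] := eqVneq mu 0.
  have {E0} [rhoE ->] := E0 mu0.
  have [wt rt] := rhoE t Wt.
  have [|-> ->] := @derive_neg_ln W° (fun s => C + D * s) (fun=> D) 0 t (open_interior _) Wi _ (isd_cst _ _ _).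
    move=> s /interior_subset Ws; have [ws rs] := rhoE s Ws; split=> //.
    apply: (is_derive_eq (isdD (isd_cst s 1 C) (isdM (isd_cst s 1 D) (is_derive_id s 1)))).
    by rewrite mul0r !add0r mulr1.
  rewrite rt expln // mu0; move: wt; set x := C + D * t => wt.
  have x0 : x != 0 by rewrite gt_eqF.
  have -> : C = x - D * t by rewrite /x addrK.
  by split; field.
have {E1} [rhoE ->] := E1 mu0.
have phi0 s : 0 < a ^+ 2 - mu * s -> phi s != 0 by move=> ps; rewrite gt_eqF // sqrtr_gt0.
pose O := W° `&` [set s | 0 < a ^+ 2 - mu * s].
have oO : open O.
  apply: openI; first exact: open_interior.
  rewrite (_ : [set s | _] = (fun s => a ^+ 2 - mu * s) @^-1` [set x | 0 < x]) //.
  apply: open_comp; last exact: open_gt.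
  by move=> s _; apply: cvgB; [exact: cvg_cst|apply: cvgM; [exact: cvg_cst|exact: cvg_id]].
have [wt rt] := rhoE t Wt.
have dphi := isd_phi pt; have F0 := phi0 t pt.
have FE : phi t ^+ 2 = a ^+ 2 - mu * t by rewrite sqr_sqrtr // ltW.
have F20 : 2 * phi t != 0 by rewrite mulf_neq0 // pnatr_eq0.
have D2 : is_derive t 1 (fun s => D * (- mu * (2 * phi s)^-1)) (- D * mu ^+ 2 / (4 * phi t ^+ 3)).
  have H := isdM (isd_cst t 1 (2 : R)) dphi.
  have HV : is_derive t 1 (fun s => (2 * phi s)^-1)
    (- (2 * phi t) ^- 2 * (0 * phi t + 2 * (- mu * (2 * phi t)^-1))) by exact: is_deriveV.
  apply: (is_derive_eq (isdM (isd_cst t 1 D) (isdM (isd_cst t 1 (- mu)) HV))).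
  by move: (phi t) F0 => F F0; field.
have [|-> ->] := @derive_neg_ln O (fun s => C + D * phi s) _ _ t oO (conj Wi pt) _ D2.
  move=> s [/interior_subset Ws ps]; have [ws rs] := rhoE s Ws; split; [exact: rs|exact: ws|].
  by apply: (is_derive_eq (isdD (isd_cst s 1 C) (isdM (isd_cst s 1 D) (isd_phi ps))));
    rewrite mul0r !add0r.
rewrite rt expln // -FE; move: wt; set x := C + D * phi t => wt.
have x0 : x != 0 by rewrite gt_eqF.
have -> : C = x - D * phi t by rewrite /x addrK.
move: (phi t) F0 FE x x0 {wt} => F F0 FE x x0.
(* With t expressed by F = sqrt p and C by the argument x of the logarithm, both equations are
   rational identities in F and x. *)
have -> : t = (a ^+ 2 - F ^+ 2) / mu by rewrite FE; field.
by split; field; rewrite ?x0 ?F0 ?mu0.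
Qed.

End Equation.
End ConformalFactor.

(** * Passage to the manifold *)

Section LengthValues.
Context {R : realType} {n : nat} (M : smoothManifold R n).
Variables (alpha : metricField M) (beta : oneForm M).
Hypotheses (ra : is_riemannian alpha) (fb : is_oneForm beta).

Lemma chart_metric_on c : metric_on (chart_image c) (alpha c).
Proof.
case: ra => sa _ ta pa; split; [exact: image_open|exact: sa|exact: ta|].
by move=> z cz y y0; exact: pa.
Qed.

Lemma chart_smooth_form c : smooth_mx_on (chart_image c) (beta c).
Proof. by move=> i j; rewrite ord1; case: fb. Qed.

Lemma chart_imageP c (x : M) : dom c x -> chart_image c (Defs.coord c x).
Proof. by exists x. Qed.

(** With Q the Jacobian, b = b' Q^T and g = Q g' Q^T, so the dual vectors satisfy b g^-1 Q = b'
    g'^-1 and the Jacobians cancel. *)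
Lemma sqlen_transition c d (x : M) : dom c x -> dom d x ->
  sqlen (alpha c) (beta c) (Defs.coord c x) = sqlen (alpha d) (beta d) (Defs.coord d x).
Proof.
move=> cx dx; have ov : overlap c d (Defs.coord c x) by exists x.
have tE : transition c d (Defs.coord c x) = Defs.coord d x by rewrite /transition coordK.
have [_ tra _ _] := ra; have [_ trb] := fb.
have aE := tra c d _ ov; have bE := trb c d _ ov; rewrite tE in aE bE.
have uc := metric_on_unit (chart_metric_on c) (chart_imageP cx).
have ud := metric_on_unit (chart_metric_on d) (chart_imageP dx).
move: aE bE uc ud; rewrite /sqlen.
move: (alpha c _) (alpha d _) (beta c _) (beta d _) (jacobian _ _) => A A' B B' Q AE BE uA uA'.
have uQ : Q^T \in unitmx by move: uA; rewrite AE unitmx_mul => /andP[].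
have E : B *m invmx A *m Q = B' *m invmx A'.
  apply: (can_inj (mulmxK uA')); rewrite mulmxKV //.
  apply: (can_inj (mulmxK uQ)); rewrite -BE.
  by rewrite -!mulmxA (mulmxA Q) -AE mulVmx // mulmx1.
by rewrite {2}BE trmx_mul trmxK mulmxA E.
Qed.

(** An arbitrary choice of charts turns b^2 into a function on M; by [sqlen_transition], near x it
    agrees with the smooth expression in one fixed chart, so it is continuous. *)
Let chart_at (x : M) := sval (cid (dom_cover x)).
Let chart_atP (x : M) : dom (chart_at x) x. Proof. exact: (svalP (cid (dom_cover x))). Qed.
Let len (x : M) := sqlen (alpha (chart_at x)) (beta (chart_at x)) (Defs.coord (chart_at x) x).

Lemma sqlen_values_interval : connected [set: M] -> is_interval (sqlen_values alpha beta).
Proof.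
move=> cM; apply/connected_intervalP.
have -> : sqlen_values alpha beta = len @` [set: M].
  apply/seteqP; split=> [t [c [z [[x cx <-] ->]]]|t [x _ <-]].
    by exists x => //; rewrite /len; apply: sqlen_transition => //; exact: chart_atP.
  exists (chart_at x), (Defs.coord (chart_at x) x); split=> //.
  exact: chart_imageP (chart_atP x).
apply: connected_continuous_connected => //.
apply: continuous_subspaceT => x.
pose c := chart_at x; have cx : dom c x by exact: chart_atP.
have nc : nbhs x (dom c) by apply: open_nbhs_nbhs; split=> //; exact: dom_open.
have E : \forall y \near x, sqlen (alpha c) (beta c) (Defs.coord c y) = len y.
  by near=> y; apply: sqlen_transition; [near: y|exact: chart_atP].
have lE : len x = sqlen (alpha c) (beta c) (Defs.coord c x) by [].
rewrite /continuous_at lE; apply: cvg_trans; first exact: (near_eq_cvg E).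
apply: (@cvg_comp _ _ _ (Defs.coord c) (sqlen (alpha c) (beta c)) _ (nbhs (Defs.coord c x))); last first.
  exact: (smooth_on_continuous (smooth_sqlen (chart_metric_on c) (@chart_smooth_form c)) (chart_imageP cx)).
have := @Defs.coord_continuous _ _ M c; rewrite continuous_open_subspace; last exact: dom_open.
by move=> /(_ x); rewrite inE => /(_ cx).
Unshelve. all: by end_near. Qed.

End LengthValues.

Section RegularValues.
Context {R : realType} {n : nat}.
Local Notation V := 'rV[R]_n.
Variables (U : set V) (g : V -> 'M[R]_n) (b : V -> V) (mu a : R).
Hypothesis KD : killing_data U g b mu a.

(* b^2 has nonzero gradient at regular points. *)
Lemma regular_value_nbhs (W : set R) z : is_interval W ->
  (forall w, U w -> W (sqlen g b w)) -> regular U g b mu a z ->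
  nbhs (sqlen g b z) W.
Proof.
move=> iW UW reg; have [Uz f0 p0] := reg.
have oU := metric_on_open (kd_metric KD).
have [fp pp] := regular_gt0 (kd_metric KD) (kd_structure KD) reg.
pose S := Sf g b z; have D := isd_sqlen (kd_metric KD) (kd_smooth KD) (kd_killing KD) S Uz.
have pos : 0 < 'D_S (sqlen g b) z.
  rewrite (@derive_val _ _ _ _ _ _ _ D) (s0_S (kd_metric KD) (kd_structure KD)) //.
  by rewrite !mulr_gt0.
have quot : t^-1 *: ((sqlen g b \o shift z) (t *: S) - sqlen g b z) @[t --> 0^']
    --> 'D_S (sqlen g b) z by exact: (@ex_derive _ _ _ _ _ _ _ D).
have nU : \forall t \near (0 : R), U (t *: S + z).
  have lc : (t *: S + z) @[t --> (0 : R)] --> 0 *: S + z.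
    by apply: cvgD; [apply: cvgZr_tmp; exact: cvg_id|exact: cvg_cst].
  by rewrite scale0r add0r in lc; apply: lc; exact: open_nbhs_nbhs.
have [d /= d0 hd] := (nbhs_ballP _ _).1 (filterI (cvgr_gt _ quot _ pos) (nbhs_dnbhs nU)).
have d2 : 0 < d / 2 by rewrite divr_gt0.
(* A positive difference quotient at t = d / 2 and at t = - d / 2 gives values of b^2 on both sides
   of its value at [z]. *)
have inb t : `|t| = d / 2 -> 0 < t^-1 * (sqlen g b (t *: S + z) - sqlen g b z) /\
    U (t *: S + z).
  move=> td; apply: hd; last by rewrite -normr_gt0 td.
  by rewrite -ball_normE /ball_ /= sub0r normrN td ltr_pdivrMr // ltr_pMr // ltr1n.
have [gt Ut] := inb (d / 2) (gtr0_norm d2).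
have [lt Ut'] := inb (- (d / 2)) (etrans (normrN _) (gtr0_norm d2)).
rewrite pmulr_rgt0 ?invr_gt0 // subr_gt0 in gt.
rewrite invrN mulNr oppr_gt0 pmulr_rlt0 ?invr_gt0 // subr_lt0 in lt.
have : nbhs (sqlen g b z) `]sqlen g b (- (d / 2) *: S + z), sqlen g b (d / 2 *: S + z)[%classic.
  by apply: open_nbhs_nbhs; split; [exact: itv_open|rewrite /= in_itv /= lt gt].
apply: filterS => t; rewrite /= in_itv /= => /andP[t1 t2].
by apply: (iW _ _ (UW _ Ut') (UW _ Ut)); rewrite !ltW.
Qed.

End RegularValues.

Theorem theorem6p2 (R : realType) (n : nat) (M : smoothManifold R n)
    (alpha : metricField M) (beta : oneForm M) (mu a mubar : R)
    (I : set R) (rho kappa nu : R -> R) :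
  (2 < n)%N ->
  connected [set: M] ->
  is_riemannian alpha ->
  is_oneForm beta ->
  constant_sectional_curvature alpha mu ->
  killing alpha beta ->
  (exists t1 t2, [/\ sqlen_values alpha beta t1,
                     sqlen_values alpha beta t2 & t1 != t2]) ->
  a != 0 ->
  satisfies_structure_eq alpha beta a mu ->
  open I ->
  sqlen_values alpha beta `<=` I ->
  smooth1_on I rho -> smooth1_on I kappa -> smooth1_on I nu ->
  (forall t, sqlen_values alpha beta t -> 0 < 1 - t * kappa t) ->
  let alphabar := deform_metric rho kappa alpha beta in
  let betabar := deform_form nu alpha beta in
  (constant_sectional_curvature alphabar mubar <->
    (forall t, sqlen_values alpha beta t -> 1 - t * kappa t = 1) /\
    exists C D : R,
      (mu = 0 ->
        (forall t, sqlen_values alpha beta t ->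
           0 < C + D * t /\ rho t = - ln (C + D * t)) /\
        mubar = 4 * C * D * a ^+ 2) /\
      (mu != 0 ->
        (forall t, sqlen_values alpha beta t ->
           0 < C + D * Num.sqrt (a ^+ 2 - mu * t) /\
           rho t = - ln (C + D * Num.sqrt (a ^+ 2 - mu * t))) /\
        mubar = (C ^+ 2 - D ^+ 2 * a ^+ 2) * mu)) /\
  (constant_sectional_curvature alphabar mubar ->
    forall k : R, k != 0 ->
      (forall t, sqlen_values alpha beta t ->
         nu t = k * (1 - t * kappa t) * expR (2 * rho t)) ->
      killing alphabar betabar /\
      forall abar : R, abar = k * a \/ abar = - (k * a) ->
        satisfies_structure_eq alphabar betabar abar mubar).
Proof.
move=> n2 cM ra fb cca kba W2 a0 str _ WI srho skappa _ Dpos alphabar betabar.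
set W := sqlen_values alpha beta in W2 WI Dpos *.
have KD c : killing_data (chart_image c) (alpha c) (beta c) mu a.
  split=> //; [exact: chart_metric_on|exact: chart_smooth_form|exact: kba|exact: cca|exact: str].
pose f c := sqlen (alpha c) (beta c).
have fW c z : chart_image c z -> W (f c z) by exists c, z.
have fI c z : chart_image c z -> I (f c z) by move=> /fW/WI.
have Dp c z : chart_image c z -> 0 < 1 - f c z * kappa (f c z) by move=> /fW/Dpos.
have gbE c z : chart_image c z -> alphabar c z =
    expR (rho (f c z)) ^+ 2 *: (alpha c z - kappa (f c z) *: ((beta c z)^T *m beta c z)) by [].
have iW : is_interval W by exact: sqlen_values_interval.
have W0 t : W t -> 0 <= t /\ 0 <= a ^+ 2 - mu * t.
  move=> [c [z [cz ->]]]; split; first exact: (sqlen_ge0 _ (kd_metric (KD c)) cz).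
  exact: (pfun_ge0 (kd_metric (KD c)) (kd_structure (KD c)) cz).
have conf : (forall t, W t -> 1 - t * kappa t = 1) -> forall c z, chart_image c z ->
    alphabar c z = efac (alpha c) (beta c) rho z *: alpha c z.
  move=> D1 c z cz; rewrite gbE //; congr (_ *: _).
  (* At b^2 = 0 the condition 1 - t kappa(t) = 1 leaves kappa free, but there beta itself
     vanishes. *)
  have [f0|f0] := eqVneq (f c z) 0.
    have X0 := sqlen_eq0 (kd_metric (KD c)) cz f0.
    have -> : beta c z = 0.
      by rewrite -[LHS](mulmxKV (metric_on_unit (kd_metric (KD c)) cz)) -/(Xf _ _ _) X0 mul0mx.
    by rewrite mulmx0 scaler0 subr0.
  have k0 : kappa (f c z) = 0.
    apply: (mulfI f0); rewrite mulr0; have := D1 _ (fW c z cz); lra.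
  by rewrite k0 scale0r subr0.
have D1 : constant_sectional_curvature alphabar mubar -> forall t, W t -> 1 - t * kappa t = 1.
  move=> ccb t [c [z [cz ->]]].
  have gU := kd_metric (KD c); have oU := metric_on_open gU.
  have : f c z * kappa (f c z) = 0; last by rewrite /f => ->; rewrite subr0.
  apply: (regular_eq0 (KD c) _ _ cz (F := fun y => f c y * kappa (f c y))).
    have sf := smooth_sqlen gU (kd_smooth (KD c)).
    by apply: smooth_onM => //; exact: (smooth_on_comp oU skappa (fI c) sf).
  move=> y reg; have [cy _ _] := reg.
  have [v [v0 bv sv]] := exists_orthogonal (beta c y) (s_row (alpha c) (beta c) y) n2.
  have := transversal_kappa (KD c) (fI c) srho skappa (Dp c) (gbE c) reg bv sv v0 (ccb c y cy).
  by rewrite /dk /f => ->; rewrite mulr0.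
have ode : constant_sectional_curvature alphabar mubar -> forall c z,
    regular (chart_image c) (alpha c) (beta c) mu a z -> conformal_ode mu a rho mubar (f c z).
  move=> ccb c z reg; have [cz _ _] := reg.
  exact: (conformal_ode_sectional (KD c) (fI c) srho (conf (D1 ccb) c) reg (ccb c z cz)).
split.
  split=> [ccb|[D10 [C [D CD]]]].
    split; first exact: D1.
    apply: (explicit_of_ode a0 srho WI iW W0 W2) => t [Wt t0 pt0].
    by case: Wt t0 pt0 => c [z [cz ->]] t0 pt0; apply: (ode ccb).
  move=> c z cz u v fr.
  apply: (conformal_sectional (KD c) (fI c) srho (conf D10 c)) cz u v fr => y reg.
  have [cy f0 p0] := reg.
  apply: (ode_of_explicit W0 CD); first by split => //; exact: fW.
  exact: (regular_value_nbhs (KD c) iW (fW c) reg).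
move=> ccb k k0 nuE.
have bbE c z : chart_image c z ->
    betabar c z = (k * efac (alpha c) (beta c) rho z) *: beta c z.
  move=> cz; rewrite /betabar /deform_form -/(f c z) nuE ?(D1 ccb) //; try exact: fW.
  by rewrite mulr1 expRM_natl.
split=> [c z cz i j|ab abE c z cz y].
  exact: (killing_bb (KD c) (fI c) srho (conf (D1 ccb) c) (bbE c) cz).
apply: (structure_eq_bb (KD c) (fI c) srho (conf (D1 ccb) c) (bbE c) (ode ccb c) k0) => //.
(* The constant abar enters only through its square, so both signs are covered. *)
by case: abE => ->; rewrite ?sqrrN.
Qed.
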